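(* Let $n\ge 2$ and let $m\in C^\infty(\mathbb R^n\setminus\{0\})$ be positively homogeneous of degree zero. Assume that $$\int_{\mathbb S^{n-1}}m(\sigma)\,d\sigma=0.$$ Let $M\geq 2$ and $K\geq 1$ be real numbers, and set $L=MK-1$. Then there is a constant $C>0$, depending only on fixed parameters ($n$, $m$, $M$, $K$, $\varphi$), such that for all $f,g\in L^1(\mathbb R^n)$, $$\sum_{j\in\mathbb Z}2^{-j\frac{nL}K}\bigg|\int_{\mathbb R^n}\big(\Delta_jm(D)f\big)(\Delta_jg)|\Delta_jg|^{M-2}\bigg(\sum_{i\leq j}2^{-i\frac{nL}K}|\Delta_ig|^M\bigg)^{K-1}dx\bigg|\leq C\,\|f\|_{L^1}\|g\|_{L^1}^L.$$
   Context: $\mathscr Ff(\xi)=\int_{\mathbb R^n}e^{-i\xi\cdot x}f(x)\,dx$ is the Fourier transform. A nonnegative radial function $\varphi\in C_c^\infty(\mathbb R^n\setminus\{0\})$ with $\sum_{j\in\mathbb Z}\varphi(2^{-j}\xi)=1$ for every $\xi\neq0$ is fixed, and $\Delta_j=\varphi(2^{-j}D)=\mathscr F^{-1}\varphi(2^{-j}\xi)\mathscr F$ for $j\in\mathbb Z$. $m(D)$ is the Fourier multiplier operator with symbol $m$, so that $\Delta_jm(D)f=\mathscr F^{-1}\big(\varphi(2^{-j}\xi)m(\xi)\mathscr Ff(\xi)\big)$. Positively homogeneous of degree zero means $m(t\xi)=m(\xi)$ for all $t>0$, $\xi\ne0$. $d\sigma$ is the surface measure on the unit sphere. When $K=1$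 the factor $(\cdot)^{K-1}$ is equal to $1$; the sum over $i\le j$ runs over all integers $i\leq j$. *)

(* Defs.v *)
From HB Require Import structures.
From mathcomp Require Import all_boot all_order all_algebra.
From mathcomp Require Import all_classical all_reals all_analysis.
From mathcomp Require Import measurable_realfun complex.
Set Implicit Arguments.
Unset Strict Implicit.
Unset Printing Implicit Defensive.
Import Order.TTheory GRing.Theory Num.Theory.
Import numFieldNormedType.Exports.
Import ComplexField.Normc.

Local Open Scope classical_set_scope.
Local Open Scope ring_scope.

Section euclidean.
Context {R : realType} {n : nat}.
Implicit Types x y : 'rV[R]_n.

Definition dotmul x y : R := \sum_(i < n) x 0 i * y 0 i.

(* The library norm [`|x|] on ['rV[R]_n] is the sup norm. *)
Definition enorm x : R := Num.sqrt (dotmul x x).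

Definition esphere : set 'rV[R]_n := [set x | enorm x = 1].

Definition eball : set 'rV[R]_n := [set x | enorm x <= 1].

Definition edir x : 'rV[R]_n := (enorm x)^-1 *: x.

End euclidean.

(* [s] lists the directions of differentiation, last one applied first. *)
Fixpoint partials {R : realType} {n : nat} (s : seq 'I_n)
    (f : 'rV[R]_n -> R) : 'rV[R]_n -> R :=
  if s is i :: s' then fun x => 'D_(delta_mx 0 i) (partials s' f) x else f.

(* C^oo on U, for U open *)
Definition smooth_on {R : realType} {n : nat} (U : set 'rV[R]_n)
    (f : 'rV[R]_n -> R) : Prop :=
  forall (s : seq 'I_n) (x : 'rV[R]_n), U x ->
    {for x, continuous (partials s f)} /\
    forall i : 'I_n, derivable (partials s f) x (delta_mx 0 i).

Section measurable_rV.
Context {R : realType} {n : nat}.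

Let coors : 'I_n -> 'rV[R]_n -> R := fun i x => x 0 i.

Let rV_set0 : g_sigma_preimage coors set0.
Proof. exact: sigma_algebra0. Qed.

Let rV_setC A : g_sigma_preimage coors A -> g_sigma_preimage coors (~` A).
Proof. exact: sigma_algebraC. Qed.

Let rV_bigcup (F : (set 'rV[R]_n)^nat) :
  (forall i, g_sigma_preimage coors (F i)) ->
  g_sigma_preimage coors (\bigcup_i (F i)).
Proof. exact: sigma_algebra_bigcup. Qed.

(* The product sigma-algebra, as for [n.-tuple R] in the library; it is the
   Borel sigma-algebra. *)
HB.instance Definition _ := @isMeasurable.Build default_measure_display
  'rV[R]_n (g_sigma_preimage coors) rV_set0 rV_setC rV_bigcup.

End measurable_rV.


Lemma measurable_coord {R : realType} {n : nat} (i : 'I_n) :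
  measurable_fun [set: 'rV[R]_n] (fun x : 'rV[R]_n => x 0 i).
Proof.
move=> _ Y mY; rewrite setTI; apply: sub_sigma_algebra => /=.
rewrite -bigcup_seq/=; exists i => /=; first by rewrite mem_index_enum.
by exists Y => //; rewrite setTI.
Qed.

Lemma measurable_fun_rV d (T : measurableType d) {R : realType} {n : nat}
    (f : T -> 'rV[R]_n) :
  (forall i, measurable_fun [set: T] (fun t => f t 0 i)) ->
  measurable_fun [set: T] f.
Proof.
move=> mf.
suff : g_sigma_preimage (fun i => (fun x : 'rV[R]_n => x 0 i) \o f)
    `<=` measurable.
  rewrite g_sigma_preimage_comp => prefS _ A mA.
  by apply: prefS; exists A.
apply: smallest_sub; first exact: sigma_algebra_measurable.
case: n => [|n] in f mf *; first by rewrite big_ord0.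
rewrite -bigcup_mkord_ord; apply: bigcup_sub => i Ii.
by move=> A [B mB <-]; exact: mf.
Qed.

Section lebesgue_rV.
Context {R : realType}.

Definition cons_rV {n : nat} (p : measurableTypeR R * 'rV[R]_n) : 'rV[R]_n.+1 :=
  \row_i (if unlift ord0 i is Some j then p.2 0 j else p.1).

Lemma measurable_cons_rV (n : nat) :
  measurable_fun setT (@cons_rV n).
Proof.
apply: measurable_fun_rV => i.
case: (unliftP ord0 i) => [j|] ->.
  rewrite (_ : (fun _ => _) = (fun x : 'rV[R]_n => x 0 j) \o snd); last first.
    by apply/funext => p /=; rewrite mxE liftK.
  by apply: measurableT_comp => //; exact: measurable_coord.
rewrite (_ : (fun _ => _) = fst); first exact: measurable_fst.
by apply/funext => p /=; rewrite mxE unlift_none.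
Qed.

Definition lebesgue_rV_succ {n : nat} (mu : {measure set 'rV[R]_n -> \bar R}) :
    set 'rV[R]_n.+1 -> \bar R :=
  pushforward (@lebesgue_measure R \x^ mu)%E cons_rV.

Section lebesgue_rV_succ_measure.
Context {n : nat} (mu : {measure set 'rV[R]_n -> \bar R}).

Let succ0 : lebesgue_rV_succ mu set0 = 0%E.
Proof. by rewrite /lebesgue_rV_succ /pushforward preimage_set0 measure0. Qed.

Let succ_ge0 A : (0 <= lebesgue_rV_succ mu A)%E.
Proof. by rewrite /lebesgue_rV_succ /pushforward; apply: measure_ge0. Qed.

Let succ_sigma_additive : semi_sigma_additive (lebesgue_rV_succ mu).
Proof.
by apply: measure_semi_sigma_additive; exact: measurable_cons_rV.
Qed.

HB.instance Definition _ := isMeasure.Build _ _ _ (lebesgue_rV_succ mu)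
  succ0 succ_ge0 succ_sigma_additive.

End lebesgue_rV_succ_measure.

(* n-fold product of the Lebesgue measure on R (a point mass for n = 0) *)
Fixpoint lebesgue_rV (n : nat) : {measure set 'rV[R]_n -> \bar R} :=
  if n is n'.+1 then lebesgue_rV_succ (lebesgue_rV n') else dirac (0 : 'rV[R]_0).

End lebesgue_rV.

Section surface_measure.
Context {R : realType} {n : nat}.

Lemma measurable_enorm : measurable_fun setT (@enorm R n).
Proof.
rewrite (_ : @enorm R n = (@powR R ^~ 2^-1) \o (fun x => dotmul x x)).
  apply: measurableT_comp; first exact: measurable_powR.
  apply: measurable_sum => i.
  by apply: measurable_funM; exact: measurable_coord.
apply/funext => x /=; rewrite powR12_sqrt//.
by apply: sumr_ge0 => i _; rewrite -expr2 sqr_ge0.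
Qed.

Lemma measurable_edir : measurable_fun setT (@edir R n).
Proof.
apply: measurable_fun_rV => i.
rewrite (_ : (fun _ => _) =
    (fun x : 'rV[R]_n => enorm x `^ (-1) * x 0 i)); last first.
  by apply/funext => x; rewrite !mxE powR_inv1 ?sqrtr_ge0.
apply: measurable_funM; last exact: measurable_coord.
apply: (measurableT_comp (f := @powR R ^~ (-1))); first exact: measurable_powR.
exact: measurable_enorm.
Qed.

Lemma measurable_eball : measurable (@eball R n).
Proof.
rewrite (_ : eball = [set: 'rV[R]_n] `&` enorm @^-1` `]-oo, 1]).
  by apply: measurable_enorm => //; exact: measurable_itv.
by apply/seteqP; split=> x /=; rewrite in_itv/= => // -[].
Qed.

Definition cone_measure : set 'rV[R]_n -> \bar R :=
  pushforward (mrestr (lebesgue_rV n) measurable_eball) edir.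

Let cone0 : cone_measure set0 = 0%E.
Proof. by rewrite /cone_measure /pushforward preimage_set0; exact: measure0. Qed.

Let cone_ge0 A : (0 <= cone_measure A)%E.
Proof. by rewrite /cone_measure /pushforward; apply: measure_ge0. Qed.

Let cone_sigma_additive : semi_sigma_additive cone_measure.
Proof. by apply: measure_semi_sigma_additive; exact: measurable_edir. Qed.

HB.instance Definition _ := isMeasure.Build _ _ _ cone_measure
  cone0 cone_ge0 cone_sigma_additive.

(* sigma(A) = n * |{x : |x| <= 1, x/|x| in A}| for A in the unit sphere, seen
   as a measure on R^n: the surface measure, normalized by the polar
   decomposition dx = r^(n-1) dr dsigma of the Lebesgue measure. *)
Definition surface_measure : {measure set 'rV[R]_n -> \bar R} :=
  mscale n%:R%:nng cone_measure.

End surface_measure.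

Section complex_valued.
Context {R : realType}.

Definition expi (t : R) : R[i] := (cos t +i* sin t)%C.

Definition Cintegrable d (T : measurableType d)
    (mu : {measure set T -> \bar R}) (D : set T) (f : T -> R[i]) : Prop :=
  mu.-integrable D (EFin \o (fun x => complex.Re (f x))) /\
  mu.-integrable D (EFin \o (fun x => complex.Im (f x))).

Definition Cintegral d (T : measurableType d)
    (mu : {measure set T -> \bar R}) (D : set T) (f : T -> R[i]) : R[i] :=
  ((\int[mu]_(x in D) complex.Re (f x)) +i*
   (\int[mu]_(x in D) complex.Im (f x)))%C.

End complex_valued.

Section littlewood_paley.
Context {R : realType} {n : nat}.
Implicit Types (f g a m : 'rV[R]_n -> R[i]) (phi : 'rV[R]_n -> R).

Definition L1 f : Prop := Cintegrable (lebesgue_rV n) setT f.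

Definition L1norm f : R := \int[lebesgue_rV n]_x normc (f x).

Definition fourier f (xi : 'rV[R]_n) : R[i] :=
  Cintegral (lebesgue_rV n) setT (fun x => expi (- dotmul xi x) * f x).

Definition inv_fourier g (x : 'rV[R]_n) : R[i] :=
  ((2 * pi) ^- n)%:C%C *
  Cintegral (lebesgue_rV n) setT (fun xi => expi (dotmul x xi) * g xi).

(* a(D) f; for f in L^1 the integral defining the inverse Fourier transform
   converges absolutely when the symbol a is bounded with compact support. *)
Definition multiplier a f : 'rV[R]_n -> R[i] :=
  inv_fourier (fun xi => a xi * fourier f xi).

Definition LP phi (j : int) f : 'rV[R]_n -> R[i] :=
  multiplier (fun xi => (phi ((2 : R) ^ (- j) *: xi))%:C%C) f.

(* The symbols of Delta_j and m(D) are multiplied, as in the definition of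
   Delta_j m(D) f for f in L^1. *)
Definition LPm phi m (j : int) f : 'rV[R]_n -> R[i] :=
  multiplier (fun xi => (phi ((2 : R) ^ (- j) *: xi))%:C%C * m xi) f.

Definition csmooth_on (U : set 'rV[R]_n) m : Prop :=
  smooth_on U (fun x => complex.Re (m x)) /\
  smooth_on U (fun x => complex.Im (m x)).

Definition homogeneous0 m : Prop :=
  forall (t : R) (xi : 'rV[R]_n), 0 < t -> xi != 0 -> m (t *: xi) = m xi.

Definition radial phi : Prop :=
  forall x y : 'rV[R]_n, enorm x = enorm y -> phi x = phi y.

Definition supp phi : set 'rV[R]_n := closure [set x | phi x != 0].

(* phi in C_c^oo(R^n \ {0}), extended by 0 at the origin *)
Definition test_function_off0 phi : Prop :=
  [/\ smooth_on setT phi, compact (supp phi) & ~ supp phi 0].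

Definition LP_partition phi : Prop :=
  [/\ test_function_off0 phi, forall x, 0 <= phi x, radial phi &
    forall xi : 'rV[R]_n, xi != 0 ->
      (\esum_(j in [set: int]) (phi ((2 : R) ^ (- j) *: xi))%:E = 1)%E].

(* sum_{i <= j} 2^(- i s) |Delta_i g|^M. For g in L^1 and 0 <= s < n M the sum
   is finite, as |Delta_i g| <= C 2^(i n), so that [fine] is harmless. *)
Definition low_freq_sum phi (s M : R) (j : int) g (x : 'rV[R]_n) : R :=
  fine (\esum_(i in [set i : int | (i <= j)%R])
    (2 `^ (- (i%:~R * s)) * normc (LP phi i g x) `^ M)%:E).

End littlewood_paley.

(* Main.v *)
From HB Require Import structures.
Require Import Defs.
From mathcomp Require Import all_boot all_order all_algebra.
From mathcomp Require Import all_classical all_reals all_analysis.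
From mathcomp Require Import measurable_realfun complex ring lra zify.
Set Implicit Arguments.
Unset Strict Implicit.
Unset Printing Implicit Defensive.
Import Order.TTheory GRing.Theory Num.Theory.
Import numFieldNormedType.Exports.
Import ComplexField.Normc.
Local Open Scope classical_set_scope.
Local Open Scope ring_scope.

Local Notation Re := complex.Re.
Local Notation Im := complex.Im.

(** Let psi and kap be the convolution kernels of phi(D) and phi(D) m(D). Then
    Delta_i g (x) = 2^(i n) int psi (2^i (x - y)) g y dy, and likewise for
    Delta_j m(D) with kap. Put beta = n / (K M) and
      v_i (x) = 2^((i - j) beta) int psi (2^i (x - y)) g y dy.
    The weights 2^(- i n L / K) are those for which
      2^(- j n L / K) Delta_j g |Delta_j g|^(M - 2) (sum_(i <= j) ...)^(K - 1) = F (v (x))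
    where F v = v_j |v_j|^(M - 2) (sum_(i <= j) |v_i|^M)^(K - 1) does not see the scale
    any more ([lp_nonlinearity]). Moving the kernel of Delta_j m(D) to the other factor,
    the j-th term is |int f z I_j z dz| with
      I_j z = int 2^(j n) kap (2^j (x - z)) F (v (x)) dx,
    so the estimate follows from a bound on sum_j |I_j z| uniform in z.

    Cancellation. Since m is homogeneous of degree zero and has mean zero on the
    sphere, kap is orthogonal to every radial function with a first moment
    ([kernel_cancellation]). If all the mass of g sat at the point z, then v_i (x) would be
    a multiple of psi (2^i (x - z)), radial around z, and I_j z would vanish.

    Error. Write x = z + 2^(- j) u and compare psi (2^i (x - y)) with
    psi (2^(i - j) u) when 2^j |y - z| < 1 and with 0 otherwise. For i <= j and
    t = 2^j |y - z| the difference is at most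
      C 2^((j - i) eps) (1 + |u|) min (t, 1 / t)^eps
    ([kernel_difference]): for t < 1 because psi is Lipschitz, for t >= 1 because it
    decays. With eps < beta the weights 2^((i - j) beta) still make the sum over
    i <= j converge, so v is l^1-close to its radial model. As F is Lipschitz on
    l^1-bounded sets ([nonlinearity_lipschitz]),
      |I_j z| <= C |g|_1^(L - 1) int min (2^j |y - z|, 1 / (2^j |y - z|))^eps |g y| dy
    ([scale_pairing_bound]). The sum over j of the weight is bounded uniformly in y and z
    ([esum_two_sided]), hence sum_j |I_j z| <= C |g|_1^L. *)

(** * Fubini for sigma-finite measures *)

Section sigma_finite_fubini.
Local Open Scope ereal_scope.
Context d1 d2 (T1 : measurableType d1) (T2 : measurableType d2) (R : realType).
Variables (m1 : {measure set T1 -> \bar R}) (m2 : {measure set T2 -> \bar R}).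
Hypotheses (s1 : sigma_finite setT m1) (s2 : sigma_finite setT m2).

Let s1_mixin := @isSigmaFinite.Build _ T1 R m1 s1.
Let s1_mixin' := @isSFinite.Build _ T1 R m1 (sfinite_measure_sigma_finite s1).
Let s2_mixin := @isSigmaFinite.Build _ T2 R m2 s2.
Let s2_mixin' := @isSFinite.Build _ T2 R m2 (sfinite_measure_sigma_finite s2).
(* Packing a measure with its sigma-finiteness lets the theorems on product
   measures apply to a measure known to be sigma-finite only by a hypothesis. *)
Let n1 : {sigma_finite_measure set T1 -> \bar R} := HB.pack (Measure.sort m1) s1_mixin s1_mixin'.
Let n2 : {sigma_finite_measure set T2 -> \bar R} := HB.pack (Measure.sort m2) s2_mixin s2_mixin'.

Let int1 (D : set T1) (f : T1 -> \bar R) : \int[m1]_(x in D) f x = \int[n1]_(x in D) f x.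
Proof. by apply: eq_measure_integral. Qed.

Let int2 (D : set T2) (f : T2 -> \bar R) : \int[m2]_(x in D) f x = \int[n2]_(x in D) f x.
Proof. by apply: eq_measure_integral. Qed.

Section nonneg.
Variable f : T1 * T2 -> \bar R.
Hypotheses (mf : measurable_fun setT f) (f0 : forall z, 0 <= f z).

Lemma sf_tonelli :
  \int[m1]_x \int[m2]_y f (x, y) = \int[m2]_y \int[m1]_x f (x, y).
Proof.
rewrite int1 int2; under eq_integral do rewrite int2.
by under [RHS]eq_integral do rewrite int1; exact: fubini_tonelli.
Qed.

Lemma sf_measurable_tonelli1 : measurable_fun setT (fun x => \int[m2]_y f (x, y)).
Proof.
under eq_fun do rewrite int2.
exact: (measurable_fun_fubini_tonelli_F (m2 := n2)).
Qed.

Lemma sf_measurable_tonelli2 : measurable_fun setT (fun y => \int[m1]_x f (x, y)).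
Proof.
under eq_fun do rewrite int1.
exact: (measurable_fun_fubini_tonelli_G (m1 := n1)).
Qed.

(** The product measure enters through its values alone, so that [m] may carry any
    proof that these values form a measure. *)
Lemma sf_tonelli2 (m : {measure set (T1 * T2) -> \bar R}) :
  (forall A, m A = (m1 \x^ m2) A) ->
  \int[m]_z f z = \int[m2]_y \int[m1]_x f (x, y).
Proof.
move=> mE; rewrite int2; under [RHS]eq_integral do rewrite int1.
rewrite -(fubini_tonelli2 (m1 := n1) (m2 := n2))//.
apply: eq_measure_integral => A mA _; rewrite mE.
have -> : (m1 \x^ m2) A = (n1 \x^ n2) A by apply: eq_measure_integral.
apply/esym.
pose m' : {measure set (T1 * T2) -> \bar R} := (n1 \x^ n2).
apply: (product_measure_unique (m' := m')) => // B C mB mC; exact: (product_measure2E n1 n2 mB mC).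
Qed.
End nonneg.

Section integrable.
Variable f : T1 * T2 -> \bar R.
Hypotheses (mf : measurable_fun setT f)
  (If : \int[m1]_x \int[m2]_y `|f (x, y)| < +oo).

Let If' : (n1 \x n2).-integrable setT f.
Proof.
by apply/integrable12ltyP.
Qed.

Lemma sf_fubini :
  \int[m1]_x \int[m2]_y f (x, y) = \int[m2]_y \int[m1]_x f (x, y).
Proof.
rewrite int1 int2; under eq_integral do rewrite int2.
by under [RHS]eq_integral do rewrite int1; exact: Fubini.
Qed.

Lemma sf_integrable1 : m1.-integrable setT (fun x => \int[m2]_y f (x, y)).
Proof.
have /integrableP[mF oo] := integrable_fubini_F If'.
apply/integrableP; split; last by rewrite int1; under eq_integral do rewrite int2.
by under eq_fun do rewrite int2; exact: mF.
Qed.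

Lemma sf_integrable2 : m2.-integrable setT (fun y => \int[m1]_x f (x, y)).
Proof.
have /integrableP[mF oo] : n2.-integrable setT (fun y => \int[n1]_x f (x, y)).
  have If2 := If'.
  apply/integrableP; split; first exact: (measurable_fubini_G If2).
  have := (integrable21ltyP n1 n2 mf).1 If2; apply: le_lt_trans.
  apply: ge0_le_integral => //.
  - by apply: measurableT_comp => //; exact: (measurable_fubini_G If2).
  - apply: (measurable_fun_fubini_tonelli_G (abse \o f)) => //=.
    exact: measurableT_comp.
  - move=> y _; apply: le_abse_integral => //.
    exact: measurableT_comp.
apply/integrableP; split; last by rewrite int2; under eq_integral do rewrite int1.
by under eq_fun do rewrite int1; exact: mF.
Qed.

End integrable.
End sigma_finite_fubini.

(** * Slicing the Lebesgue measure on R^n *)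

Section lebesgue_rV_theory.
Context {R : realType}.
Local Notation mu1 := (@lebesgue_measure R).
Local Notation lam := (@lebesgue_rV R).

Lemma cons_rV0 n (p : measurableTypeR R * 'rV[R]_n) : cons_rV p 0 ord0 = p.1.
Proof. by rewrite mxE unlift_none. Qed.

Lemma cons_rV_lift n (p : measurableTypeR R * 'rV[R]_n) j : cons_rV p 0 (lift ord0 j) = p.2 0 j.
Proof. by rewrite mxE liftK. Qed.

(** The boxes exhaust R^n and have finite measure: they witness sigma-finiteness and
    dominate compactly supported functions. *)
Definition box (n k : nat) : set 'rV[R]_n := [set x | forall i, `|x 0 i| <= k%:R].
Arguments box n k : clear implicits.

Lemma measurable_box n k : measurable (box n k).
Proof.
rewrite (_ : box n k = \bigcap_(i in [set: 'I_n])
   ((fun x : 'rV[R]_n => x 0 i) @^-1` `[(-k%:R), k%:R])).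
  apply: fin_bigcap_measurable => [|i _]; first exact: finite_finset.
  rewrite -[X in measurable X]setTI; exact: measurable_coord.
apply/seteqP; split => x /= h i; first by move=> _; rewrite /= in_itv/= -ler_norml.
by have := h i I; rewrite /= in_itv/= -ler_norml.
Qed.

Lemma box_fin n k : (lam n (box n k) < +oo)%E.
Proof.
elim: n k => [|n IH] k /=; first by rewrite diracE; exact: ltry.
rewrite /lebesgue_rV_succ /pushforward.
rewrite (_ : _ @^-1` _ = `[(-k%:R), k%:R]%classic `*` box n k); last first.
  apply/seteqP; split => -[t y] /= h.
    split => /=; first by have := h ord0; rewrite cons_rV0/= in_itv/= -ler_norml.
    by move=> j; have := h (lift ord0 j); rewrite cons_rV_lift.
  case: h => /= + h i; rewrite in_itv/= -ler_norml => h0.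
  by case: (unliftP ord0 i) => [j|] ->; rewrite ?cons_rV_lift ?cons_rV0//; exact: h.
have mB := @measurable_box n k.
rewrite product_measure2E//= lebesgue_measure_itv/=.
case: ifPn => _; last by rewrite mul0e ltry.
rewrite -EFinB; exact: lte_mul_pinfty.
Qed.

Lemma sigma_finite_lam n : sigma_finite setT (lam n).
Proof.
exists (box n) => [|k]; last by split; [exact: measurable_box|exact: box_fin].
apply/esym/seteqP; split => // x _.
exists (Num.truncn (\sum_i `|x 0 i|)).+1 => //= i.
apply: (le_trans _ (ltW (truncnS_gt _))).
by rewrite (bigD1 i)//= lerDl sumr_ge0.
Qed.

Lemma sigma_finite_mu1 : sigma_finite setT mu1.
Proof. exact: sigma_finiteT. Qed.

Lemma integral_cons n (f : 'rV[R]_n.+1 -> \bar R) :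
  measurable_fun setT f -> (forall x, (0 <= f x)%E) ->
  (\int[lam n.+1]_x f x = \int[lam n]_y \int[mu1]_t f (cons_rV (t, y)))%E.
Proof.
move=> mf f0.
have mfc : measurable_fun setT (f \o @cons_rV R n).
  by apply: measurableT_comp => //; exact: measurable_cons_rV.
have f0c z : (0 <= (f \o @cons_rV R n) z)%E by exact: f0.
rewrite -(sf_tonelli2 _ _ mfc f0c (m := (mu1 \x^ lam n)%E))//.
have := ge0_integral_pushforward (@measurable_cons_rV R n) (mu1 \x^ lam n)%E measurableT mf.
rewrite preimage_setT => <- //.
- exact: sigma_finite_mu1.
- exact: sigma_finite_lam.
Qed.

(** Both orders of integration are at hand: one suits maps that change the first
    coordinate, the other those that change the remaining ones. *)
Lemma integral_cons_swap n (f : 'rV[R]_n.+1 -> \bar R) :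
  measurable_fun setT f -> (forall x, (0 <= f x)%E) ->
  (\int[lam n.+1]_x f x = \int[mu1]_t \int[lam n]_y f (cons_rV (t, y)))%E.
Proof.
move=> mf f0; rewrite integral_cons//; apply/esym.
apply: (sf_tonelli sigma_finite_mu1 (@sigma_finite_lam n)
  (f := f \o @cons_rV R n)) => [|z]; last exact: f0.
by apply: measurableT_comp => //; exact: measurable_cons_rV.
Qed.

End lebesgue_rV_theory.

(** * Translations, dilations and shears *)

Section invariance1.
Context {R : realType}.
Local Notation mu1 := (@lebesgue_measure R).
Local Notation RR := (measurableTypeR R).

(** The translated measure has the same values on the half-open intervals, which
    determine the Lebesgue measure. *)
Lemma lebesgue_measure_translate (c : R) (A : set RR) : measurable A ->
  pushforward mu1 ((fun t => t + c) : RR -> RR) A = mu1 A.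
Proof.
have mc : measurable_fun setT ((fun t => t + c) : RR -> RR).
  exact: measurable_funD.
pose nu := measure_function_pushforward__canonical__measure_function_Measure mu1 mc.
move=> mA; apply/esym/(lebesgue_measure_unique (mu := nu)) => // _ [[a b]] _ <-.
rewrite /= /pushforward.
rewrite (_ : _ @^-1` _ = `](a - c), (b - c)]%classic); last first.
  by apply/seteqP; split => x /=; rewrite !in_itv/= ltrBlDr lerBrDr.
by rewrite !lebesgue_measure_itv/= !lte_fin; congr (if _ then _ else _);
  rewrite ?ltrD2r//= -EFinB; congr EFin; ring.
Qed.

Lemma lebesgue_measure_dilate (c : R) (A : set RR) : 0 < c -> measurable A ->
  (c%:E * mu1 ((fun t : R => (c * t)%R) @^-1` A) = mu1 A)%E.
Proof.
move=> c0 mA.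
have mc : measurable_fun setT ((fun t => c * t) : RR -> RR).
  exact: measurable_funM.
pose nu := measure_function_pushforward__canonical__measure_function_Measure mu1 mc.
apply/esym/(lebesgue_measure_unique (mu := mscale (NngNum (ltW c0)) nu)) => // _ [[a b]] _ <-.
rewrite /= /mscale/= /pushforward.
rewrite (_ : _ @^-1` _ = `](c^-1 * a), (c^-1 * b)]%classic); last first.
  apply/seteqP; split => x /=; rewrite !in_itv/=.
    by rewrite ltr_pdivrMl// ler_pdivlMl// mulrC.
  by rewrite ltr_pdivrMl// ler_pdivlMl// mulrC.
rewrite /= !lebesgue_measure_itv/= !lte_fin ltr_pM2l ?invr_gt0//.
case: ifPn => _; last by rewrite mule0.
by rewrite -EFinB -EFinM mulrBr !mulVKf ?gt_eqF.
Qed.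

Implicit Type f : RR -> \bar R.

Lemma integral1_translate f c : measurable_fun setT f -> (forall x, (0 <= f x)%E) ->
  (\int[mu1]_t f (t + c)%R = \int[mu1]_t f t)%E.
Proof.
move=> mf f0.
have mc : measurable_fun setT ((fun t => t + c) : RR -> RR).
  exact: measurable_funD.
have := ge0_integral_pushforward mc mu1 measurableT mf.
rewrite preimage_setT => <- //.
by apply: eq_measure_integral => A mA _; exact: lebesgue_measure_translate.
Qed.

Lemma integral1_opp f : measurable_fun setT f -> (forall x, (0 <= f x)%E) ->
  (\int[mu1]_t f (- t)%R = \int[mu1]_t f t)%E.
Proof.
move=> mf f0.
have mc : measurable_fun setT ((fun t => - t) : RR -> RR).
  exact: measurable_funN.
have := ge0_integral_pushforward mc mu1 measurableT mf.
rewrite preimage_setT => <- //.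
by apply: eq_measure_integral => A mA _; exact: lebesgue_measureN.
Qed.

Lemma integral1_dilate f c : 0 < c -> measurable_fun setT f -> (forall x, (0 <= f x)%E) ->
  (c%:E * \int[mu1]_t f (c * t)%R = \int[mu1]_t f t)%E.
Proof.
move=> c0 mf f0.
have mc : measurable_fun setT ((fun t => c * t) : RR -> RR).
  exact: measurable_funM.
pose nu := measure_function_pushforward__canonical__measure_function_Measure mu1 mc.
have := ge0_integral_pushforward mc mu1 measurableT mf.
rewrite preimage_setT => <- //.
rewrite -(ge0_integral_mscale nu measurableT (NngNum (ltW c0)))//.
by apply: eq_measure_integral => A mA _; exact: lebesgue_measure_dilate.
Qed.

End invariance1.

Section invariance.
Context {R : realType}.
Local Notation mu1 := (@lebesgue_measure R).
Local Notation RR := (measurableTypeR R).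
Local Notation lam := (@lebesgue_rV R).

(** Stated with integrals of nonnegative functions: this composes, and it is proved one
    coordinate at a time by slicing. *)
Definition measure_preserving n (T : 'rV[R]_n -> 'rV[R]_n) :=
  measurable_fun setT T /\
  forall f : 'rV[R]_n -> \bar R, measurable_fun setT f -> (forall x, (0 <= f x)%E) ->
    (\int[lam n]_x f (T x) = \int[lam n]_x f x)%E.

Lemma measure_preserving_comp n (T U : 'rV[R]_n -> 'rV[R]_n) :
  measure_preserving T -> measure_preserving U -> measure_preserving (T \o U).
Proof.
move=> [mT iT] [mU iU]; split; first exact: measurableT_comp.
move=> f mf f0; rewrite -[RHS]iT//; apply: (iU (f \o T)) => //=.
exact: measurableT_comp.
Qed.

Lemma measurable_cons2 d (T : measurableType d) n (h : T -> RR) (g : T -> 'rV[R]_n) :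
  measurable_fun setT h -> measurable_fun setT g ->
  measurable_fun setT (fun t => cons_rV (h t, g t)).
Proof.
move=> mh mg; apply: (measurableT_comp (@measurable_cons_rV R n)).
exact: measurable_fun_pair.
Qed.

Definition behead_rV n (x : 'rV[R]_n.+1) : 'rV[R]_n := \row_j x 0 (lift ord0 j).

Lemma measurable_behead n : measurable_fun setT (@behead_rV n).
Proof.
by apply: measurable_fun_rV => i; under eq_fun do rewrite mxE; exact: measurable_coord.
Qed.

Lemma behead_cons n p : behead_rV (@cons_rV R n p) = p.2.
Proof. by apply/rowP => j; rewrite mxE cons_rV_lift. Qed.

Lemma preserving_head n (h : RR -> 'rV[R]_n -> RR) :
  measurable_fun setT (fun p : RR * 'rV[R]_n => h p.1 p.2) ->
  (forall y (f : RR -> \bar R), measurable_fun setT f -> (forall x, (0 <= f x)%E) ->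
     (\int[mu1]_t f (h t y) = \int[mu1]_t f t)%E) ->
  measure_preserving (fun x : 'rV[R]_n.+1 =>
    cons_rV (h (x 0 ord0) (behead_rV x), behead_rV x)).
Proof.
move=> mh ph; have mT : measurable_fun setT (fun x : 'rV[R]_n.+1 =>
    cons_rV (h (x 0 ord0) (behead_rV x), behead_rV x)).
  apply: measurable_cons2; last exact: measurable_behead.
  apply: (measurableT_comp mh (g := fun x : 'rV[R]_n.+1 => (x 0 ord0 : RR, behead_rV x))).
  apply: measurable_fun_pair; first exact: measurable_coord.
  exact: measurable_behead.
split=> [|f mf f0]; first exact: mT.
have mfT := measurableT_comp mf mT.
rewrite (integral_cons mf f0) (integral_cons mfT (fun x => f0 _)).
apply: eq_integral => y _.
under eq_integral do rewrite /= behead_cons cons_rV0.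
apply: (ph y (fun t => f (cons_rV (t, y)))) => //.
apply: measurableT_comp => //; exact: measurable_cons2.
Qed.

(** On each line parallel to the first axis the map is a translation. *)
Lemma preserving_shear_head n (h : 'rV[R]_n -> RR) : measurable_fun setT h ->
  measure_preserving (fun x : 'rV[R]_n.+1 =>
    cons_rV (x 0 ord0 + h (behead_rV x), behead_rV x)).
Proof.
move=> mh; apply: (preserving_head (h := fun t y => t + h y)) => [|y f mf f0].
  apply: measurable_funD; first exact: measurable_fst.
  by apply: measurableT_comp => //; exact: measurable_snd.
exact: integral1_translate.
Qed.

Lemma preserving_tail n (U : RR -> 'rV[R]_n -> 'rV[R]_n) :
  measurable_fun setT (fun p : RR * 'rV[R]_n => U p.1 p.2) ->
  (forall t, measure_preserving (U t)) ->
  measure_preserving (fun x : 'rV[R]_n.+1 =>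
    cons_rV (x 0 ord0, U (x 0 ord0) (behead_rV x))).
Proof.
move=> mU pU; have mT : measurable_fun setT (fun x : 'rV[R]_n.+1 =>
    cons_rV (x 0 ord0, U (x 0 ord0) (behead_rV x))).
  apply: measurable_cons2; first exact: measurable_coord.
  apply: (measurableT_comp mU (g := fun x : 'rV[R]_n.+1 => (x 0 ord0 : RR, behead_rV x))).
  apply: measurable_fun_pair; first exact: measurable_coord.
  exact: measurable_behead.
split=> [|f mf f0]; first exact: mT.
have mfT := measurableT_comp mf mT.
rewrite (integral_cons_swap mf f0) (integral_cons_swap mfT (fun x => f0 _)).
apply: eq_integral => t _.
under eq_integral do rewrite /= behead_cons cons_rV0.
apply: ((pU t).2 (fun y => f (cons_rV (t, y)))) => //.
apply: measurableT_comp => //; exact: measurable_cons2.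
Qed.

Lemma measurable_addrV n (v : 'rV[R]_n) : measurable_fun setT (fun x : 'rV[R]_n => x + v).
Proof.
apply: measurable_fun_rV => i; under eq_fun do rewrite mxE.
by apply: measurable_funD => //; exact: measurable_coord.
Qed.

Lemma measurable_scalerV n c : measurable_fun setT (fun x : 'rV[R]_n => c *: x).
Proof.
apply: measurable_fun_rV => i; under eq_fun do rewrite mxE.
by apply: measurable_funM => //; exact: measurable_coord.
Qed.

Lemma preserving_translate n (v : 'rV[R]_n) : measure_preserving (fun x => x + v).
Proof.
elim: n v => [|n IH] v.
  split; first exact: measurable_addrV.
  by move=> f mf f0; apply: eq_integral => x _; congr f; apply/rowP => -[].
have := measure_preserving_comp
  (preserving_shear_head (h := fun _ => v 0 ord0) (measurable_cst _))
  (preserving_tail (U := fun _ y => y + behead_rV v) _ (fun _ => IH _)).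
rewrite (_ : _ \o _ = (fun x : 'rV[R]_n.+1 => x + v)).
  apply; apply: (measurableT_comp (measurable_addrV _)); exact: measurable_snd.
apply/funext => x /=; apply/rowP => i; case: (unliftP ord0 i) => [j|] ->.
  by rewrite cons_rV_lift/= behead_cons/= !mxE.
by rewrite cons_rV0/= cons_rV0 mxE.
Qed.

Lemma integral_dilate n (c : R) (f : 'rV[R]_n -> \bar R) : 0 < c ->
  measurable_fun setT f -> (forall x, (0 <= f x)%E) ->
  ((c ^+ n)%:E * \int[lam n]_x f (c *: x)%R = \int[lam n]_x f x)%E.
Proof.
move=> c0; elim: n f => [|n IH] f mf f0.
  rewrite mul1e; apply: eq_integral => x _.
  by congr f; apply/rowP => -[].
have mfc : measurable_fun setT (fun x : 'rV[R]_n.+1 => f (c *: x)).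
  apply: measurableT_comp => //; exact: measurable_scalerV.
rewrite !integral_cons// exprSr EFinM -muleA.
have mf2 : measurable_fun setT (fun p : RR * 'rV[R]_n => f (cons_rV p)).
  by apply: measurableT_comp => //; exact: measurable_cons_rV.
rewrite -[RHS]IH; last 2 first.
- exact: (sf_measurable_tonelli2 (sigma_finite_mu1 (R := R)) mf2 (fun z => f0 _)).
- by move=> y; apply: integral_ge0.
congr (_ * _)%E.
have mf3 : measurable_fun setT (fun p : RR * 'rV[R]_n => f (c *: cons_rV p)).
  by apply: (measurableT_comp mfc); exact: measurable_cons_rV.
have mf4 := sf_measurable_tonelli2 (sigma_finite_mu1 (R := R)) mf3 (fun z => f0 _).
rewrite -ge0_integralZl//; last 2 first.
- by move=> y _; apply: integral_ge0.
- by rewrite lee_fin ltW.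
apply: eq_integral => y _.
rewrite -(integral1_dilate (f := fun t => f (cons_rV (t, c *: y))) c0)//.
  congr (_ * _)%E; apply: eq_integral => t _; congr f.
  apply/rowP => i; case: (unliftP ord0 i) => [j|] ->; rewrite mxE.
    by rewrite !cons_rV_lift/= mxE.
  by rewrite !cons_rV0.
apply: measurableT_comp => //; exact: measurable_cons2.
Qed.

End invariance.

(** * Rotations *)

Section rotation.
Context {R : realType}.
Local Notation RR := (measurableTypeR R).

Lemma dotmulE n (x y : 'rV[R]_n.+1) :
  dotmul x y = x 0 ord0 * y 0 ord0 + dotmul (behead_rV x) (behead_rV y).
Proof.
rewrite /dotmul big_ord_recl; congr (_ + _).
by apply: eq_bigr => i _; rewrite !mxE.
Qed.

Lemma dotmulC n (x y : 'rV[R]_n) : dotmul x y = dotmul y x.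
Proof. by apply: eq_bigr => i _; rewrite mulrC. Qed.

Lemma dotmulDl n (x y z : 'rV[R]_n) : dotmul (x + y) z = dotmul x z + dotmul y z.
Proof. by rewrite /dotmul -big_split; apply: eq_bigr => i _; rewrite mxE mulrDl. Qed.

Lemma dotmulZl n c (x z : 'rV[R]_n) : dotmul (c *: x) z = c * dotmul x z.
Proof. by rewrite /dotmul mulr_sumr; apply: eq_bigr => i _; rewrite mxE mulrA. Qed.

Lemma dotmulDr n (x y z : 'rV[R]_n) : dotmul z (x + y) = dotmul z x + dotmul z y.
Proof. by rewrite !(dotmulC z) dotmulDl. Qed.

Lemma dotmulZr n c (x z : 'rV[R]_n) : dotmul z (c *: x) = c * dotmul z x.
Proof. by rewrite !(dotmulC z) dotmulZl. Qed.

Lemma dotmul_ge0 n (x : 'rV[R]_n) : 0 <= dotmul x x.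
Proof. by apply: sumr_ge0 => i _; rewrite -expr2 sqr_ge0. Qed.

Lemma dotmul_eq0 n (x : 'rV[R]_n) : dotmul x x = 0 -> x = 0.
Proof.
move/eqP; rewrite psumr_eq0 => [/allP h|i _]; last by rewrite -expr2 sqr_ge0.
apply/rowP => i; rewrite mxE; apply/eqP.
by have /implyP/(_ isT) := h i (mem_index_enum _); rewrite mulf_eq0 orbb.
Qed.

Lemma measurable_dotmul n (u : 'rV[R]_n) : measurable_fun setT (dotmul u : 'rV[R]_n -> RR).
Proof.
apply: measurable_sum => i; apply: measurable_funM => //; exact: measurable_coord.
Qed.

(** For every unit vector u there is a rotation taking the first coordinate to the
    coordinate along u. The usual factorization of a rotation into three shears gives
    it together with the invariance of the Lebesgue measure, without determinants:
    writing u = (c, w), the first and the third shear add (1 + c)^-1 times the product with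
    w to the first coordinate, and the middle one subtracts the first coordinate times w
    from the others. For c = -1 a reflection does it. *)
Lemma rotation_to_axis n (u : 'rV[R]_n.+1) : dotmul u u = 1 ->
  exists T : 'rV[R]_n.+1 -> 'rV[R]_n.+1,
    [/\ measure_preserving T, forall x, enorm (T x) = enorm x &
        forall x, T x 0 ord0 = dotmul u x].
Proof.
move=> u1; set c := u 0 ord0; set w := behead_rV u.
have cw : c ^+ 2 + dotmul w w = 1 by rewrite expr2 -dotmulE.
have [cN1|c1] := eqVneq c (-1).
  have w0 : w = 0 by apply: dotmul_eq0; move: cw; rewrite cN1; lra.
  exists (fun x : 'rV[R]_n.+1 => cons_rV (- x 0 ord0, behead_rV x)); split.
  - apply: (preserving_head (h := fun t _ => - t)) => [|_ f mf f0].
      by apply: measurable_funN; exact: measurable_fst.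
    exact: integral1_opp.
  - by move=> x; rewrite /enorm !dotmulE behead_cons/= cons_rV0/= mulrNN.
  - move=> x; rewrite cons_rV0/= dotmulE -/c -/w cN1 w0 /dotmul big1 ?addr0 ?mulN1r//.
    by move=> i _; rewrite mxE mul0r.
have c10 : 1 + c != 0 by rewrite addrC -subr_eq0 opprK in c1 *.
pose A (x : 'rV[R]_n.+1) := cons_rV (x 0 ord0 + (1 + c)^-1 * dotmul w (behead_rV x), behead_rV x) : 'rV[R]_n.+1.
pose B (x : 'rV[R]_n.+1) := cons_rV (x 0 ord0, behead_rV x + (- x 0 ord0) *: w) : 'rV[R]_n.+1.
have pA : measure_preserving A.
  apply: (preserving_shear_head (h := fun y => (1 + c)^-1 * dotmul w y)).
  by apply: measurable_funM => //; exact: measurable_dotmul.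
have pB : measure_preserving B.
  apply: (preserving_tail (U := fun t y => y + (- t) *: w)) => [|t].
    apply: measurable_fun_rV => i /=; under eq_fun do rewrite !mxE.
    apply: measurable_funD.
      exact: (measurableT_comp (measurable_coord i) measurable_snd).
    by apply: measurable_funM => //; apply: measurable_funN; exact: measurable_fst.
  exact: preserving_translate.
exists (A \o B \o A); split.
- by do 2 apply: measure_preserving_comp => //.
- move=> x; rewrite /enorm; congr Num.sqrt; rewrite /A /B /=.
  rewrite !dotmulE !behead_cons/= !cons_rV0/=.
  set y := behead_rV x; set q := dotmul w y; set t := x 0 ord0.
  rewrite !(dotmulDl, dotmulDr, dotmulZl, dotmulZr) (dotmulC y w) -/q.
  have -> : dotmul w w = 1 - c ^+ 2 by rewrite -cw; ring.
  by field.
- move=> x; rewrite /A /B /= !behead_cons/= !cons_rV0/= dotmulE.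
  set y := behead_rV x; set t := x 0 ord0.
  rewrite !(dotmulDr, dotmulZr) -/w -/c.
  have -> : dotmul w w = 1 - c ^+ 2 by rewrite -cw; ring.
  by field.
Qed.

End rotation.

(** * Borel measurability on R^n *)

Section borel_rV.
Context {R : realType} {n : nat}.
Implicit Types (x y : 'rV[R]_n) (U : set 'rV[R]_n).

Lemma le_coord_norm x i : `|x 0 i| <= `|x|.
Proof.
rewrite [leRHS]/Num.norm /= mx_normrE; apply/bigmax_geP; right => /=.
by exists (0, i).
Qed.

Lemma norm_rV_le x c : 0 <= c -> (forall i, `|x 0 i| <= c) -> `|x| <= c.
Proof.
move=> c0 h; rewrite [leLHS]/Num.norm /= mx_normrE; apply/bigmax_leP; split => // -[i j] _ /=.
by rewrite (ord1 i).
Qed.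

Lemma norm_rV_lt x c : 0 < c -> (forall i, `|x 0 i| < c) -> `|x| < c.
Proof.
move=> c0 h; rewrite [ltLHS]/Num.norm /= mx_normrE; apply/bigmax_ltP; split => // -[i j] _ /=.
by rewrite (ord1 i).
Qed.

(* Cubes with rational centre: countably many of them cover an open set. *)
Let cell (p : 'rV[rat]_n * nat) : set 'rV[R]_n :=
  [set x | forall i, `|x 0 i - ratr (p.1 0 i)| < p.2.+1%:R^-1].

Let measurable_cell p : measurable (cell p).
Proof.
rewrite (_ : cell p = \bigcap_(i in [set: 'I_n]) ((fun x : 'rV[R]_n => x 0 i) @^-1`
   `](ratr (p.1 0 i) - p.2.+1%:R^-1), (ratr (p.1 0 i) + p.2.+1%:R^-1)[)).
  apply: fin_bigcap_measurable => [|i _]; first exact: finite_finset.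
  rewrite -[X in measurable X]setTI; exact: measurable_coord.
by apply/seteqP; split => x /= h i; [move=> _|move: (h i I)];
  rewrite /= in_itv/= -ltr_distlC distrC//; exact: h.
Qed.

(** The sigma-algebra is generated by the coordinates; an open set is a countable union
    of rational cubes, which are measurable. *)
Lemma open_measurable_rV U : open U -> measurable U.
Proof.
move=> oU.
rewrite (_ : U = \bigcup_(p : 'rV[rat]_n * nat)
   (if `[< cell p `<=` U >] then cell p else set0)).
  apply: countable_bigcupT_measurable => // p.
  by case: ifPn => _ //; exact: measurable_cell.
apply/seteqP; split => [x Ux|x [p _]]; last by case: asboolP => // + cx; exact.
have /nbhs_ballP[e /= e0 he] := open_nbhs_nbhs (conj oU Ux).
(* half the side of a cube centred near x that fits into the ball of radius e *)
have [k ke] : exists k : nat, k.+1%:R^-1 < e / 2.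
  exists (Num.truncn (e / 2)^-1).
  by rewrite invf_plt ?posrE ?divr_gt0 ?truncnS_gt.
have /choice[q hq] i : exists r : rat, `|x 0 i - ratr r| < k.+1%:R^-1.
  have /rat_in_itvoo[r] : x 0 i - k.+1%:R^-1 < x 0 i + k.+1%:R^-1.
    by rewrite ltrBlDr -addrA ltrDl addr_gt0 ?invr_gt0.
  rewrite in_itv/= => hr; exists r.
  by rewrite distrC ltr_distl.
exists (\row_i q i, k) => //.
have cU : cell (\row_i q i, k) `<=` U.
  move=> y cy; apply: he; rewrite -ball_normE/=.
  apply: norm_rV_lt => // i; rewrite !mxE.
  rewrite (le_lt_trans (ler_distD (ratr (q i)) _ _))// (splitr e) ltrD//.
    exact: (lt_trans (hq i)).
  by rewrite distrC; apply: lt_trans ke; have := cy i; rewrite /= mxE.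
by case: asboolP => // _ i /=; rewrite mxE; exact: hq.
Qed.

Lemma measurable_continuous_on U (f : 'rV[R]_n -> R) : open U ->
  (forall x, U x -> {for x, continuous f}) -> measurable_fun U f.
Proof.
move=> oU cf; apply: (measurability _ (RGenOInfty.measurableE R)) => //.
move=> _ [_ [a ->] <-]; apply: open_measurable_rV.
rewrite openE => x [Ux fx].
have oUx := open_nbhs_nbhs (conj oU Ux).
apply: filterI; first exact: oUx.
apply: (cf x Ux); apply: open_nbhs_nbhs; split => //; exact: interval_open.
Qed.

Lemma measurable_continuous (f : 'rV[R]_n -> R) : continuous f -> measurable_fun setT f.
Proof. by move=> cf; apply: (measurable_continuous_on openT) => x _; exact: cf. Qed.

Lemma open_neq0_rV : open [set x : 'rV[R]_n | x != 0].
Proof.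
rewrite (_ : [set _ | _] = ~` [set 0]); last first.
  by apply/seteqP; split => x /=; [move/eqP|move/eqP].
apply: closed_openC.
by apply: accessible_closed_set1; apply: hausdorff_accessible; exact: norm_hausdorff.
Qed.

(** Homogeneous functions are continuous away from the origin only. *)
Lemma measurable_off0 (f : 'rV[R]_n -> R) :
  (forall x, x != 0 -> {for x, continuous f}) -> measurable_fun setT f.
Proof.
move=> cf; have o0 := open_neq0_rV; have m0 := open_measurable_rV o0.
rewrite -(setvU [set x : 'rV[R]_n | x != 0]).
apply/measurable_funU; [exact: measurableC|exact: m0|split].
  have -> : ~` [set x : 'rV[R]_n | x != 0] = [set 0].
    by apply/seteqP; split => x /=; [move/negP; rewrite negbK => /eqP|move=> ->; apply/negP; rewrite negbK].
  apply: (eq_measurable_fun (cst (f 0))) => [x|]; last exact: measurable_cst.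
  by rewrite inE => ->.
exact: measurable_continuous_on.
Qed.

End borel_rV.

(** * Complex-valued integrals *)

Section complex_facts.
Context {R : realType}.
Implicit Types z w : R[i].

Lemma complex_eq z w : Re z = Re w -> Im z = Im w -> z = w.
Proof. by case: z w => [a b] [c d] /= -> ->. Qed.

Lemma normcE z : normc z = Num.sqrt (Re z ^+ 2 + Im z ^+ 2).
Proof. by case: z. Qed.

Lemma normc_ge0 z : 0 <= normc z.
Proof. by rewrite normcE sqrtr_ge0. Qed.

Lemma normr_Re_le z : `|Re z| <= normc z.
Proof. by rewrite normcE -sqrtr_sqr ler_sqrt ?addr_ge0 ?sqr_ge0// lerDl sqr_ge0. Qed.

Lemma normr_Im_le z : `|Im z| <= normc z.
Proof. by rewrite normcE -sqrtr_sqr ler_sqrt ?addr_ge0 ?sqr_ge0// lerDr sqr_ge0. Qed.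

Lemma normcR (r : R) : normc r%:C%C = `|r|.
Proof. by rewrite normcE /= expr0n addr0 sqrtr_sqr. Qed.

Lemma normcB z w : normc (z - w) = normc (w - z).
Proof. by rewrite -[RHS]normcN opprB. Qed.

Lemma normc_le_ReIm z : normc z <= `|Re z| + `|Im z|.
Proof.
rewrite normcE -[leRHS]ger0_norm ?addr_ge0// -sqrtr_sqr ler_sqrt ?sqr_ge0//.
rewrite sqrrD !real_normK ?num_real// addrAC lerDl.
by rewrite mulrn_wge0// mulr_ge0.
Qed.

Lemma normc_expi (t : R) : normc (expi t) = 1.
Proof. by rewrite normcE/= cos2Dsin2 sqrtr1. Qed.

Lemma expiD (s t : R) : expi (s + t) = expi s * expi t.
Proof. by apply: complex_eq => /=; rewrite ?cosD ?sinD; ring. Qed.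

Lemma Re_mul z w : Re (z * w) = Re z * Re w - Im z * Im w.
Proof. by case: z w => [a b] [c d]. Qed.

Lemma Im_mul z w : Im (z * w) = Re z * Im w + Im z * Re w.
Proof. by case: z w => [a b] [c d]. Qed.

Lemma Re_add z w : Re (z + w) = Re z + Re w.
Proof. by case: z w => [a b] [c d]. Qed.

Lemma Im_add z w : Im (z + w) = Im z + Im w.
Proof. by case: z w => [a b] [c d]. Qed.

Lemma Re_opp z : Re (- z) = - Re z. Proof. by case: z. Qed.

Lemma Im_opp z : Im (- z) = - Im z. Proof. by case: z. Qed.

End complex_facts.

Section complex_measurable.
Context {R : realType} d (T : measurableType d).
Implicit Types f g : T -> R[i].

(** Measurability through the two components, matching the definition of complex
    integrability. *)
Definition cmeasurable f :=
  measurable_fun setT (fun x => Re (f x)) /\ measurable_fun setT (fun x => Im (f x)).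

Lemma cmeasurable_normc f : cmeasurable f -> measurable_fun setT (fun x => normc (f x)).
Proof.
move=> [mr mi]; under eq_fun do rewrite normcE.
apply: (@measurableT_comp _ _ _ _ _ _ (@Num.sqrt R)).
  by apply: continuous_measurable_fun; exact: sqrt_continuous.
by apply: measurable_funD; exact: measurable_funX.
Qed.

Lemma cmeasurable_cst c : cmeasurable (fun=> c).
Proof. by split; exact: measurable_cst. Qed.

Lemma cmeasurableR (h : T -> R) : measurable_fun setT h -> cmeasurable (fun x => (h x)%:C%C).
Proof. by move=> mh; split => //=; exact: measurable_cst. Qed.

Lemma cmeasurableM f g : cmeasurable f -> cmeasurable g -> cmeasurable (fun x => f x * g x).
Proof.
move=> [? ?] [? ?]; split.
  under eq_fun do rewrite Re_mul.
  by apply: measurable_funB; exact: measurable_funM.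
under eq_fun do rewrite Im_mul.
by apply: measurable_funD; exact: measurable_funM.
Qed.

Lemma cmeasurable_expi (h : T -> R) : measurable_fun setT h -> cmeasurable (fun x => expi (h x)).
Proof.
move=> mh; split => /=.
  apply: (@measurableT_comp _ _ _ _ _ _ (@cos R)) => //.
  by apply: continuous_measurable_fun; exact: continuous_cos.
apply: (@measurableT_comp _ _ _ _ _ _ (@sin R)) => //.
by apply: continuous_measurable_fun; exact: continuous_sin.
Qed.

End complex_measurable.

Lemma cmeasurable_comp {R : realType} d d' (T : measurableType d) (T' : measurableType d')
    (f : T' -> R[i]) (g : T -> T') :
  cmeasurable f -> measurable_fun setT g -> cmeasurable (fun x => f (g x)).
Proof. by move=> [mr mi] mg; split; [apply: (measurableT_comp mr)|apply: (measurableT_comp mi)]. Qed.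

Section complex_integral.
Context {R : realType} d (T : measurableType d) (mu : {measure set T -> \bar R}).
Implicit Types (f g : T -> R[i]) (h : T -> R).
Local Notation Cint f := (Cintegral mu setT f).
Local Notation CI f := (Cintegrable mu setT f).
Local Notation I h := (mu.-integrable setT (EFin \o h)).

Lemma cmeasurable_integrable f : CI f -> cmeasurable f.
Proof. by move=> [/integrableP[/measurable_EFinP ? _] /integrableP[/measurable_EFinP ? _]]. Qed.

Lemma Cintegrable_dom f h : cmeasurable f -> I h -> (forall x, normc (f x) <= h x) -> CI f.
Proof.
move=> [mr mi] ih fh; split; apply: le_integrable ih => //=.
- exact/measurable_EFinP.
- move=> x _ /=; rewrite lee_fin (le_trans (normr_Re_le _))// (le_trans (fh x))// ler_norm//.
- exact/measurable_EFinP.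
- move=> x _ /=; rewrite lee_fin (le_trans (normr_Im_le _))// (le_trans (fh x))// ler_norm//.
Qed.

Lemma integrable_normc f : CI f -> I (fun x => normc (f x)).
Proof.
move=> If; have mf := cmeasurable_integrable If; case: If => ir ii.
have := integrableD measurableT (integrable_norm ir) (integrable_norm ii).
apply: le_integrable => //=.
  by apply/measurable_EFinP; exact: cmeasurable_normc.
move=> x _ /=; rewrite lee_fin ger0_norm ?normc_ge0// [leRHS]ger0_norm ?addr_ge0//.
exact: normc_le_ReIm.
Qed.

Lemma eq_Cintegral f g : (forall x, f x = g x) -> Cint f = Cint g.
Proof. by move=> /funext ->. Qed.

Lemma CintegrableD f g : CI f -> CI g -> CI (fun x => f x + g x).
Proof.
move=> [? ?] [? ?]; split.
  rewrite (_ : _ \o _ = (EFin \o (fun x => Re (f x))) \+ (EFin \o (fun x => Re (g x))))%E;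
    first exact: integrableD.
  by apply/funext => x /=; rewrite Re_add.
rewrite (_ : _ \o _ = (EFin \o (fun x => Im (f x))) \+ (EFin \o (fun x => Im (g x))))%E;
  first exact: integrableD.
by apply/funext => x /=; rewrite Im_add.
Qed.

Lemma CintegralD f g : CI f -> CI g -> Cint (fun x => f x + g x) = Cint f + Cint g.
Proof.
move=> [? ?] [? ?]; apply: complex_eq => /=.
  by rewrite -RintegralD//; apply: eq_Rintegral => x _; rewrite Re_add.
by rewrite -RintegralD//; apply: eq_Rintegral => x _; rewrite Im_add.
Qed.

Lemma CintegrableZ c f : CI f -> CI (fun x => c * f x).
Proof.
move=> If; have mf := cmeasurable_integrable If.
apply: (@Cintegrable_dom _ (fun x => normc c * normc (f x))).
- by apply: cmeasurableM => //; exact: cmeasurable_cst.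
- exact: (integrableZl measurableT (normc c) (integrable_normc If)).
- by move=> x; rewrite normcM.
Qed.

Lemma integrable_scale (k : R) h : I h -> I (fun x => k * h x).
Proof. by move=> ih; exact: (integrableZl measurableT k ih). Qed.

Lemma CintegralZ c f : CI f -> Cint (fun x => c * f x) = c * Cint f.
Proof.
move=> [ir ii]; apply: complex_eq => /=.
  rewrite Re_mul/= -!RintegralZl// -RintegralB//; last 2 first.
  - exact: integrable_scale.
  - exact: integrable_scale.
  by apply: eq_Rintegral => x _; rewrite Re_mul.
rewrite Im_mul/= -!RintegralZl// -RintegralD//; last 2 first.
- exact: integrable_scale.
- exact: integrable_scale.
by apply: eq_Rintegral => x _; rewrite Im_mul.
Qed.

Lemma CintegralZr c f : CI f -> Cint (fun x => f x * c) = Cint f * c.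
Proof.
by move=> If; rewrite mulrC -CintegralZ//; apply: eq_Cintegral => x; rewrite mulrC.
Qed.

Lemma CintegrableN f : CI f -> CI (fun x => - f x).
Proof.
move=> If; rewrite (_ : (fun _ => _) = (fun x => -1 * f x)); first exact: CintegrableZ.
by apply/funext => x; rewrite mulN1r.
Qed.

Lemma CintegrableB f g : CI f -> CI g -> CI (fun x => f x - g x).
Proof. by move=> If Ig; apply: CintegrableD => //; exact: CintegrableN. Qed.

Lemma CintegralB f g : CI f -> CI g -> Cint (fun x => f x - g x) = Cint f - Cint g.
Proof.
move=> If Ig; rewrite CintegralD//; last exact: CintegrableN.
by rewrite -[- Cint g]mulN1r -CintegralZ//; congr (_ + _); apply: eq_Cintegral => x; rewrite mulN1r.
Qed.

(** Multiply by a unit complex number making the integral real and nonnegative; the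
    real triangle inequality then applies to the real part. *)
Lemma normc_Cintegral_le f : CI f -> normc (Cint f) <= \int[mu]_x normc (f x).
Proof.
move=> If; have In := integrable_normc If.
have [->|z0] := eqVneq (Cint f) 0.
  by rewrite normc0; apply: Rintegral_ge0 => x _; exact: normc_ge0.
set z := Cint f in z0 *.
have nz0 : normc z != 0 by apply: contra z0 => /eqP/eq0_normc ->.
pose u : R[i] := (normc z)%:C%C / z.
have uz : u * z = (normc z)%:C%C by rewrite /u -mulrA mulVf ?mulr1.
have nu : normc u = 1 by rewrite /u normcM normcV normcR ger0_norm ?normc_ge0// divff.
have -> : normc z = Re (u * z) by rewrite uz.
rewrite -CintegralZ//=; apply: le_Rintegral => //.
  by case: (CintegrableZ u If).
by move=> x _; rewrite (le_trans (ler_norm _))// (le_trans (normr_Re_le _))// normcM nu mul1r.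
Qed.

Lemma Cintegral_bound f h : cmeasurable f -> I h -> (forall x, normc (f x) <= h x) ->
  normc (Cint f) <= \int[mu]_x h x.
Proof.
move=> mf ih fh; have If := Cintegrable_dom mf ih fh.
rewrite (le_trans (normc_Cintegral_le If))// le_Rintegral//.
exact: integrable_normc.
Qed.

End complex_integral.

Section real_fubini.
Context d1 d2 (T1 : measurableType d1) (T2 : measurableType d2) (R : realType).
Variables (m1 : {measure set T1 -> \bar R}) (m2 : {measure set T2 -> \bar R}).
Hypotheses (s1 : sigma_finite setT m1) (s2 : sigma_finite setT m2).

Lemma Rfubini (f : T1 -> T2 -> R) :
  measurable_fun setT (fun p : T1 * T2 => f p.1 p.2) ->
  (\int[m1]_x \int[m2]_y (`|f x y|)%:E < +oo)%E ->
  (forall x, m2.-integrable setT (EFin \o f x)) ->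
  (forall y, m1.-integrable setT (EFin \o f ^~ y)) ->
  [/\ m1.-integrable setT (EFin \o (fun x => \int[m2]_y f x y)),
      m2.-integrable setT (EFin \o (fun y => \int[m1]_x f x y)) &
      \int[m1]_x \int[m2]_y f x y = \int[m2]_y \int[m1]_x f x y].
Proof.
move=> mf foo i2 i1; pose F (p : T1 * T2) := (f p.1 p.2)%:E.
have mF : measurable_fun setT F by exact/measurable_EFinP.
have E1 x : (\int[m2]_y f x y)%:E = (\int[m2]_y F (x, y))%E.
  by rewrite fineK//; exact: integrable_fin_num (i2 x).
have E2 y : (\int[m1]_x f x y)%:E = (\int[m1]_x F (x, y))%E.
  by rewrite fineK//; exact: integrable_fin_num (i1 y).
split.
- rewrite (_ : _ \o _ = (fun x => \int[m2]_y F (x, y))%E); first exact: sf_integrable1.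
  by apply/funext => x; exact: E1.
- rewrite (_ : _ \o _ = (fun y => \int[m1]_x F (x, y))%E); first exact: sf_integrable2.
  by apply/funext => y; exact: E2.
- rewrite /Rintegral; congr fine; under eq_integral do rewrite E1.
  by under [RHS]eq_integral do rewrite E2; exact: sf_fubini.
Qed.

Lemma Cfubini (f : T1 -> T2 -> R[i]) :
  cmeasurable (fun p : T1 * T2 => f p.1 p.2) ->
  (\int[m1]_x \int[m2]_y (normc (f x y))%:E < +oo)%E ->
  (forall x, Cintegrable m2 setT (f x)) ->
  (forall y, Cintegrable m1 setT (f ^~ y)) ->
  [/\ Cintegrable m1 setT (fun x => Cintegral m2 setT (f x)),
      Cintegrable m2 setT (fun y => Cintegral m1 setT (f ^~ y)) &
      Cintegral m1 setT (fun x => Cintegral m2 setT (f x)) =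
      Cintegral m2 setT (fun y => Cintegral m1 setT (f ^~ y))].
Proof.
move=> [mr mi] foo i2 i1.
have mn : measurable_fun setT (fun p : T1 * T2 => (normc (f p.1 p.2))%:E).
  by apply/measurable_EFinP; exact: cmeasurable_normc.
have dom (g : T1 -> T2 -> R) : measurable_fun setT (fun p : T1 * T2 => g p.1 p.2) ->
    (forall x y, `|g x y| <= normc (f x y)) ->
    (\int[m1]_x \int[m2]_y (`|g x y|)%:E < +oo)%E.
  move=> mg gf; apply: le_lt_trans foo.
  have mg' : measurable_fun setT (fun p : T1 * T2 => (`|g p.1 p.2|)%:E).
    by apply/measurable_EFinP; exact: measurableT_comp.
  apply: ge0_le_integral => //.
  - by move=> x _; apply: integral_ge0.
  - exact: (sf_measurable_tonelli1 s2 mg').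
  - by apply: (sf_measurable_tonelli1 s2 mn) => z; rewrite lee_fin normc_ge0.
  - move=> x _; apply: ge0_le_integral => //.
    + exact: (measurableT_comp mg' (measurable_pair1 x)).
    + exact: (measurableT_comp mn (measurable_pair1 x)).
    + by move=> y _; rewrite lee_fin.
have [R1 R2 RE] := Rfubini mr (dom _ mr (fun x y => normr_Re_le _))
  (fun x => (i2 x).1) (fun y => (i1 y).1).
have [I1 I2 IE] := Rfubini mi (dom _ mi (fun x y => normr_Im_le _))
  (fun x => (i2 x).2) (fun y => (i1 y).2).
by split=> //; apply: complex_eq.
Qed.

(** The case of most use: absolute integrability on the product follows from a
    dominating function with separated variables. *)
Lemma Cfubini_dom (f : T1 -> T2 -> R[i]) (a : T1 -> R) (b : T2 -> R) :
  cmeasurable (fun p : T1 * T2 => f p.1 p.2) ->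
  m1.-integrable setT (EFin \o a) -> m2.-integrable setT (EFin \o b) ->
  (forall x y, normc (f x y) <= a x * b y) ->
  [/\ Cintegrable m1 setT (fun x => Cintegral m2 setT (f x)),
      Cintegrable m2 setT (fun y => Cintegral m1 setT (f ^~ y)) &
      Cintegral m1 setT (fun x => Cintegral m2 setT (f x)) =
      Cintegral m2 setT (fun y => Cintegral m1 setT (f ^~ y))].
Proof.
move=> mf ia ib fab.
have mn : measurable_fun setT (fun p : T1 * T2 => (normc (f p.1 p.2))%:E).
  by apply/measurable_EFinP; exact: cmeasurable_normc.
have i2 x : Cintegrable m2 setT (f x).
  apply: (Cintegrable_dom _ (integrable_scale (a x) ib)) => //.
  exact: (cmeasurable_comp mf (measurable_pair1 x)).
have i1 y : Cintegrable m1 setT (f ^~ y).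
  apply: (Cintegrable_dom _ (integrable_scale (b y) ia)) => [|x]; last by rewrite mulrC.
  exact: (cmeasurable_comp mf (measurable_pair2 y)).
apply: Cfubini => //.
have ia' := integrable_norm ia; have ib' := integrable_norm ib.
have mb : measurable_fun setT b by apply/measurable_EFinP/(measurable_int m2).
have ma : measurable_fun setT a by apply/measurable_EFinP/(measurable_int m1).
apply: (@le_lt_trans _ _ (\int[m1]_x ((`|a x|)%:E * \int[m2]_y (`|b y|)%:E))%E).
  apply: ge0_le_integral => //.
  - by move=> x _; apply: integral_ge0 => y _; rewrite lee_fin normc_ge0.
  - by apply: (sf_measurable_tonelli1 s2 mn) => z; rewrite lee_fin normc_ge0.
  - apply: emeasurable_funM => //.
    by apply/measurable_EFinP; exact: measurableT_comp.
  - move=> x _; rewrite -ge0_integralZl//; last first.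
      by apply/measurable_EFinP; exact: measurableT_comp.
    apply: ge0_le_integral => //.
    + by move=> y _; rewrite lee_fin normc_ge0.
    + exact: (measurableT_comp mn (measurable_pair1 x)).
    + by apply/measurable_EFinP; apply: measurable_funM => //; exact: measurableT_comp.
    + move=> y _; rewrite -EFinM lee_fin (le_trans (fab x y))// (le_trans (ler_norm _))//.
      by rewrite normrM.
have ib2 := integrable_lty measurableT ib'.
rewrite ge0_integralZr//; last 2 first.
- by apply/measurable_EFinP; exact: measurableT_comp.
- by apply: integral_ge0.
apply: lte_mul_pinfty => //; first by apply: integral_ge0.
  by rewrite ge0_fin_numE ?integral_ge0//; exact: (integrable_lty measurableT ia').
Qed.

End real_fubini.

(** * Changes of variables in integrals *)

Section change_of_variables.
Context {R : realType}.
Local Notation lam := (@lebesgue_rV R).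
Local Notation I h := ((lam _).-integrable setT (EFin \o h)).
Local Notation CI f := (Cintegrable (lam _) setT f).

Section preserving.
Context {n : nat} (T : 'rV[R]_n -> 'rV[R]_n) (mpT : measure_preserving T).
Implicit Types (h : 'rV[R]_n -> R) (f : 'rV[R]_n -> R[i]).

Let integral_mp (h : 'rV[R]_n -> \bar R) : measurable_fun setT h ->
  (\int[lam n]_x h (T x) = \int[lam n]_x h x)%E.
Proof.
move=> mh; rewrite [LHS]integralE [RHS]integralE.
congr (_ - _)%E.
  rewrite -(mpT.2 h^\+%E (measurable_funepos mh) (funepos_ge0 h)).
  by apply: eq_integral => x _; rewrite (funepos_comp h T).
rewrite -(mpT.2 h^\-%E (measurable_funeneg mh) (funeneg_ge0 h)).
by apply: eq_integral => x _; rewrite (funeneg_comp h T).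
Qed.

Lemma Rintegral_mp h : measurable_fun setT h ->
  \int[lam n]_x h (T x) = \int[lam n]_x h x.
Proof. by move=> mh; congr fine; apply: (integral_mp (h := EFin \o h)); exact/measurable_EFinP. Qed.

Lemma integrable_mp h : I h -> I (fun x => h (T x)).
Proof.
move=> /integrableP[mh oo]; apply/integrableP; split.
  exact: (measurableT_comp mh mpT.1).
by rewrite (mpT.2 (fun x => `|(h x)%:E|%E))//; exact: measurableT_comp.
Qed.

Lemma Cintegral_mp f : cmeasurable f ->
  Cintegral (lam n) setT (fun x => f (T x)) = Cintegral (lam n) setT f.
Proof.
by move=> [mr mi]; rewrite /Cintegral (Rintegral_mp mr) (Rintegral_mp mi).
Qed.

Lemma Cintegrable_mp f : CI f -> CI (fun x => f (T x)).
Proof. by move=> [ir ii]; split; [exact: (integrable_mp ir)|exact: (integrable_mp ii)]. Qed.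
End preserving.

Section dilation.
Context {n : nat} (c : R) (c0 : 0 < c).
Implicit Types (h : 'rV[R]_n -> R) (f : 'rV[R]_n -> R[i]).

Lemma integrable_dilate h : I h -> I (fun x => h (c *: x)).
Proof.
move=> /integrableP[mh oo]; apply/integrableP; split.
  by apply: (measurableT_comp mh); exact: measurable_scalerV.
have := integral_dilate c0 (f := fun x : 'rV[R]_n => `|(h x)%:E|%E).
move=> E; rewrite -E// in oo; last exact: measurableT_comp.
have cn0 : 0 < c ^+ n by rewrite exprn_gt0.
rewrite ltNge; apply/negP => h'; move: oo.
rewrite (_ : \int[_]_x _ = +oo)%E; last by apply/eqP; rewrite eq_le leey.
by rewrite gt0_muley ?lte_fin// ltxx.
Qed.

Lemma Rintegral_dilate h : I h ->
  c ^+ n * \int[lam n]_x h (c *: x) = \int[lam n]_x h x.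
Proof.
move=> ih; have ihc := integrable_dilate ih.
have mh := measurable_int _ ih.
rewrite /Rintegral [in LHS](_ : c ^+ n = fine (c ^+ n)%:E)// -fineM//; last first.
  exact: integrable_fin_num ihc.
congr fine; rewrite [RHS]integralE [in LHS]integralE muleBr//; last first.
  apply: fin_num_adde_defr; exact: integrable_pos_fin_num.
congr (_ - _)%E.
  rewrite -(integral_dilate c0 (measurable_funepos mh) (funepos_ge0 _)).
  by congr (_ * _)%E; apply: eq_integral => x _; rewrite -[RHS]/(((EFin \o h)^\+ \o (fun x => c *: x)) x)%E -funepos_comp.
rewrite -(integral_dilate c0 (measurable_funeneg mh) (funeneg_ge0 _)).
by congr (_ * _)%E; apply: eq_integral => x _; rewrite -[RHS]/(((EFin \o h)^\- \o (fun x => c *: x)) x)%E -funeneg_comp.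
Qed.

Lemma Cintegrable_dilate f : CI f -> CI (fun x => f (c *: x)).
Proof. by move=> [ir ii]; split; [exact: (integrable_dilate ir)|exact: (integrable_dilate ii)]. Qed.

Lemma Cintegral_dilate f : CI f ->
  (c ^+ n)%:C%C * Cintegral (lam n) setT (fun x => f (c *: x)) = Cintegral (lam n) setT f.
Proof.
move=> [ir ii]; apply: complex_eq.
  by rewrite Re_mul/= mul0r subr0 (Rintegral_dilate ir).
by rewrite Im_mul/= mul0r addr0 (Rintegral_dilate ii).
Qed.
End dilation.

Section decay_weight.

(** A product of one-dimensional integrable weights, so that integrability on R^n
    follows by slicing. *)
Definition decay_weight n (x : 'rV[R]_n) : R := \prod_i (1 + x 0 i ^+ 2)^-1.

Lemma decay_weight_ge0 n (x : 'rV[R]_n) : 0 <= decay_weight x.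
Proof. by apply: prodr_ge0 => i _; rewrite invr_ge0 addr_ge0 ?sqr_ge0. Qed.

Lemma decay_weight_le1 n (x : 'rV[R]_n) : decay_weight x <= 1.
Proof.
apply: prodr_ile1 => i _; rewrite invr_ge0 addr_ge0 ?sqr_ge0//=.
by rewrite invf_le1 ?lerDl ?sqr_ge0// ltr_pwDl ?sqr_ge0.
Qed.

Lemma measurable_decay_weight n : measurable_fun setT (@decay_weight n).
Proof.
apply: measurable_prod => i _.
rewrite (_ : (fun _ => _) = (fun t => (1 + t ^+ 2)^-1) \o (fun x : 'rV[R]_n => x 0 i))//.
apply: measurableT_comp; last exact: measurable_coord.
apply: continuous_measurable_fun => t; apply: continuous_oneDsqrV.
Qed.

Lemma integrable_decay_weight n : I (@decay_weight n).
Proof.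
apply/integrableP; split.
  by apply/measurable_EFinP; exact: measurable_decay_weight.
under eq_integral do rewrite /= ger0_norm ?decay_weight_ge0//.
have md k : measurable_fun setT (fun x : 'rV[R]_k => (decay_weight x)%:E).
  by apply/measurable_EFinP; exact: measurable_decay_weight.
elim: n => [|n IH].
  rewrite (eq_integral (cst 1%E)) => [|x _]; last by rewrite /decay_weight big_ord0.
  by rewrite integral_cst//= mul1e diracT ltry.
rewrite integral_cons//; last by move=> x; rewrite lee_fin decay_weight_ge0.
pose C := (\int[@lebesgue_measure R]_t ((1 + t ^+ 2)^-1)%:E)%E.
have Coo : (C < +oo)%E.
  rewrite /C (ge0_symfun_integralT (f := fun t => (1 + t ^+ 2)^-1))//.
  - rewrite (_ : [set x : R | 0 <= x] = `[0%R, +oo[%classic); last first.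
      by apply/seteqP; split => x /=; rewrite in_itv/= andbT.
    by rewrite (@integral0y_oneDsqr R) -EFinM ltry.
  - by move=> t; rewrite invr_ge0 addr_ge0 ?sqr_ge0.
  - by move=> t; apply: continuous_oneDsqrV.
  - by move=> t /=; rewrite sqrrN.
have g0 (t : R) : (0 <= ((1 + t ^+ 2)^-1)%:E)%E by rewrite lee_fin invr_ge0 addr_ge0 ?sqr_ge0.
have d0 k (y : 'rV[R]_k) : (0 <= (decay_weight y)%:E)%E by rewrite lee_fin decay_weight_ge0.
have C0 : (0 <= C)%E by apply: integral_ge0.
have mg : measurable_fun setT (fun t : R => ((1 + t ^+ 2)^-1)%:E).
  by apply/measurable_EFinP; apply: continuous_measurable_fun => t; exact: continuous_oneDsqrV.
have E (y : 'rV[R]_n) : (\int[@lebesgue_measure R]_t (decay_weight (cons_rV (t, y)))%:E =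
    C * (decay_weight y)%:E)%E.
  rewrite -[RHS]ge0_integralZr//.
  apply: eq_integral => t _; rewrite -EFinM; congr EFin.
  rewrite /decay_weight big_ord_recl cons_rV0; congr (_ * _).
  by apply: eq_bigr => j _; rewrite cons_rV_lift.
under eq_integral do rewrite E.
rewrite ge0_integralZl//; last exact: md.
by apply: lte_mul_pinfty => //; rewrite ge0_fin_numE.
Qed.

End decay_weight.

Lemma integrable_cst_box n k (c : R) (h : 'rV[R]_n -> R) :
  measurable_fun setT h -> (forall x, `|h x| <= c) ->
  (forall x, h x != 0 -> `|x| <= k%:R) -> I h.
Proof.
move=> mh hc hk; have mB := @measurable_box R n k.
have ib : I (fun x => c * \1_(@box R n k) x).
  apply: integrable_scale; apply/integrableP; split; first exact/measurable_EFinP.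
  under eq_integral do rewrite /= ger0_norm//.
  by rewrite integral_indic// setIT; exact: box_fin.
apply: le_integrable ib => //; first exact/measurable_EFinP.
move=> x _ /=; rewrite lee_fin indicE.
have c0 : 0 <= c by apply: le_trans (hc x).
case: (boolP (x \in @box R n k)) => xB.
  by rewrite mulr1 (ger0_norm c0).
rewrite mulr0 normr0; have [->|hx] := eqVneq (h x) 0; first by rewrite normr0.
move: xB; rewrite notin_setE => -[] i.
exact: le_trans (le_coord_norm _ _) (hk _ hx).
Qed.

End change_of_variables.

(** * Kernels of Fourier multipliers *)

Section trig_lipschitz.
Context {R : realType}.

Lemma lipschitz_of_derivative (f df : R -> R) :
  (forall t : R, is_derive t 1 f (df t)) -> (forall t, `|df t| <= 1) ->
  forall s t, `|f s - f t| <= `|s - t|.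
Proof.
move=> fd fb.
have H s t : s <= t -> `|f t - f s| <= `|t - s|.
  move=> st; have [|c _ ->] := MVT_segment st (fun x _ => fd x).
    by apply: derivable_within_continuous => x _; exact: (@ex_derive _ _ _ _ _ _ _ (fd x)).
  by rewrite normrM ler_piMl.
move=> s t; have [st|ts] := leP s t; last exact: H (ltW ts).
by rewrite distrC (distrC s); exact: H.
Qed.

Lemma normc_expiB (s t : R) : normc (expi s - expi t) <= 2 * `|s - t|.
Proof.
rewrite (le_trans (normc_le_ReIm _))//= mulr_natl mulr2n lerD//.
  apply: (lipschitz_of_derivative (df := fun t => - sin t)) => // x.
  by rewrite normrN ler_norml sin_geN1 sin_le1.
apply: (lipschitz_of_derivative (df := cos)) => // x.
by rewrite ler_norml cos_geN1 cos_le1.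
Qed.

End trig_lipschitz.

Section kernels.
Context {R : realType}.
Local Notation lam := (@lebesgue_rV R).
Local Notation I h := ((lam _).-integrable setT (EFin \o h)).
Local Notation CI f := (Cintegrable (lam _) setT f).

Lemma normr_dotmul_le n (x y : 'rV[R]_n) : `|dotmul x y| <= n%:R * (`|x| * `|y|).
Proof.
rewrite (le_trans (ler_norm_sum _ _ _))//.
have -> : n%:R * (`|x| * `|y|) = \sum_(i < n) (`|x| * `|y|).
  by rewrite sumr_const card_ord mulr_natl.
by apply: ler_sum => i _; rewrite normrM ler_pM// le_coord_norm.
Qed.

Lemma dotmulBl n (x y z : 'rV[R]_n) : dotmul (x - y) z = dotmul x z - dotmul y z.
Proof.
by rewrite /dotmul -sumrB; apply: eq_bigr => i _; rewrite !mxE mulrBl.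
Qed.

Lemma measurable_dotmul2 d (T : measurableType d) n (f g : T -> 'rV[R]_n) :
  measurable_fun setT f -> measurable_fun setT g ->
  measurable_fun setT (fun t => dotmul (f t) (g t)).
Proof.
move=> mf mg; apply: measurable_sum => i; apply: measurable_funM.
  exact: (measurableT_comp (measurable_coord i) mf).
exact: (measurableT_comp (measurable_coord i) mg).
Qed.

Lemma measurable_subrV d (T : measurableType d) n (f g : T -> 'rV[R]_n) :
  measurable_fun setT f -> measurable_fun setT g ->
  measurable_fun setT (fun t => f t - g t).
Proof.
move=> mf mg; apply: measurable_fun_rV => i; under eq_fun do rewrite !mxE.
apply: measurable_funB.
  exact: (measurableT_comp (measurable_coord i) mf).
exact: (measurableT_comp (measurable_coord i) mg).
Qed.

Lemma Cintegrable_expiM n (h : 'rV[R]_n -> R) (a : 'rV[R]_n -> R[i]) :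
  measurable_fun setT h -> CI a -> CI (fun xi => expi (h xi) * a xi).
Proof.
move=> mh ia; apply: (Cintegrable_dom _ (integrable_normc ia)).
  apply: cmeasurableM; last exact: cmeasurable_integrable ia.
  exact: cmeasurable_expi.
by move=> x; rewrite normcM normc_expi mul1r.
Qed.

(** Exchange the integral defining the Fourier transform of f with the inverse
    transform; the exponentials combine into that of x - y. *)
Lemma multiplier_conv n (a f : 'rV[R]_n -> R[i]) (x : 'rV[R]_n) : CI a -> CI f ->
  multiplier a f x = Cintegral (lam n) setT (fun y => inv_fourier a (x - y) * f y).
Proof.
move=> ia If; rewrite /multiplier /inv_fourier.
pose F (xi y : 'rV[R]_n) := expi (dotmul x xi) * a xi * (expi (- dotmul xi y) * f y).
have ma := cmeasurable_integrable ia; have mf := cmeasurable_integrable If.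
have [_ i2 FE] : [/\ CI (fun xi => Cintegral (lam n) setT (F xi)),
      CI (fun y => Cintegral (lam n) setT (F ^~ y)) &
      Cintegral (lam n) setT (fun xi => Cintegral (lam n) setT (F xi)) =
      Cintegral (lam n) setT (fun y => Cintegral (lam n) setT (F ^~ y))].
  apply: (Cfubini_dom (@sigma_finite_lam R n) (@sigma_finite_lam R n)
    _ (integrable_normc ia) (integrable_normc If)) => [|xi y].
    apply: cmeasurableM; apply: cmeasurableM.
    - apply: cmeasurable_expi; apply: measurable_dotmul2; [exact: measurable_cst|exact: measurable_fst].
    - exact: (cmeasurable_comp ma measurable_fst).
    - apply: cmeasurable_expi; apply: measurable_funN.
      by apply: measurable_dotmul2; [exact: measurable_fst|exact: measurable_snd].
    - exact: (cmeasurable_comp mf measurable_snd).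
  by rewrite !normcM !normc_expi !mul1r.
transitivity (((2 * pi) ^- n)%:C%C * Cintegral (lam n) setT (fun y => Cintegral (lam n) setT (F ^~ y))).
  rewrite -FE; congr (_ * _); apply: eq_Cintegral => xi.
  rewrite /fourier mulrA -CintegralZ; first exact: eq_Cintegral.
  exact: (Cintegrable_expiM (measurable_funN (measurable_dotmul xi)) If).
rewrite -(CintegralZ _ i2); apply: eq_Cintegral => y.
rewrite -mulrA -(CintegralZr _ (Cintegrable_expiM (measurable_dotmul (x - y)) ia)).
congr (_ * _); apply: eq_Cintegral => xi; rewrite /F.
rewrite [X in _ = expi X * _ * _](_ : _ = dotmul x xi - dotmul xi y); last first.
  by rewrite dotmulBl [dotmul y xi]dotmulC.
by rewrite expiD; ring.
Qed.

(** Rotating the variable of integration puts x on the first axis; the value then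
    depends on x through its Euclidean norm only. *)
Lemma inv_fourier_radial n (a : 'rV[R]_n.+1 -> R[i]) : cmeasurable a ->
  (forall x y, enorm x = enorm y -> a x = a y) ->
  forall x y, enorm x = enorm y -> inv_fourier a x = inv_fourier a y.
Proof.
move=> ma ra.
suff H x : inv_fourier a x = ((2 * pi) ^- n.+1)%:C%C *
    Cintegral (lam n.+1) setT (fun xi => expi (enorm x * xi 0 ord0) * a xi).
  by move=> x y xy; rewrite !H xy.
rewrite /inv_fourier; congr (_ * _).
have [x0|x0] := eqVneq x 0.
  have e0 : enorm x = 0 by rewrite x0 /enorm /dotmul big1 ?sqrtr0// => i _; rewrite mxE mul0r.
  apply: eq_Cintegral => xi; rewrite e0 mul0r x0 /dotmul big1// => i _; by rewrite mxE mul0r.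
have e0 : enorm x != 0.
  rewrite sqrtr_eq0 -ltNge lt_neqAle dotmul_ge0 andbT eq_sym.
  by apply: contra x0 => /eqP/dotmul_eq0 ->.
have ee : dotmul x x = enorm x ^+ 2 by rewrite sqr_sqrtr ?dotmul_ge0.
have [T [mpT eT T0]] : exists T : 'rV[R]_n.+1 -> 'rV[R]_n.+1,
    [/\ measure_preserving T, forall x, enorm (T x) = enorm x &
        forall y, T y 0 ord0 = dotmul ((enorm x)^-1 *: x) y].
  apply: rotation_to_axis; rewrite dotmulZl dotmulZr ee; by field.
rewrite -[RHS](Cintegral_mp mpT); last first.
  apply: cmeasurableM => //; apply: cmeasurable_expi; apply: measurable_funM => //.
  exact: measurable_coord.
apply: eq_Cintegral => xi; rewrite T0 dotmulZl mulVKf//.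
by congr (_ * _); apply: ra; rewrite eT.
Qed.

Lemma inv_fourier_dilate n (a : 'rV[R]_n -> R[i]) (c : R) (x : 'rV[R]_n) : 0 < c -> CI a ->
  inv_fourier (fun xi => a (c^-1 *: xi)) x = (c ^+ n)%:C%C * inv_fourier a (c *: x).
Proof.
move=> c0 ia; rewrite /inv_fourier mulrCA; congr (_ * _).
have ci0 : 0 < c^-1 by rewrite invr_gt0.
rewrite -(Cintegral_dilate c0); last first.
  by apply: Cintegrable_expiM; [exact: measurable_dotmul|exact: Cintegrable_dilate].
congr (_ * _); apply: eq_Cintegral => xi.
by rewrite scalerA mulVf ?gt_eqF// scale1r dotmulZr dotmulZl.
Qed.

Lemma inv_fourier_bound n (a : 'rV[R]_n -> R[i]) : CI a ->
  exists C : R, 0 <= C /\ forall x, normc (inv_fourier a x) <= C.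
Proof.
move=> ia; exists (`|(2 * pi) ^- n| * \int[lam n]_xi normc (a xi)); split.
  by rewrite mulr_ge0//; apply: Rintegral_ge0 => x _; exact: normc_ge0.
move=> x; rewrite /inv_fourier normcM normcR ler_wpM2l//.
have mx := measurable_dotmul x.
apply: Cintegral_bound; last by move=> xi; rewrite normcM normc_expi mul1r.
  exact: cmeasurable_integrable (Cintegrable_expiM mx ia).
exact: integrable_normc.
Qed.

(** The exponential is Lipschitz in its phase, at the cost of one moment of the
    symbol. *)
Lemma inv_fourier_lipschitz n (a : 'rV[R]_n -> R[i]) : CI a ->
  I (fun xi : 'rV[R]_n => `|xi| * normc (a xi)) ->
  exists C : R, 0 <= C /\ forall x y, normc (inv_fourier a x - inv_fourier a y) <= C * `|x - y|.
Proof.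
move=> ia ia1; pose J := \int[lam n]_xi (`|xi| * normc (a xi)).
exists (`|(2 * pi) ^- n| * (2 * n%:R * J)); split.
  by rewrite !mulr_ge0//; apply: Rintegral_ge0 => x _; rewrite mulr_ge0// normc_ge0.
move=> x y; rewrite /inv_fourier -mulrBr normcM normcR -[leRHS]mulrA ler_wpM2l//.
have mx := measurable_dotmul x; have my := measurable_dotmul y.
rewrite -CintegralB; try exact: Cintegrable_expiM.
have -> : 2 * n%:R * J * `|x - y| = \int[lam n]_xi (2 * n%:R * `|x - y| * (`|xi| * normc (a xi))).
  by rewrite RintegralZl// -/J; ring.
apply: Cintegral_bound.
- by apply: cmeasurable_integrable; apply: CintegrableB; exact: Cintegrable_expiM.
- exact: integrable_scale.
- move=> xi; rewrite -mulrBl normcM mulrA ler_wpM2r ?normc_ge0//.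
  rewrite (le_trans (normc_expiB _ _))// -!mulrA ler_wpM2l//.
  have -> : dotmul x xi - dotmul y xi = dotmul (x - y) xi.
    by rewrite dotmulBl.
  exact: normr_dotmul_le.
Qed.

Lemma continuous_of_lipschitz n (h : 'rV[R]_n -> R) C :
  (forall x y, `|h x - h y| <= C * `|x - y|) -> continuous h.
Proof.
move=> hC x; apply/(@cvgrPdist_lt _ _ _ (nbhs x) (nbhs_filter x)) => e e0.
have C1 : 0 < `|C| + 1 by rewrite ltr_wpDl.
apply/nbhs_ballP; exists (e / (`|C| + 1)); first exact: divr_gt0.
move=> y; rewrite -ball_normE /= => xy.
rewrite (le_lt_trans (hC _ _))//.
rewrite (@le_lt_trans _ _ ((`|C| + 1) * `|x - y|))//.
  by rewrite ler_wpM2r// (le_trans (ler_norm _))// lerDl.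
by rewrite -ltr_pdivlMl// mulrC.
Qed.

Lemma cmeasurable_lipschitz n (f : 'rV[R]_n -> R[i]) C :
  (forall x y, normc (f x - f y) <= C * `|x - y|) -> cmeasurable f.
Proof.
move=> fC; split; apply: measurable_continuous; apply: (continuous_of_lipschitz (C := C)) => x y.
  by rewrite -Re_opp -Re_add (le_trans (normr_Re_le _)).
by rewrite -Im_opp -Im_add (le_trans (normr_Im_le _)).
Qed.

End kernels.

(** * Finite differences of smooth functions *)

Section directional_smoothness.
Context {R : realType} {n : nat} (v : 'rV[R]_n).
Implicit Types (f g : 'rV[R]_n -> R) (U V : set 'rV[R]_n).

(** C^N regularity in the single direction v, the only kind of smoothness used to get
    decay along a coordinate. The recursion on the derivative makes the stability under
    products an induction. *)
Fixpoint diff_along N U f : Prop :=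
  (forall x, U x -> {for x, continuous f}) /\
  if N is N'.+1 then
    (forall x, U x -> derivable f x v) /\ diff_along N' U (fun x => 'D_v f x)
  else True.

Lemma diff_along_continuous N U f : diff_along N U f -> forall x, U x -> {for x, continuous f}.
Proof. by case: N => [|N] []. Qed.

Lemma diff_alongW N U f : diff_along N.+1 U f -> diff_along N U f.
Proof.
elim: N f => [|N IH] f [cf [df Df]]; first by split.
by split => //; split => //; exact: IH.
Qed.

Lemma near_eq_continuous f g x : {near x, f =1 g} ->
  {for x, continuous f} -> {for x, continuous g}.
Proof.
move=> fg cf; have E : f x = g x by exact: (nbhs_singleton fg).
suff : g @ x --> g x by [].
rewrite -E; have : f @ x --> f x by exact: cf.
by apply: cvg_trans; exact: (@near_eq_cvg _ _ (nbhs x) (nbhs_filter x) f g fg).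
Qed.

Lemma diff_along_eq N U f g : open U -> (forall x, U x -> f x = g x) ->
  diff_along N U f -> diff_along N U g.
Proof.
move=> oU; elim: N f g => [|N IH] f g fg;
  have nfg x : U x -> {near x, f =1 g}
    by move=> Ux; apply: filterS (open_nbhs_nbhs (conj oU Ux)) => y; exact: fg.
  by move=> [cf _]; split => // x Ux; exact: near_eq_continuous (nfg x Ux) (cf x Ux).
move=> [cf [df Df]]; split.
  by move=> x Ux; exact: near_eq_continuous (nfg x Ux) (cf x Ux).
split=> [x Ux|]; first exact: near_eq_derivable (nfg x Ux) (df x Ux).
apply: IH Df => x Ux; apply: near_eq_derive; exact: nfg.
Qed.

(** Regularity is local: it glues the region where a cut-off vanishes with the region
    where the other factor is smooth. *)
Lemma diff_alongU N U V f : diff_along N U f -> diff_along N V f -> diff_along N (U `|` V) f.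
Proof.
elim: N f => [|N IH] f [cU dU] [cV dV]; split; try by move=> x [/cU|/cV].
  by [].
case: dU dV => [dU DU] [dV DV]; split; last exact: IH.
by move=> x [/dU|/dV].
Qed.

Lemma diff_along_cst N U c : diff_along N U (fun=> c).
Proof.
elim: N c => [|N IH] c; split => //; try by move=> x _; exact: cst_continuous.
split=> [x _|]; first exact: derivable_cst.
have -> : (fun x => 'D_v (fun=> c) x) = fun=> 0 by apply/funext => x; exact: derive_cst.
exact: IH.
Qed.

Lemma diff_alongD N U f g : open U -> diff_along N U f -> diff_along N U g ->
  diff_along N U (fun x => f x + g x).
Proof.
move=> oU; elim: N f g => [|N IH] f g [cf df] [cg dg]; split => //.
- by move=> x Ux; apply: continuousD; [exact: cf|exact: cg].
- by move=> x Ux; apply: continuousD; [exact: cf|exact: cg].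
case: df dg => [df Df] [dg Dg]; split.
  by move=> x Ux; apply: derivableD; [exact: df|exact: dg].
apply: (diff_along_eq oU _ (IH _ _ Df Dg)) => x Ux /=.
by rewrite -deriveD//; [exact: df|exact: dg].
Qed.

Lemma diff_alongM N U f g : open U -> diff_along N U f -> diff_along N U g ->
  diff_along N U (fun x => f x * g x).
Proof.
move=> oU; elim: N f g => [|N IH] f g Sf Sg; move: (Sf) (Sg) => [cf df] [cg dg]; split => //.
- by move=> x Ux; apply: continuousM; [exact: cf|exact: cg].
- by move=> x Ux; apply: continuousM; [exact: cf|exact: cg].
case: df dg => [df Df] [dg Dg]; split.
  by move=> x Ux; apply: derivableM; [exact: df|exact: dg].
have H := diff_alongD oU (IH _ _ (diff_alongW Sf) Dg) (IH _ _ (diff_alongW Sg) Df).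
apply: (diff_along_eq oU _ H) => x Ux /=.
by rewrite -[RHS]/('D_v (f * g) x) deriveM//; [exact: df|exact: dg].
Qed.

Definition iter_derive N f := iter N (fun h x => 'D_v h x) f.

Lemma iter_derive_continuous N f : diff_along N setT f -> continuous (iter_derive N f).
Proof.
elim: N f => [|N IH] f [cf df]; first by move=> x; exact: cf.
by rewrite /iter_derive iterSr; apply: IH; case: df.
Qed.

Lemma iter_derive0 N U f : open U -> (forall x, U x -> f x = 0) ->
  forall x, U x -> iter_derive N f x = 0.
Proof.
move=> oU f0; elim: N => [|N IH] x Ux; first by rewrite /iter_derive /=; exact: f0.
rewrite /iter_derive iterS -/(iter_derive N f).
rewrite (@near_eq_derive _ _ _ _ (cst 0)) ?derive_cst//.
by apply: filterS (open_nbhs_nbhs (conj oU Ux)) => y Uy; rewrite IH.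
Qed.

(** The target is any abelian group, so that the same operator acts on a complex symbol
    and on its real and imaginary parts. *)
Definition fdiff (V : zmodType) (w : 'rV[R]_n) (h : 'rV[R]_n -> V) x := h (x + w) - h x.

Let growth_shift f x w :
  (fun h : R => h^-1 *: (((fun y => f (y + w)) \o shift x) (h *: v) - f (x + w))) =
  (fun h : R => h^-1 *: ((f \o shift (x + w)) (h *: v) - f (x + w))).
Proof. by apply/funext => h /=; rewrite addrA. Qed.

Lemma derive_shift f x w : 'D_v (fun y => f (y + w)) x = 'D_v f (x + w).
Proof. by rewrite /derive growth_shift. Qed.

Lemma derivable_shift f x w : derivable f (x + w) v -> derivable (fun y => f (y + w)) x v.
Proof. by rewrite /derivable growth_shift. Qed.

Lemma fdiff_derivable f w : (forall x, derivable f x v) -> forall x, derivable (fdiff w f) x v.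
Proof. by move=> df x; apply: derivableB => //; exact: derivable_shift. Qed.

Lemma derive_fdiff f w : (forall x, derivable f x v) ->
  (fun x => 'D_v (fdiff w f) x) = fdiff w (fun x => 'D_v f x).
Proof.
move=> df; apply/funext => x; rewrite /fdiff.
by rewrite [LHS](@deriveB _ _ _ (fun y => f (y + w)) f) ?derive_shift//; exact: derivable_shift.
Qed.

Lemma iter_fdiff_derivable N f w : (forall x, derivable f x v) ->
  (forall x, derivable (iter N (fdiff w) f) x v) /\
  (fun x => 'D_v (iter N (fdiff w) f) x) = iter N (fdiff w) (fun x => 'D_v f x).
Proof.
move=> df; elim: N => [|N [IH1 IH2]]; first by [].
split; first exact: fdiff_derivable.
by rewrite -[iter N.+1 _ f]/(fdiff w (iter N (fdiff w) f)) (derive_fdiff w IH1) IH2.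
Qed.

(** Mean value theorem along the line through x in the direction v. *)
Lemma fdiff_bound f t C : (forall x, derivable f x v) -> (forall x, `|'D_v f x| <= C) ->
  forall x, `|fdiff (t *: v) f x| <= `|t| * C.
Proof.
move=> df DC x; rewrite /fdiff.
pose phi (s : R) : R := f (x + s *: v).
have dphi (s : R) : is_derive s (1 : R) phi ('D_v f (x + s *: v)).
  have E : (fun h : R => h^-1 *: ((phi \o shift s) (h *: 1) - phi s)) =
           (fun h : R => h^-1 *: ((f \o shift (x + s *: v)) (h *: v) - f (x + s *: v))).
    apply/funext => h; rewrite /phi /=; congr (_ *: (f _ - _)).
    by rewrite -[h *: 1]/(h * 1) mulr1 scalerDl addrCA.
  split; first by rewrite /derivable E; exact: df.
  by rewrite /derive E.
have H (a b : R) : a <= b -> `|phi b - phi a| <= (b - a) * C.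
  move=> ab; have [|c _ ->] := MVT_segment ab (fun x _ => dphi x).
    by apply: derivable_within_continuous => s _; exact: (@ex_derive _ _ _ _ _ _ _ (dphi s)).
  by rewrite normrM mulrC [`|b - a|]ger0_norm ?subr_ge0// ler_wpM2l ?subr_ge0.
have -> : f (x + t *: v) - f x = phi t - phi 0 by rewrite /phi scale0r addr0.
have [t0|t0] := leP 0 t; first by have := H _ _ t0; rewrite subr0 [`|t|]ger0_norm.
by have := H _ _ (ltW t0); rewrite sub0r distrC [`|t|]ltr0_norm.
Qed.

(** Differences commute with derivatives, so each of the N differences can be traded
    for a derivative. *)
Lemma iter_fdiff_bound N f t C : diff_along N setT f ->
  (forall x, `|iter_derive N f x| <= C) ->
  forall x, `|iter N (fdiff (t *: v)) f x| <= `|t| ^+ N * C.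
Proof.
elim: N f => [|N IH] f; first by move=> _ fC x; rewrite expr0 mul1r; exact: fC.
move=> [cf [df Df]] fC x.
have df' y : derivable f y v by exact: df.
have [d1 d2] := iter_fdiff_derivable N (t *: v) df'.
rewrite iterS exprS -mulrA; apply: fdiff_bound => // y.
rewrite (_ : 'D_v _ y = iter N (fdiff (t *: v)) (fun x => 'D_v f x) y); last by rewrite -d2.
by apply: IH => // z; have := fC z; rewrite /iter_derive iterSr.
Qed.

End directional_smoothness.

Lemma smooth_on_diff_along {R : realType} n (U : set 'rV[R]_n) f (k : 'I_n) N :
  smooth_on U f -> diff_along (delta_mx 0 k) N U f.
Proof.
move=> sf; suff H l : diff_along (delta_mx 0 k) N U (partials (nseq l k) f) by exact: (H 0%N).
elim: N l => [|N IH] l.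
  by split => // x Ux; have [] := sf (nseq l k) x Ux.
split; first by move=> x Ux; have [] := sf (nseq l k) x Ux.
split; first by move=> x Ux; have [_ ] := sf (nseq l k) x Ux; exact.
exact: (IH l.+1).
Qed.

(** * Decay of kernels of smooth symbols *)

Section decay.
Context {R : realType}.
Local Notation lam := (@lebesgue_rV R).
Local Notation I h := ((lam _).-integrable setT (EFin \o h)).
Local Notation CI f := (Cintegrable (lam _) setT f).

(** Smooth symbols with compact support, with smoothness tested along the coordinate
    axes. *)
Definition test_symbol n (a : 'rV[R]_n -> R[i]) :=
  (exists r : nat, forall x, r%:R < `|x| -> a x = 0) /\
  forall (k : 'I_n) N, diff_along (delta_mx 0 k) N setT (fun x => Re (a x)) /\
            diff_along (delta_mx 0 k) N setT (fun x => Im (a x)).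

Lemma bounded_of_compact_support n (h : 'rV[R]_n -> R) r : continuous h ->
  (forall x, r < `|x| -> h x = 0) -> exists C : R, 0 <= C /\ forall x, `|h x| <= C.
Proof.
move=> ch h0; have [r0|r0] := ltP r 0.
  by exists 0; split => // x; rewrite h0 ?normr0// (lt_le_trans r0).
pose K := [set x : 'rV[R]_n | `|x| <= r].
have K0 : K !=set0 by exists 0; rewrite /K/= normr0.
have cK : compact K.
  apply: bounded_closed_compact.
    exists r; split; first exact: num_real.
    by move=> s rs x /le_trans; apply; exact: ltW.
  rewrite (_ : K = (fun x : 'rV[R]_n => `|x|) @^-1` [set t | t <= r])//.
  apply: closed_comp; last exact: closed_le.
  by move=> x _; exact: norm_continuous.
have [c _ hc] : exists2 c, c \in K & forall t, t \in K -> `|h t| <= `|h c|.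
  apply: compact_EVT_max => //; apply: continuous_subspaceT => x.
  by apply: continuous_comp; [exact: ch|exact: norm_continuous].
exists `|h c|; split => // x; have [xr|xr] := leP `|x| r; first by apply: hc; rewrite inE.
by rewrite h0// normr0.
Qed.

Section test.
Context {n : nat} (a : 'rV[R]_n.+1 -> R[i]) (ta : test_symbol a).

Lemma test_symbol_continuous :
  continuous (fun x => Re (a x)) /\ continuous (fun x => Im (a x)).
Proof.
have [/diff_along_continuous c1 /diff_along_continuous c2] := ta.2 ord0 0%N.
by split => x; [exact: c1|exact: c2].
Qed.

Lemma test_symbol_cmeasurable : cmeasurable a.
Proof. by have [c1 c2] := test_symbol_continuous; split; exact: measurable_continuous. Qed.

Lemma test_symbol_bounded : exists C : R, 0 <= C /\ forall x, normc (a x) <= C.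
Proof.
have [c1 c2] := test_symbol_continuous; have [[r r0] _] := ta.
have [C1 [C10 h1]] : exists C : R, 0 <= C /\ forall x, `|Re (a x)| <= C.
  by apply: (bounded_of_compact_support c1 (r := r%:R)) => x xr; rewrite r0.
have [C2 [C20 h2]] : exists C : R, 0 <= C /\ forall x, `|Im (a x)| <= C.
  by apply: (bounded_of_compact_support c2 (r := r%:R)) => x xr; rewrite r0.
exists (C1 + C2); split; first exact: addr_ge0.
by move=> x; rewrite (le_trans (normc_le_ReIm _))// lerD.
Qed.

Lemma test_symbol_integrable_norm : I (fun x => normc (a x)).
Proof.
have [C [C0 aC]] := test_symbol_bounded; have [[r r0] _] := ta.
apply: (integrable_cst_box (k := r) (c := C)).
- exact: cmeasurable_normc test_symbol_cmeasurable.
- by move=> x; rewrite ger0_norm ?normc_ge0.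
- by move=> x; apply: contraNle => /r0 ->; rewrite normc0.
Qed.

Lemma test_symbol_integrable : CI a.
Proof.
by apply: (Cintegrable_dom test_symbol_cmeasurable test_symbol_integrable_norm).
Qed.

Lemma test_symbol_moment : I (fun x => `|x| * normc (a x)).
Proof.
have [C [C0 aC]] := test_symbol_bounded; have [[r r0] _] := ta.
have z x : `|x| * normc (a x) != 0 -> `|x| <= r%:R.
  by apply: contraNle => /r0 ->; rewrite normc0 mulr0.
apply: (integrable_cst_box (k := r) (c := r%:R * C)) => //.
- apply: measurable_funM; last exact: cmeasurable_normc test_symbol_cmeasurable.
  by apply: measurable_continuous => x; exact: norm_continuous.
- move=> x; rewrite ger0_norm ?mulr_ge0 ?normc_ge0//.
  have [->|/z xr] := eqVneq (`|x| * normc (a x)) 0; first by rewrite mulr_ge0.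
  by apply: ler_pM => //; exact: normc_ge0.
Qed.

End test.

Lemma Cintegrable_fdiff n (w : 'rV[R]_n) a : CI a -> CI (fdiff w a).
Proof.
move=> ia; apply: CintegrableB => //.
exact: (Cintegrable_mp (preserving_translate w) ia).
Qed.

(** The Fourier counterpart of a translation is a phase. *)
Lemma inv_fourier_fdiff n (w : 'rV[R]_n) a x : CI a ->
  inv_fourier (fdiff w a) x = (expi (- dotmul x w) - 1) * inv_fourier a x.
Proof.
move=> ia; rewrite /inv_fourier [RHS]mulrCA; congr (_ * _).
have mx := measurable_dotmul x.
have ix := Cintegrable_expiM mx ia.
have iw := Cintegrable_mp (preserving_translate w) ia.
transitivity (Cintegral (lam n) setT (fun xi => expi (dotmul x xi) * a (xi + w)) -
              Cintegral (lam n) setT (fun xi => expi (dotmul x xi) * a xi)).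
  rewrite -(CintegralB (Cintegrable_expiM mx iw) ix).
  by apply: eq_Cintegral => xi; rewrite /fdiff mulrBr.
rewrite mulrBl mul1r; congr (_ - _).
rewrite -(CintegralZ _ ix).
rewrite -[RHS](Cintegral_mp (preserving_translate w)
  (cmeasurable_integrable (CintegrableZ _ ix))).
apply: eq_Cintegral => xi.
by rewrite mulrA -expiD dotmulDr; congr (expi _ * _); ring.
Qed.

Lemma iter_inv_fourier_fdiff n N (w : 'rV[R]_n) a x : CI a ->
  inv_fourier (iter N (fdiff w) a) x = (expi (- dotmul x w) - 1) ^+ N * inv_fourier a x.
Proof.
move=> ia; have ii : forall l, CI (iter l (fdiff w) a).
  by elim=> [|l IH] //; rewrite iterS; exact: Cintegrable_fdiff.
elim: N => [|N IH]; first by rewrite expr0 mul1r.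
by rewrite iterS inv_fourier_fdiff// IH exprS mulrA.
Qed.

Lemma Re_iter_fdiff n N (w : 'rV[R]_n) (a : 'rV[R]_n -> R[i]) x :
  Re (iter N (fdiff w) a x) = iter N (fdiff w) (fun y => Re (a y)) x.
Proof. by elim: N x => [|N IH] x //; rewrite !iterS /fdiff Re_add Re_opp !IH. Qed.

Lemma Im_iter_fdiff n N (w : 'rV[R]_n) (a : 'rV[R]_n -> R[i]) x :
  Im (iter N (fdiff w) a x) = iter N (fdiff w) (fun y => Im (a y)) x.
Proof. by elim: N x => [|N IH] x //; rewrite !iterS /fdiff Im_add Im_opp !IH. Qed.

Lemma iter_fdiff_support n N (w : 'rV[R]_n) (a : 'rV[R]_n -> R[i]) r x :
  (forall y, r < `|y| -> a y = 0) -> r + N%:R * `|w| < `|x| -> iter N (fdiff w) a x = 0.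
Proof.
move=> a0; elim: N x => [|N IH] x; first by rewrite mul0r addr0; exact: a0.
rewrite -natr1 mulrDl mul1r addrA => h; rewrite iterS /fdiff !IH ?subrr//.
  by rewrite (le_lt_trans _ h)// lerDl.
rewrite -ltrBrDr in h; rewrite (lt_le_trans h)//.
by rewrite lerBlDr (le_trans _ (ler_normB _ _))// addrK.
Qed.

Lemma expi_pi : expi (- (pi : R)) = -1.
Proof. by apply: complex_eq => /=; rewrite ?cosN ?sinN ?cospi ?sinpi ?oppr0. Qed.

Lemma norm_delta_mx n (k : 'I_n) : `|delta_mx 0 k : 'rV[R]_n| <= 1.
Proof. by apply: norm_rV_le => // i; rewrite mxE; case: (_ && _); rewrite ?normr1 ?normr0. Qed.

(** Finite differences stand in for integration by parts. With the step w = (pi / x_k) e_k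
    the phase shift is -1, so that N differences of the symbol multiply its inverse
    transform at x by (-2)^N. On the other hand they are bounded by |pi / x_k|^N times the
    N-th derivatives and, since |x_k| >= 1 makes the step shorter than 4, they live in a
    fixed box. *)
Lemma inv_fourier_decay_coord n (a : 'rV[R]_n.+1 -> R[i]) (k : 'I_n.+1) N : test_symbol a ->
  exists C : R, 0 <= C /\
    forall x : 'rV[R]_n.+1, 1 <= `|x 0 k| -> `|x 0 k| ^+ N * normc (inv_fourier a x) <= C.
Proof.
move=> ta; have ia := test_symbol_integrable ta.
have [[r r0] da] := ta; have [d1 d2] := da k N.
set v : 'rV[R]_n.+1 := delta_mx 0 k in d1 d2.
have o : open [set x : 'rV[R]_n.+1 | r%:R < `|x|].
  rewrite (_ : [set _ | _] = (fun x : 'rV[R]_n.+1 => `|x|) @^-1` [set t | r%:R < t])//.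
  by apply: open_comp; [move=> x _; exact: norm_continuous|exact: open_gt].
have [C1 [C10 h1]] : exists C : R, 0 <= C /\ forall x, `|iter_derive v N (fun x => Re (a x)) x| <= C.
  apply: (bounded_of_compact_support (r := r%:R)); first exact: iter_derive_continuous.
  by apply: (iter_derive0 v N o) => x /r0 ->.
have [C2 [C20 h2]] : exists C : R, 0 <= C /\ forall x, `|iter_derive v N (fun x => Im (a x)) x| <= C.
  apply: (bounded_of_compact_support (r := r%:R)); first exact: iter_derive_continuous.
  by apply: (iter_derive0 v N o) => x /r0 ->.
(* a box containing the support of the N differences, steps being shorter than 4 *)
pose q := (r + N * 4)%N.
pose V := fine (lam n.+1 (@box R n.+1 q)).
have V0 : 0 <= V by apply: fine_ge0.
exists (`|(2 * pi) ^- n.+1| * (pi ^+ N * (C1 + C2) * V)); split.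
  by rewrite !mulr_ge0// ?exprn_ge0 ?pi_ge0// addr_ge0.
move=> x xk; have xk0 : x 0 k != 0 by rewrite -normr_gt0 (lt_le_trans _ xk).
pose t := pi / x 0 k.
have tN : `|t| * `|x 0 k| = pi by rewrite -normrM divfK// ger0_norm ?pi_ge0.
have t4 : `|t| <= 4.
  rewrite (@le_trans _ _ pi)//; last by have /andP[_] := @pihalf_02 R; lra.
  by rewrite -tN ler_peMr.
have xw : dotmul x (t *: v) = pi.
  rewrite dotmulZr /dotmul (bigD1 k)//= mxE !eqxx mulr1 big1 ?addr0 ?divfK//.
  by move=> i ik; rewrite mxE (negPf ik) andbF mulr0.
pose b := iter N (fdiff (t *: v)) a.
have bE : inv_fourier b x = (- 2) ^+ N * inv_fourier a x.
  by rewrite (iter_inv_fourier_fdiff N _ x ia) xw expi_pi; congr (_ ^+ _ * _); ring.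
have nb : normc (inv_fourier a x) <= normc (inv_fourier b x).
  rewrite bE [leRHS]normcM ler_peMl ?normc_ge0//.
  elim: (N) => [|l IH]; first by rewrite expr0 normc1.
  rewrite exprS normcM -[leLHS]mulr1 ler_pM//.
  by rewrite normcN (_ : 2 = 2%:C%C) ?normcR ?normr_nat ?ler1n//; apply: complex_eq => //=; rewrite addr0.
have bb y : normc (b y) <= `|t| ^+ N * (C1 + C2) * \1_(@box R n.+1 q) y.
  rewrite indicE; case: (boolP (y \in @box R n.+1 q)) => yq.
    rewrite mulr1 (le_trans (normc_le_ReIm _))// Re_iter_fdiff Im_iter_fdiff mulrDr lerD//.
      exact: iter_fdiff_bound.
    exact: iter_fdiff_bound.
  rewrite mulr0 /b (iter_fdiff_support (r := r%:R) (N := N)) ?normc0//.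
  rewrite ltNge; apply: contra yq => yq; rewrite inE => i.
  rewrite (le_trans (le_coord_norm _ _))// (le_trans yq)// /q natrD natrM lerD2l ler_wpM2l//.
  by rewrite normrZ (le_trans _ t4)// ler_piMr// norm_delta_mx.
have mB := @measurable_box R n.+1 q.
have i1 : I (\1_(@box R n.+1 q) : 'rV[R]_n.+1 -> R).
  apply/integrableP; split; first exact/measurable_EFinP.
  under eq_integral do rewrite /= ger0_norm//.
  by rewrite integral_indic// setIT; exact: box_fin.
have i2 := integrable_scale (`|t| ^+ N * (C1 + C2)) i1.
have ib l : CI (iter l (fdiff (t *: v)) a).
  by elim: l => [|l IH] //; rewrite iterS; exact: Cintegrable_fdiff.
have mb := cmeasurable_integrable (ib N).
have mx := measurable_dotmul x.
rewrite (le_trans (ler_wpM2l _ nb))// /inv_fourier normcM normcR mulrCA ler_wpM2l//.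
rewrite -tN exprMn.
have H : normc (Cintegral (lam n.+1) setT (fun xi => expi (dotmul x xi) * b xi)) <= `|t| ^+ N * (C1 + C2) * V.
  rewrite (_ : _ * V = \int[lam n.+1]_y (`|t| ^+ N * (C1 + C2) * \1_(@box R n.+1 q) y)).
    apply: Cintegral_bound => //.
      by apply: cmeasurableM => //; exact: cmeasurable_expi.
    by move=> xi; rewrite normcM normc_expi mul1r.
  rewrite RintegralZl//; congr (_ * _).
  by rewrite /V /Rintegral integral_indic// setIT.
rewrite (le_trans (ler_wpM2l _ H))//.
by rewrite le_eqVlt; apply/orP; left; apply/eqP; ring.
Qed.

End decay.

Section kernel_decay.
Context {R : realType}.

Lemma norm_rV_attained n (x : 'rV[R]_n) : `|x| != 0 -> exists i, `|x| = `|x 0 i|.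
Proof. by move/mx_norm_neq0 => [[i j] /= h]; exists j; rewrite -(ord1 i). Qed.

(** The largest coordinate of x is the sup norm; decay of order 2 n + 1 along it beats
    (1 + |x|) (1 + |x|^2)^n, which dominates the inverse of the weight. *)
Lemma inv_fourier_decay n (a : 'rV[R]_n.+1 -> R[i]) : test_symbol a ->
  exists C : R, 0 <= C /\
    forall x, (1 + `|x|) * normc (inv_fourier a x) <= C * decay_weight x.
Proof.
move=> ta; pose m := n.+1.
have [B [B0 kB]] := inv_fourier_bound (test_symbol_integrable ta).
have /choice[D hD] (k : 'I_n.+1) := inv_fourier_decay_coord k (2 * m).+1 ta.
pose S := \sum_k D k.
have S0 : 0 <= S by apply: sumr_ge0 => k _; case: (hD k).
have DS k : D k <= S.
  by rewrite /S (bigD1 k)//= lerDl; apply: sumr_ge0 => i _; case: (hD i).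
exists (2 ^+ m * 2 * (B + S)); split; first by rewrite !mulr_ge0// addr_ge0.
move=> x; set y := `|x|; set K := normc _.
have K0 : 0 <= K by exact: normc_ge0.
have y0 : 0 <= y by exact: normr_ge0.
have w1 : (1 + y ^+ 2) ^- m <= decay_weight x.
  rewrite /decay_weight -[m]card_ord -prodr_const -prodfV; apply: ler_prod => i _.
  rewrite invr_ge0 addr_ge0 ?sqr_ge0//= lef_pV2 ?posrE ?ltr_wpDr ?sqr_ge0//.
  by rewrite lerD2l -[x 0 i ^+ 2]real_normK ?num_real// lerXn2r ?nnegrE// le_coord_norm.
have w0 : 0 < 1 + y ^+ 2 by rewrite ltr_wpDr ?sqr_ge0.
suff H : (1 + y) * K * (1 + y ^+ 2) ^+ m <= 2 ^+ m * 2 * (B + S).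
  rewrite (le_trans _ (ler_wpM2l _ w1))//; last by rewrite !mulr_ge0// addr_ge0.
  by rewrite ler_pdivlMr ?exprn_gt0.
have [y1|y1] := leP y 1.
  have KB : K <= B + S by rewrite (le_trans (kB x))// lerDl.
  have -> : 2 ^+ m * 2 * (B + S) = 2 * (B + S) * 2 ^+ m :> R by ring.
  apply: ler_pM; rewrite ?mulr_ge0 ?exprn_ge0 ?addr_ge0 ?sqr_ge0//.
    apply: ler_pM; rewrite ?addr_ge0//; lra.
  rewrite lerXn2r ?nnegrE ?addr_ge0 ?sqr_ge0//.
  by rewrite -[leRHS]/(1 + 1) lerD2l expr_le1.
have [k yk] : exists i, `|x| = `|x 0 i| by apply: norm_rV_attained; rewrite gt_eqF ?(lt_trans _ y1).
have HK : y ^+ (2 * m).+1 * K <= B + S.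
  rewrite /y yk; case: (hD k) => _ /(_ x); rewrite -yk => /(_ (ltW y1)) h.
  by rewrite (le_trans h)// (le_trans (DS k))// lerDr.
have e1 : (1 + y) * K * (1 + y ^+ 2) ^+ m <= (2 * y) * K * (2 * y ^+ 2) ^+ m.
  apply: ler_pM; rewrite ?mulr_ge0 ?exprn_ge0 ?addr_ge0 ?sqr_ge0//.
    by rewrite ler_wpM2r//; lra.
  rewrite lerXn2r ?nnegrE ?mulr_ge0 ?addr_ge0 ?sqr_ge0//.
  by rewrite mulr_natl mulr2n lerD2r exprn_ege1// ltW.
rewrite (le_trans e1)// exprMn -exprM.
have -> : 2 * y * K * (2 ^+ m * y ^+ (2 * m)) = 2 ^+ m * 2 * (y ^+ (2 * m).+1 * K).
  by rewrite exprS; ring.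
by rewrite ler_wpM2l// mulr_ge0// exprn_ge0.
Qed.

Section off0.
Context {n : nat} (phi : 'rV[R]_n -> R) (tphi : test_function_off0 phi).

Lemma test_function_outside : open (~` supp phi) /\ forall x, (~` supp phi) x -> phi x = 0.
Proof.
split; first by apply: closed_openC; exact: closed_closure.
move=> x nx; apply/eqP; apply: contrapT => /negP px; apply: nx.
exact: subset_closure.
Qed.

Lemma test_function_at0 : phi 0 = 0.
Proof. by case: tphi => _ _; exact: test_function_outside.2. Qed.

Lemma test_function_bounded_support : exists r : nat, forall x, r%:R < `|x| -> phi x = 0.
Proof.
case: tphi => _ /compact_bounded[M [_ hM]] _.
exists (Num.truncn M).+1 => x hx; apply: test_function_outside.2 => sx.
have /= := hM _ (truncnS_gt M) x sx.
by rewrite leNgt hx.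
Qed.

(** Near the origin the product vanishes with phi, away from it both factors are
    smooth. *)
Lemma diff_along_mul_off0 (h : 'rV[R]_n -> R) (k : 'I_n) N :
  smooth_on [set xi | xi != 0] h -> diff_along (delta_mx 0 k) N setT (fun x => phi x * h x).
Proof.
move=> sh; case: tphi => sphi _ n0.
have [oU pU] := test_function_outside.
rewrite (_ : setT = [set x | x != 0] `|` ~` supp phi); last first.
  apply/esym/seteqP; split => // x _; have [->|x0] := eqVneq x 0; first by right.
  by left.
apply: diff_alongU.
  apply: diff_alongM; first exact: open_neq0_rV.
    by apply: smooth_on_diff_along => s x _; exact: sphi.
  exact: smooth_on_diff_along.
apply: (diff_along_eq oU _ (diff_along_cst _ N _ 0)) => x Ux.
by rewrite pU// mul0r.
Qed.

Lemma test_symbol_mul (m : 'rV[R]_n -> R[i]) : csmooth_on [set xi | xi != 0] m ->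
  test_symbol (fun xi => (phi xi)%:C%C * m xi).
Proof.
move=> [sr si]; have [r r0] := test_function_bounded_support; split.
  by exists r => x /r0 ->; rewrite mul0r.
move=> k N; split.
  rewrite (_ : (fun _ => _) = (fun x => phi x * Re (m x))); first exact: diff_along_mul_off0.
  by apply/funext => x; rewrite Re_mul/= mul0r subr0.
rewrite (_ : (fun _ => _) = (fun x => phi x * Im (m x))); first exact: diff_along_mul_off0.
by apply/funext => x; rewrite Im_mul/= mul0r addr0.
Qed.

Lemma test_symbolR : test_symbol (fun xi => (phi xi)%:C%C).
Proof.
have [r r0] := test_function_bounded_support; split; first by exists r => x /r0 ->.
move=> k N; split => /=; last exact: diff_along_cst.
by apply: smooth_on_diff_along; case: tphi.
Qed.

End off0.
End kernel_decay.

(** * Cancellation against radial functions *)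

Section polar.
Context {R : realType} {n : nat}.
Local Notation rV := 'rV[R]_n.+1.
Local Notation lam := (@lebesgue_rV R n.+1).
Local Notation I h := (lam.-integrable setT (EFin \o h)).

Lemma enormE (x : rV) : enorm x ^+ 2 = dotmul x x.
Proof. by rewrite sqr_sqrtr ?dotmul_ge0. Qed.

Lemma enorm_ge0 (x : rV) : 0 <= enorm x.
Proof. exact: sqrtr_ge0. Qed.

Lemma enorm0 : enorm (0 : rV) = 0.
Proof. by rewrite /enorm /dotmul big1 ?sqrtr0// => i _; rewrite mxE mul0r. Qed.

Lemma enorm_eq0 (x : rV) : enorm x = 0 -> x = 0.
Proof. by move=> e0; apply: dotmul_eq0; rewrite -enormE e0 expr0n. Qed.

Lemma enormZ (t : R) (x : rV) : 0 <= t -> enorm (t *: x) = t * enorm x.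
Proof.
move=> t0; rewrite /enorm dotmulZl dotmulZr mulrA sqrtrM ?mulr_ge0//.
by rewrite -expr2 sqrtr_sqr ger0_norm.
Qed.

Lemma norm_le_enorm (x : rV) : `|x| <= enorm x.
Proof.
apply: norm_rV_le => [|i]; first exact: enorm_ge0.
rewrite -sqrtr_sqr ler_sqrt ?dotmul_ge0// /dotmul (bigD1 i)//= -expr2 lerDl.
by apply: sumr_ge0 => j _; rewrite -expr2 sqr_ge0.
Qed.

Lemma enorm_axis (t : R) : 0 <= t -> enorm (t *: delta_mx 0 ord0 : rV) = t.
Proof.
move=> t0; rewrite enormZ// (_ : enorm _ = 1) ?mulr1//.
rewrite /enorm /dotmul (bigD1 ord0)//= !mxE !eqxx mulr1 big1 ?addr0 ?sqrtr1//.
by move=> i i0; rewrite mxE (negPf i0) andbF mul0r.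
Qed.

Lemma edirE (x : rV) : enorm (edir x) = (x != 0)%:R.
Proof.
rewrite /edir enormZ ?invr_ge0 ?enorm_ge0//; have [->|x0] := eqVneq x 0.
  by rewrite enorm0 mulr0.
by rewrite mulVf//; apply: contra x0 => /eqP/enorm_eq0 ->.
Qed.

Lemma edir_preimage_esphere : @edir R n.+1 @^-1` esphere = [set x | x != 0].
Proof.
apply/seteqP; split => x /=; rewrite /esphere/= edirE; first by case: eqVneq => // _ /eqP; rewrite eq_sym oner_eq0.
by move=> ->.
Qed.

Lemma measurable_esphere : measurable (@esphere R n.+1).
Proof.
rewrite (_ : esphere = [set: rV] `&` enorm @^-1` [set 1]); last first.
  by apply/seteqP; split => x //= [].
by apply: measurable_enorm => //; exact: measurable_set1.
Qed.

Lemma ge0_integral_mrestr (A D : set rV) (mA : measurable A) (f : rV -> \bar R) :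
  measurable D -> measurable_fun setT f -> (forall x, (0 <= f x)%E) ->
  (\int[mrestr lam mA]_(x in D) f x = \int[lam]_(x in D `&` A) f x)%E.
Proof.
move=> mD mf f0.
have -> : (\int[mrestr lam mA]_(x in D) f x =
   \int[mrestr lam mA]_(x in D `&` A) f x + \int[mrestr lam mA]_(x in D `\` A) f x)%E.
  rewrite -ge0_integral_setU//.
  - by rewrite setUIDK.
  - exact: measurableI.
  - exact: measurableD.
  - by apply: measurable_funTS.
  - by apply/disj_setPS => x [[_ ?] [_ ?]].
rewrite [X in (_ + X)%E](_ : _ = 0%E) ?adde0.
  apply: eq_measure_integral => B mB BDA /=; rewrite /mrestr; congr (lam _).
  by apply/setIidPl => x /BDA[].
apply: null_set_integral; first exact: measurableD.
  exact: measurable_funTS.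
by rewrite /= /mrestr setDE -setIA setICl setI0 measure0.
Qed.

(** Integrals of homogeneous functions over the sphere are integrals over the ball: the
    surface measure is n times the image of the Lebesgue measure of the ball under the
    radial projection, which leaves such functions unchanged. The value at the origin has
    to be 0 because the projection does not map it to the sphere. *)
Lemma ge0_integral_esphere (f : rV -> \bar R) :
  measurable_fun setT f -> (forall x, (0 <= f x)%E) -> (forall x, f (edir x) = f x) ->
  f 0 = 0%E ->
  (\int[surface_measure]_(x in esphere) f x = n.+1%:R%:E * \int[lam]_(x in eball) f x)%E.
Proof.
move=> mf f0 fe f00.
have mfs : measurable_fun (@esphere R n.+1) f by exact: measurable_funTS.
have ep := ge0_integral_pushforward (@measurable_edir R n.+1)
  (mrestr lam (@measurable_eball R n.+1)) measurable_esphere mfs (fun x _ => f0 x).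
have E : (\int[cone_measure]_(x in esphere) f x = \int[lam]_(x in eball) f x)%E.
  apply: (etrans _ (etrans ep _)); first exact: (eq_measure_integral _ (fun A mA _ => erefl)).
  clear ep; rewrite edir_preimage_esphere.
  under eq_integral do rewrite /= fe.
  have m0 : measurable [set x : rV | x != 0].
    exact: (open_measurable_rV (open_neq0_rV (n := n.+1))).
  rewrite (ge0_integral_mrestr _ m0 mf f0).
  rewrite integral_mkcond [RHS]integral_mkcond; apply: eq_integral => x _.
  rewrite !patchE; have [->|x0] := eqVneq x 0.
    by rewrite f00 !if_same.
  have xE : (x \in [set x : rV | x != 0] `&` eball) = (x \in eball).
    by apply/idP/idP; rewrite !inE; [case|split].
  by rewrite xE.
rewrite /surface_measure.
rewrite (ge0_integral_mscale _ measurable_esphere _ mfs (fun x _ => f0 x)).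
by rewrite E.
Qed.

End polar.

Section radial_cancellation.
Context {R : realType} {n : nat}.
Local Notation rV := 'rV[R]_n.+1.
Local Notation lam := (@lebesgue_rV R n.+1).
Local Notation I h := (lam.-integrable setT (EFin \o h)).

Definition ball_ind (t : R) (x : rV) : R := (enorm x <= t)%R%:R.

Lemma measurable_ball_ind t : measurable_fun setT (ball_ind t).
Proof.
rewrite (_ : ball_ind t = \1_(enorm @^-1` `]-oo, t]%classic)); last first.
  apply/funext => x; rewrite indicE /ball_ind; congr (_ : bool)%:R.
  by apply/idP/idP; rewrite inE/= in_itv.
apply: measurable_indic; rewrite -[X in measurable X]setTI.
by apply: measurable_enorm => //; exact: measurable_itv.
Qed.

Lemma ball_ind_ge0 t x : 0 <= ball_ind t x.
Proof. by rewrite /ball_ind. Qed.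

Lemma integrable_mul_ball_ind (h : rV -> R) t C : measurable_fun setT h ->
  (forall x, enorm x <= t -> `|h x| <= C) -> I (fun x => h x * ball_ind t x).
Proof.
move=> mh hC; have [t0|t0] := ltP t 0.
  rewrite (_ : (fun _ => _) = cst 0); first exact: integrable0.
  apply/funext => x /=; rewrite /ball_ind leNgt (lt_le_trans t0)//= ?mulr0//.
  exact: enorm_ge0.
have C0 : 0 <= C by apply: le_trans (hC 0 _) => //; rewrite enorm0.
apply: (integrable_cst_box (k := (Num.truncn t).+1) (c := C)).
- by apply: measurable_funM => //; exact: measurable_ball_ind.
- move=> x; rewrite normrM /ball_ind; case: (leP (enorm x) t) => xt.
    by rewrite normr1 mulr1 hC.
  by rewrite normr0 mulr0.
- move=> x; rewrite /ball_ind; case: (leP (enorm x) t) => xt; last by rewrite mulr0 eqxx.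
  move=> _; rewrite (le_trans (norm_le_enorm x))// (le_trans xt)// ltW// truncnS_gt//.
Qed.

Section homogeneous.
Variables (h : rV -> R) (Ch : R).
Hypotheses (mh : measurable_fun setT h) (hC : forall x, `|h x| <= Ch) (h0 : h 0 = 0)
  (hom : forall t x, 0 < t -> h (t *: x) = h x).

Let ihb t : I (fun x => h x * ball_ind t x).
Proof. by apply: integrable_mul_ball_ind mh _ => x _; exact: hC. Qed.

Lemma mean_zero_unit_ball : \int[surface_measure]_(x in esphere) h x = 0 ->
  \int[lam]_x (h x * ball_ind 1 x) = 0.
Proof.
have he x : h (edir x) = h x.
  have [->|x0] := eqVneq x 0; first by rewrite /edir scaler0.
  rewrite /edir hom// invr_gt0 lt_neqAle enorm_ge0 andbT eq_sym.
  by apply: contra x0 => /eqP/enorm_eq0 ->.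
pose F := EFin \o h.
have mF : measurable_fun setT F by exact/measurable_EFinP.
have ep : (\int[surface_measure]_(x in esphere) F^\+ x =
           n.+1%:R%:E * \int[lam]_(x in eball) F^\+ x)%E.
  apply: ge0_integral_esphere => //; first exact: measurable_funepos.
    by move=> x; rewrite !funeposE /F /= he.
  by rewrite funeposE /F /= h0 maxxx.
have en : (\int[surface_measure]_(x in esphere) F^\- x =
           n.+1%:R%:E * \int[lam]_(x in eball) F^\- x)%E.
  apply: ge0_integral_esphere => //; first exact: measurable_funeneg.
    by move=> x; rewrite !funenegE /F /= he.
  by rewrite funenegE /F /= h0 oppr0 maxxx.
have iF : lam.-integrable eball F.
  have := ihb 1; rewrite /F => ih.
  apply: (eq_integrable _ (EFin \o (fun x => h x * ball_ind 1 x))) => //.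
  - exact: measurable_eball.
  - move=> x; rewrite inE /eball/= => x1; by rewrite /ball_ind x1 mulr1.
  - apply: integrableS ih => //; exact: measurable_eball.
have fp := integrable_pos_fin_num measurable_eball iF.
have fn := integrable_neg_fin_num measurable_eball iF.
rewrite /Rintegral integralE -/F ep en.
rewrite -(fineK fp) -(fineK fn) -!EFinM -EFinB /= -mulrBr => /eqP.
rewrite mulf_eq0 pnatr_eq0/= subr_eq0 => /eqP H.
have -> : (\int[lam]_x (h x * ball_ind 1 x)%:E = \int[lam]_(x in eball) F x)%E.
  rewrite [RHS]integral_mkcond; apply: eq_integral => x _.
  rewrite patchE /ball_ind; case: (boolP (x \in eball)) => [|].
    by rewrite inE /eball/= => ->; rewrite mulr1.
  by rewrite notin_setE /eball/= => /negP/negPf ->; rewrite mulr0.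
by rewrite integralE -(fineK fp) -(fineK fn) H subee.
Qed.

(** All balls reduce to the unit ball by a dilation. *)
Lemma mean_zero_balls : \int[lam]_x (h x * ball_ind 1 x) = 0 ->
  forall t, \int[lam]_x (h x * ball_ind t x) = 0.
Proof.
move=> h1 t; have [t0|t0] := leP t 0.
  rewrite (@eq_Rintegral _ _ _ lam setT (cst 0)) ?Rintegral_cst ?mul0r// => x _ /=.
  rewrite /ball_ind; case: (leP (enorm x) t) => xt; last by rewrite mulr0.
  have -> : x = 0 by apply: enorm_eq0; apply/eqP; rewrite eq_le enorm_ge0 (le_trans xt).
  by rewrite h0 mul0r.
rewrite -(Rintegral_dilate t0 (ihb t)).
have E x : h (t *: x) * ball_ind t (t *: x) = h x * ball_ind 1 x.
  by rewrite hom// /ball_ind (enormZ _ (ltW t0)) ger_pMr.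
by under eq_Rintegral do rewrite E; rewrite h1 mulr0.
Qed.

Hypothesis hb : forall t, \int[lam]_x (h x * ball_ind t x) = 0.

(** A function whose integral vanishes on every centred ball also integrates to zero
    against compactly supported Lipschitz functions of the norm. Cut the ball of radius B into k shells of
    width B / k: on each of them eta may be replaced by a constant up to an error of
    order 1 / k, and the constant contributes nothing. The total error is of order 1 / k
    times the volume of the ball, for every k. This replaces polar coordinates. *)
Lemma radial_cancellation (eta : rV -> R) (Lam B : R) :
  measurable_fun setT eta ->
  (forall x y, `|eta x - eta y| <= Lam * `|enorm x - enorm y|) ->
  (forall x, B < enorm x -> eta x = 0) ->
  \int[lam]_x (h x * eta x) = 0.
Proof.
move=> me el eB.
have Ch0 : 0 <= Ch by apply: le_trans (hC 0).
wlog L0 : Lam el / 0 <= Lam.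
  move=> H; apply: (H `|Lam|) => // x y.
  by rewrite (le_trans (el x y))// ler_wpM2r// ler_norm.
wlog B0 : B eB / 0 < B.
  move=> H; apply: (H (`|B| + 1)); last by rewrite ltr_wpDl.
  by move=> x xB; apply: eB; rewrite (le_lt_trans _ xB)// (le_trans (ler_norm B))// lerDl.
have eb t x : enorm x <= t -> `|eta x| <= `|eta 0| + Lam * t.
  move=> xt; have := el x 0; rewrite enorm0 subr0 [`|enorm x|]ger0_norm ?enorm_ge0// => e1.
  rewrite -[eta x](subrK (eta 0)) (le_trans (ler_normD _ _))// addrC lerD2l (le_trans e1)//.
  by rewrite ler_wpM2l.
have i1 t : I (fun x => h x * eta x * ball_ind t x).
  apply: (integrable_mul_ball_ind (C := Ch * (`|eta 0| + Lam * t))).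
    exact: measurable_funM.
  by move=> x xt; rewrite normrM ler_pM// eb.
have i0 t : I (ball_ind t).
  have := @integrable_mul_ball_ind (cst 1) t 1 (measurable_cst _).
  rewrite (_ : (fun x => cst 1 x * _) = ball_ind t); last by apply/funext => x; rewrite mul1r.
  by apply => x _; rewrite normr1.
pose Phi t := \int[lam]_x (h x * eta x * ball_ind t x).
pose v t := \int[lam]_x ball_ind t x.
have step s t : 0 <= s -> s <= t -> `|Phi t - Phi s| <= Lam * Ch * (t - s) * (v t - v s).
  move=> s0 st; pose p : rV := t *: delta_mx 0 ord0.
  have pt : enorm p = t by rewrite enorm_axis// (le_trans s0).
  have -> : Phi t - Phi s = \int[lam]_x (h x * (eta x - eta p) * (ball_ind t x - ball_ind s x)).
    pose G x := h x * eta x * ball_ind t x - h x * eta x * ball_ind s x.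
    pose G' x := eta p * (h x * ball_ind t x) - eta p * (h x * ball_ind s x).
    have iG : I G by exact: (integrableB measurableT (i1 t) (i1 s)).
    have j t' := integrable_scale (eta p) (ihb t').
    have iG' : I G' by exact: (integrableB measurableT (j t) (j s)).
    have E1 : \int[lam]_x G x = Phi t - Phi s by rewrite RintegralB.
    have E2 : \int[lam]_x G' x = 0.
      rewrite RintegralB// !RintegralZl//; first by rewrite !hb !mulr0 subr0.
    rewrite -E1 -[LHS]subr0 -E2 -RintegralB//.
    by apply: eq_Rintegral => x _; rewrite /G /G'; ring.
  have iH : I (fun x => h x * (eta x - eta p) * (ball_ind t x - ball_ind s x)).
    have a1 t' : I (fun x => h x * (eta x - eta p) * ball_ind t' x).
      apply: (integrable_mul_ball_ind (C := Ch * (`|eta 0| + Lam * t' + `|eta p|))).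
        by apply: measurable_funM => //; apply: measurable_funB.
      move=> x xt; rewrite normrM ler_pM// (le_trans (ler_normB _ _))// lerD2r; exact: eb.
    rewrite (_ : (fun _ => _) = (fun x => h x * (eta x - eta p) * ball_ind t x -
       h x * (eta x - eta p) * ball_ind s x)).
      exact: (integrableB measurableT (a1 t) (a1 s)).
    by apply/funext => x; ring.
  rewrite (le_trans (le_normr_Rintegral _ iH))//.
  have iD : I (fun x => ball_ind t x - ball_ind s x) by exact: (integrableB measurableT (i0 t) (i0 s)).
  rewrite -RintegralB// -RintegralZl//; apply: le_Rintegral => //.
  - exact: integrable_norm iH.
  - exact: integrable_scale.
  move=> x _; rewrite !normrM.
  have [xs|xs] := leP (enorm x) s.
    by rewrite /ball_ind xs (le_trans xs st) subrr normr0 !mulr0.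
  have [xt|xt] := leP (enorm x) t; last first.
    by rewrite /ball_ind (lt_geF xs) (lt_geF xt)/= subrr normr0 !mulr0.
  rewrite /ball_ind xt (lt_geF xs)/= subr0 normr1 !mulr1 mulrC [Lam * Ch]mulrC -mulrA mulrC.
  apply: ler_pM => //.
  rewrite (le_trans (el _ _))// pt ler_wpM2l// ler0_norm ?subr_le0//.
  by rewrite opprB lerB// ltW.
have Phi0 : Phi 0 = 0.
  rewrite /Phi (@eq_Rintegral _ _ _ lam setT (cst 0)) ?Rintegral_cst ?mul0r// => x _ /=.
  rewrite /ball_ind; case: (leP (enorm x) 0) => xt; last by rewrite mulr0.
  have -> : x = 0 by apply: enorm_eq0; apply/eqP; rewrite eq_le enorm_ge0 xt.
  by rewrite h0 !mul0r.
have v0 : 0 <= v 0 by apply: Rintegral_ge0 => x _; exact: ball_ind_ge0.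
have vB : 0 <= v B by apply: Rintegral_ge0 => x _; exact: ball_ind_ge0.
have small K : (0 < K)%N -> `|Phi B| <= Lam * Ch * (B / K%:R) * v B.
  move=> K0; pose d := B / K%:R.
  have d0 : 0 <= d by rewrite divr_ge0// ltW.
  have KB : K%:R * d = B by rewrite mulrC divfK// pnatr_eq0 -lt0n.
  (* the errors on the shells add up telescopically in the volume *)
  suff H k : `|Phi (k%:R * d)| <= Lam * Ch * d * v (k%:R * d) by have := H K; rewrite KB.
  elim: k => [|k IH]; first by rewrite mul0r Phi0 normr0; do 2 (apply: mulr_ge0 => //); exact: mulr_ge0.
  have kd : 0 <= k%:R * d by rewrite mulr_ge0.
  have := step (k%:R * d) (k.+1%:R * d) kd.
  rewrite -natr1 mulrDl mul1r lerDl => /(_ d0); rewrite addrAC subrr add0r => st.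
  rewrite -[Phi (k%:R * d + d)](subrK (Phi (k%:R * d))) (le_trans (ler_normD _ _))//.
  rewrite (le_trans (lerD st IH))// -mulrDr subrK//.
have PB : Phi B = 0.
  apply/eqP; rewrite -normr_eq0 eq_le normr_ge0 andbT; apply/ler_addgt0Pr => e e0.
  pose Q := Lam * Ch * B * v B.
  have Q0 : 0 <= Q by rewrite !mulr_ge0// ltW.
  pose K := (Num.truncn (Q / e)).+1.
  rewrite (le_trans (small K _))// add0r.
  rewrite (_ : _ * v B = Q / K%:R); last by rewrite /Q; field; rewrite pnatr_eq0.
  rewrite ler_pdivrMr ?ltr0n// mulrC -ler_pdivrMr// ltW// truncnS_gt//.
rewrite -PB; apply: eq_Rintegral => x _; rewrite /ball_ind.
by case: (leP (enorm x) B) => xB; rewrite ?mulr1// eB// mulr0 mul0r.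
Qed.

End homogeneous.
End radial_cancellation.

Section cancellation.
Context {R : realType} {n : nat}.
Local Notation rV := 'rV[R]_n.+1.
Local Notation lam := (@lebesgue_rV R n.+1).
Local Notation I h := (lam.-integrable setT (EFin \o h)).
Local Notation CI f := (Cintegrable lam setT f).

(** Parseval, in the form that moves the inverse transform to the other factor. *)
Lemma inv_fourier_swap (a H : rV -> R[i]) : CI a -> CI H ->
  Cintegral lam setT (fun x => inv_fourier a x * H x) =
  Cintegral lam setT (fun xi => a xi * inv_fourier H xi).
Proof.
move=> ia iH; have ma := cmeasurable_integrable ia; have mH := cmeasurable_integrable iH.
pose c : R[i] := ((2 * pi) ^- n.+1)%:C%C.
pose F (x xi : rV) := c * (expi (dotmul x xi) * a xi) * H x.
have [_ _ FE] : [/\ CI (fun x => Cintegral lam setT (F x)),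
      CI (fun xi => Cintegral lam setT (F ^~ xi)) &
      Cintegral lam setT (fun x => Cintegral lam setT (F x)) =
      Cintegral lam setT (fun xi => Cintegral lam setT (F ^~ xi))].
  apply: (Cfubini_dom (@sigma_finite_lam R n.+1) (@sigma_finite_lam R n.+1) _
    (integrable_normc iH) (integrable_scale (normc c) (integrable_normc ia))) => [|x xi].
    apply: cmeasurableM; last exact: (cmeasurable_comp mH measurable_fst).
    apply: cmeasurableM; first exact: cmeasurable_cst.
    apply: cmeasurableM; last exact: (cmeasurable_comp ma measurable_snd).
    apply: cmeasurable_expi.
    by apply: measurable_dotmul2; [exact: measurable_fst|exact: measurable_snd].
  by rewrite !normcM normc_expi mul1r mulrC.
transitivity (Cintegral lam setT (fun x => Cintegral lam setT (F x))).
  apply: eq_Cintegral => x; rewrite /inv_fourier -/c.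
  have ie := Cintegrable_expiM (measurable_dotmul x) ia.
  by rewrite /F (CintegralZr _ (CintegrableZ c ie)) (CintegralZ c ie).
rewrite FE; apply: eq_Cintegral => xi; rewrite /inv_fourier -/c.
have ie := Cintegrable_expiM (measurable_dotmul xi) iH.
rewrite mulrA -(CintegralZ _ ie); apply: eq_Cintegral => x.
by rewrite /F dotmulC; ring.
Qed.

(** The value of m at the origin is arbitrary; setting it to 0 makes the function
    homogeneous everywhere. *)
Definition zero_at0 (u : rV -> R) (x : rV) : R := if x == 0 then 0 else u x.

Section component.
Variable u : rV -> R.
Hypotheses (cu : forall x, x != 0 -> {for x, continuous u})
  (hu : forall (t : R) x, 0 < t -> x != 0 -> u (t *: x) = u x)
  (u0 : \int[surface_measure]_(x in esphere) u x = 0).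
Local Notation h := (zero_at0 u).

Lemma measurable_zero_at0 : measurable_fun setT h.
Proof.
apply: measurable_off0 => x x0; apply: (near_eq_continuous _ (cu x0)).
apply: filterS (open_nbhs_nbhs (conj (open_neq0_rV (n := n.+1)) x0)) => y /= y0.
by rewrite /zero_at0 (negPf y0).
Qed.

Lemma zero_at0_hom (t : R) x : 0 < t -> h (t *: x) = h x.
Proof.
move=> t0; rewrite /zero_at0 scaler_eq0 gt_eqF//=.
by case: eqVneq => // x0; exact: hu.
Qed.

(** By homogeneity the bound is a maximum over the unit sphere of the sup norm, which
    is compact. *)
Lemma zero_at0_bounded : exists C : R, forall x, `|h x| <= C.
Proof.
pose K := [set x : rV | `|x| = 1].
have K0 : K !=set0.
  exists (delta_mx 0 ord0); apply/eqP; rewrite eq_le norm_delta_mx/=.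
  by have := le_coord_norm (delta_mx 0 ord0 : rV) ord0; rewrite mxE !eqxx normr1.
have cK : compact K.
  apply: bounded_closed_compact.
    exists 1; split; first exact: num_real.
    by move=> s s1 x Kx; apply: le_trans (ltW s1); rewrite le_eqVlt; apply/orP; left; apply/eqP.
  rewrite (_ : K = (fun x : rV => `|x|) @^-1` [set 1])//.
  apply: closed_comp; last exact: (accessible_closed_set1 (hausdorff_accessible (@Rhausdorff R))).
  by move=> x _; exact: norm_continuous.
have [c _ hc] : exists2 c, c \in K & forall t, t \in K -> `|u t| <= `|u c|.
  apply: compact_EVT_max => //; apply: continuous_in_subspaceT => x; rewrite inE => Kx.
  apply: continuous_comp; last exact: norm_continuous.
  by apply: cu; rewrite -normr_gt0 Kx.
exists `|u c| => x; rewrite /zero_at0; case: (eqVneq x 0) => [_|x0]; first by rewrite normr0.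
have nx : 0 < `|x| by rewrite normr_gt0.
rewrite -(@hu `|x|^-1)// ?invr_gt0//; apply: hc.
by rewrite inE /K/= normrZ ger0_norm ?invr_ge0// mulVf// gt_eqF.
Qed.

Lemma homogeneous_cancellation (eta : rV -> R) (Lam B : R) :
  measurable_fun setT eta ->
  (forall x y, `|eta x - eta y| <= Lam * `|enorm x - enorm y|) ->
  (forall x, B < enorm x -> eta x = 0) ->
  \int[lam]_x (h x * eta x) = 0.
Proof.
have [C hC] := zero_at0_bounded.
have h0 : h 0 = 0 by rewrite /zero_at0 eqxx.
have hh x : esphere x -> h x = u x.
  rewrite /esphere/= /zero_at0 => x1; have [x0|//] := eqVneq x 0.
  by move: x1; rewrite x0 enorm0 => /eqP; rewrite eq_sym oner_eq0.
apply: (radial_cancellation (Ch := C) measurable_zero_at0 hC h0) => //.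
apply: (mean_zero_balls (Ch := C)) => //.
- exact: measurable_zero_at0.
- exact: zero_at0_hom.
apply: (mean_zero_unit_ball (Ch := C)) => //.
- exact: measurable_zero_at0.
- exact: zero_at0_hom.
by rewrite -u0; apply: eq_Rintegral => x; rewrite inE; exact: hh.
Qed.

End component.

(** By Parseval the integral becomes that of m against rho times the inverse transform of
    H. The latter function is radial, and it is Lipschitz because H has a first moment; a
    radial Lipschitz function is a Lipschitz function of the norm, so the vanishing mean of m
    applies to the real and imaginary parts. *)
Lemma kernel_cancellation (rho : rV -> R) (m H : rV -> R[i]) :
  test_function_off0 rho -> radial rho ->
  csmooth_on [set xi | xi != 0] m -> homogeneous0 m ->
  Cintegral surface_measure esphere m = 0 ->
  CI H -> I (fun x => `|x| * normc (H x)) ->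
  (forall x y, enorm x = enorm y -> H x = H y) ->
  Cintegral lam setT (fun x => inv_fourier (fun xi => (rho xi)%:C%C * m xi) x * H x) = 0.
Proof.
move=> trho rrho sm hom m0 iH iH1 rH.
have ia := test_symbol_integrable (test_symbol_mul trho sm).
rewrite (inv_fourier_swap ia iH); set q := inv_fourier H.
have tr := test_symbolR trho.
have [[r r0] dr] := tr.
have {}r0 x : r%:R < `|x| -> rho x = 0 by move=> /r0 [].
have qr x y : enorm x = enorm y -> q x = q y.
  by apply: inv_fourier_radial => //; exact: cmeasurable_integrable iH.
have [Cq [Cq0 qC]] := inv_fourier_bound iH.
have [Lq [Lq0 qL]] := inv_fourier_lipschitz iH iH1.
have mq := cmeasurable_lipschitz qL.
have mrho : measurable_fun setT rho by case: (test_symbol_cmeasurable tr).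
have [Cr [Cr0 rC]] : exists C : R, 0 <= C /\ forall x, `|rho x| <= C.
  apply: (bounded_of_compact_support (r := r%:R)) => //.
  by case: (test_symbol_continuous tr).
pose e0 : rV := delta_mx 0 ord0.
have [s1 [s2 s3]] : diff_along e0 1%N setT rho by case: (dr ord0 1%N).
have [Lr [Lr0 rL]] : exists C : R, 0 <= C /\ forall x, `|'D_e0 rho x| <= C.
  apply: (bounded_of_compact_support (r := r%:R)).
    by move=> x; case: s3 => c _; exact: c.
  move=> x xr; have o : open [set x : rV | r%:R < `|x|].
    rewrite (_ : [set _ | _] = (fun x : rV => `|x|) @^-1` [set t | r%:R < t])//.
    by apply: open_comp; [move=> ? _; exact: norm_continuous|exact: open_gt].
  exact: (iter_derive0 e0 1%N o (fun y yr => r0 y yr) xr).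
have ax (x : rV) : enorm (enorm x *: e0) = enorm x by rewrite enorm_axis ?enorm_ge0.
have rx x : rho x = rho (enorm x *: e0) by apply: rrho; rewrite ax.
have qx x : q x = q (enorm x *: e0) by apply: qr; rewrite ax.
have Ler x y : `|rho x - rho y| <= Lr * `|enorm x - enorm y|.
  have d y' : derivable rho y' e0 by exact: s2.
  have := fdiff_bound (enorm x - enorm y) d rL (enorm y *: e0).
  by rewrite /fdiff -scalerDl [enorm y + _]addrC subrK -!rx mulrC.
have Leq x y : normc (q x - q y) <= Lq * `|enorm x - enorm y|.
  rewrite (qx x) (qx y) (le_trans (qL _ _))// ler_wpM2l//.
  by rewrite -scalerBl normrZ ler_piMr// norm_delta_mx.
have out x : r%:R < enorm x -> rho x = 0.
  move=> xr; rewrite rx r0// (lt_le_trans xr)//.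
  have := le_coord_norm (enorm x *: e0) ord0.
  by rewrite !mxE !eqxx mulr1 ger0_norm ?enorm_ge0.
have etaL (p : rV -> R) : (forall x, `|p x| <= Cq) ->
    (forall x y, `|p x - p y| <= Lq * `|enorm x - enorm y|) ->
    forall x y, `|rho x * p x - rho y * p y| <= (Cr * Lq + Cq * Lr) * `|enorm x - enorm y|.
  move=> pC pL x y.
  have -> : rho x * p x - rho y * p y = rho x * (p x - p y) + p y * (rho x - rho y) by ring.
  rewrite (le_trans (ler_normD _ _))// !normrM mulrDl -!mulrA lerD// ler_pM//.
pose qR x := Re (q x); pose qI x := Im (q x).
have qRC x : `|qR x| <= Cq by rewrite (le_trans (normr_Re_le _)).
have qIC x : `|qI x| <= Cq by rewrite (le_trans (normr_Im_le _)).
have qRL x y : `|qR x - qR y| <= Lq * `|enorm x - enorm y|.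
  by rewrite /qR -Re_opp -Re_add (le_trans (normr_Re_le _)).
have qIL x y : `|qI x - qI y| <= Lq * `|enorm x - enorm y|.
  by rewrite /qI -Im_opp -Im_add (le_trans (normr_Im_le _)).
pose hR := zero_at0 (fun x => Re (m x)); pose hI := zero_at0 (fun x => Im (m x)).
have [sR sI] := sm.
have cR x : x != 0 -> {for x, continuous (fun x => Re (m x))}.
  by move=> x0; have [] := sR [::] x x0.
have cI x : x != 0 -> {for x, continuous (fun x => Im (m x))}.
  by move=> x0; have [] := sI [::] x x0.
have oR (t : R) x : 0 < t -> x != 0 -> Re (m (t *: x)) = Re (m x) by move=> t0 x0; rewrite hom.
have oI (t : R) x : 0 < t -> x != 0 -> Im (m (t *: x)) = Im (m x) by move=> t0 x0; rewrite hom.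
have [zR zI] : \int[surface_measure]_(x in esphere) Re (m x) = 0 /\
               \int[surface_measure]_(x in esphere) Im (m x) = 0 by case: m0.
have canc (u p : rV -> R) : (forall x, x != 0 -> {for x, continuous u}) ->
    (forall (t : R) x, 0 < t -> x != 0 -> u (t *: x) = u x) ->
    \int[surface_measure]_(x in esphere) u x = 0 ->
    measurable_fun setT p -> (forall x, `|p x| <= Cq) ->
    (forall x y, `|p x - p y| <= Lq * `|enorm x - enorm y|) ->
    I (fun x => zero_at0 u x * (rho x * p x)) /\
    \int[lam]_x (zero_at0 u x * (rho x * p x)) = 0.
  move=> cu hu u0 mp pC pL.
  have mrp : measurable_fun setT (fun x => rho x * p x) by exact: measurable_funM.
  split; last first.
    apply: (homogeneous_cancellation cu hu u0 mrp (etaL p pC pL) (B := r%:R)).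
    by move=> x /out ->; rewrite mul0r.
  have [C uC] := zero_at0_bounded cu hu.
  apply: (integrable_cst_box (k := r) (c := C * (Cr * Cq))).
  - by apply: measurable_funM => //; exact: measurable_zero_at0.
  - by move=> x; rewrite !normrM ler_pM// ler_pM.
  - by move=> x; apply: contraNle => /r0 ->; rewrite mul0r mulr0.
have [i1 z1] := canc _ _ cR oR zR mq.1 qRC qRL.
have [i2 z2] := canc _ _ cI oI zI mq.2 qIC qIL.
have [i3 z3] := canc _ _ cR oR zR mq.2 qIC qIL.
have [i4 z4] := canc _ _ cI oI zI mq.1 qRC qRL.
have rho0 : rho 0 = 0 := test_function_at0 trho.
have hx (u : rV -> R) x c : rho x * u x * c = zero_at0 u x * (rho x * c).
  by rewrite /zero_at0; case: eqVneq => [->|_]; [rewrite rho0 !mul0r|ring].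
have hmR x : Re ((rho x)%:C%C * m x) = rho x * Re (m x) by rewrite Re_mul/= mul0r subr0.
have hmI x : Im ((rho x)%:C%C * m x) = rho x * Im (m x) by rewrite Im_mul/= mul0r addr0.
apply: complex_eq => /=.
  rewrite -[RHS]subr0 -{1}z1 -z2 -RintegralB//; apply: eq_Rintegral => x _.
  by rewrite Re_mul hmR hmI (hx (fun x => Re (m x))) (hx (fun x => Im (m x))).
rewrite -[RHS]addr0 -{1}z3 -z4 -RintegralD//; apply: eq_Rintegral => x _.
by rewrite Im_mul hmR hmI (hx (fun x => Re (m x))) (hx (fun x => Im (m x))).
Qed.

End cancellation.

(** * The nonlinearity is Lipschitz on bounded sets *)

Section power_inequalities.
Context {R : realType}.
Implicit Types x y r : R.

(** Young's inequality for u and 1, with exponent r. *)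
Lemma bernoulli_powR (u r : R) : 0 <= u -> 1 <= r -> r * u <= u `^ r + (r - 1).
Proof.
move=> u0; rewrite le_eqVlt => /predU1P[<-|r1]; first by rewrite powRr1// mul1r subrr addr0.
have r0 : 0 < r by rewrite (lt_trans _ r1).
have q0 : 0 < r / (r - 1) by rewrite divr_gt0// subr_gt0.
have := conjugate_powR u0 ler01 r0 q0; rewrite powR1 !mulr1 => /(_ _)/wrap[].
  by field; rewrite ?gt_eqF// ?subr_gt0.
move=> h; rewrite mulrC -ler_pdivlMr// (le_trans h)// le_eqVlt; apply/orP; left; apply/eqP.
by field; rewrite ?gt_eqF// ?subr_gt0.
Qed.

Lemma powR_sub_le x y r : 0 <= x -> 0 <= y -> 1 <= r ->
  x `^ r - y `^ r <= r * x `^ (r - 1) * `|x - y|.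
Proof.
move=> x0 y0 r1; have r0 : 0 < r by rewrite (lt_le_trans _ r1).
have [xy|yx] := leP x y.
  rewrite (@le_trans _ _ 0)// ?subr_le0 ?ge0_ler_powR ?nnegrE// ?(ltW r0)//.
  by rewrite !mulr_ge0 ?powR_ge0 ?(ltW r0).
have {}x0 : 0 < x by exact: le_lt_trans yx.
rewrite ger0_norm ?subr_ge0 ?(ltW yx)//.
have u0 : 0 <= y / x by rewrite divr_ge0// ltW.
have yE : y = y / x * x by rewrite divfK// gt_eqF.
have xE : x `^ r = x * x `^ (r - 1) by rewrite mulr_powRB1// ltW.
rewrite {1}yE powRM ?(ltW x0)// -[X in X - _]mul1r -mulrBl xE.
have -> : r * x `^ (r - 1) * (x - y) = r * (1 - y / x) * (x * x `^ (r - 1)).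
  by field; rewrite gt_eqF.
rewrite ler_wpM2r ?mulr_ge0 ?powR_ge0 ?(ltW x0)//.
by have := bernoulli_powR u0 r1; rewrite mulrBr mulr1; lra.
Qed.

(** For exponents at most 1, negative ones included, concavity is replaced by the
    monotonicity of x^(r - 1). *)
Lemma powR_sub_le_small x y r : 0 < x -> 0 <= y -> y <= x -> r <= 1 ->
  x `^ r - y `^ r <= x `^ (r - 1) * (x - y).
Proof.
move=> x0 y0 yx r1.
have E z : 0 < z -> z `^ r = z `^ (r - 1) * z.
  move=> z0; rewrite -[X in _ * X](powRr1 (ltW z0)) -powRD ?subrK//.
  by rewrite (gt_eqF z0) implybT.
rewrite (E x x0) mulrBr lerD2l lerN2.
move: y0; rewrite le_eqVlt => /predU1P[<-|y0]; first by rewrite mulr0 powR_ge0.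
rewrite (E y y0) ler_wpM2r ?(ltW y0)// -[r - 1]opprB !powRN lef_pV2 ?posrE ?powR_gt0//.
by apply: ge0_ler_powR; rewrite ?nnegrE ?subr_ge0 ?(ltW x0) ?(ltW y0).
Qed.

Lemma powR_sub_le_max x y r : 0 < x -> 0 <= y -> y <= x ->
  x `^ r - y `^ r <= Num.max 1 r * x `^ (r - 1) * (x - y).
Proof.
move=> x0 y0 yx; have d0 : 0 <= x - y by rewrite subr_ge0.
have [r1|r1] := leP r 1.
  by rewrite mul1r powR_sub_le_small.
by rewrite (le_trans (powR_sub_le (ltW x0) y0 (ltW r1)))// ger0_norm.
Qed.

(** Valid at x = 0 because the exponent r + 1 is positive. *)
Lemma mulr_powR x r : 0 <= x -> 0 <= r -> x * x `^ r = x `^ (r + 1).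
Proof.
by move=> x0 r0; rewrite -{1}[r](addrK 1) mulr_powRB1// ltr_wpDl.
Qed.

Lemma powR_mulD x r s : 0 <= x -> 0 < r + s -> x `^ r * x `^ s = x `^ (r + s).
Proof. by move=> x0 rs; rewrite powRD// (gt_eqF rs). Qed.

(** A factor x below s^a absorbs the lack of regularity at 0 of the power b, whose
    exponent may be less than 1. *)
Lemma powR_mul_sub_le (s t x a b : R) : 0 <= s -> s <= t -> 0 <= a -> 0 <= b ->
  0 < a + b -> x <= s `^ a -> x * (t `^ b - s `^ b) <= t `^ (a + b) - s `^ (a + b).
Proof.
move=> s0 st a0 b0 ab xs; have t0 : 0 <= t by exact: le_trans st.
have stb : s `^ b <= t `^ b by apply: ge0_ler_powR.
have sta : s `^ a <= t `^ a by apply: ge0_ler_powR.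
rewrite (@le_trans _ _ (s `^ a * (t `^ b - s `^ b)))//; first by rewrite ler_wpM2r// subr_ge0.
by rewrite mulrBr (powR_mulD s0 ab) lerD2r -(powR_mulD t0 ab) ler_wpM2r ?powR_ge0.
Qed.

Lemma mulC_diff_split (z w : R[i]) (a b c d : R) :
  z * (a * c)%:C%C - w * (b * d)%:C%C =
  (z * a%:C%C - w * b%:C%C) * c%:C%C + w * b%:C%C * (c - d)%:C%C.
Proof. by case: z w => [z1 z2] [w1 w2]; apply: complex_eq => /=; ring. Qed.

(** Split off the variation of the modulus; the smaller of the two vectors multiplies it,
    which leaves a difference of powers with exponent p + 1 >= 1. *)
Lemma normc_powR_sub (v w : R[i]) (p B : R) : 0 <= p -> normc v <= B -> normc w <= B ->
  normc (v * (normc v `^ p)%:C%C - w * (normc w `^ p)%:C%C) <= (p + 2) * B `^ p * normc (v - w).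
Proof.
move=> p0; wlog vw : v w / normc w <= normc v.
  move=> H vB wB; have [h|/ltW h] := leP (normc w) (normc v); first exact: H.
  by rewrite [leLHS]normcB [normc (v - w)]normcB; exact: H.
move=> vB wB; have v0 := normc_ge0 v; have w0 := normc_ge0 w.
have B0 : 0 <= B by exact: le_trans vB.
have -> : v * (normc v `^ p)%:C%C - w * (normc w `^ p)%:C%C =
  (v - w) * (normc v `^ p)%:C%C + w * (normc v `^ p - normc w `^ p)%:C%C.
  by rewrite rmorphB/=; ring.
have vwp : normc w `^ p <= normc v `^ p by apply: ge0_ler_powR.
rewrite (le_trans (le_normcD _ _))// !normcM !normcR !ger0_norm ?powR_ge0 ?subr_ge0//.
have vpB : normc v `^ p <= B `^ p by apply: ge0_ler_powR; rewrite ?nnegrE.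
have e1 : normc w * (normc v `^ p - normc w `^ p) <= (p + 1) * normc v `^ p * `|normc v - normc w|.
  rewrite mulrBr (mulr_powR w0 p0).
  rewrite (@le_trans _ _ (normc v `^ (p + 1) - normc w `^ (p + 1)))//.
    by rewrite lerD2r -(mulr_powR v0 p0) ler_wpM2r ?powR_ge0.
  by rewrite (le_trans (powR_sub_le v0 w0 _))// ?lerDr// addrK.
have e2 : `|normc v - normc w| <= normc (v - w).
  have h1 : normc v <= normc (v - w) + normc w by rewrite -{1}(subrK w v) le_normcD.
  by rewrite ger0_norm ?subr_ge0// lerBlDr.
have -> : (p + 2) * B `^ p * normc (v - w) = normc (v - w) * B `^ p + (p + 1) * B `^ p * normc (v - w) by ring.
rewrite lerD//; first by rewrite ler_wpM2l ?normc_ge0.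
rewrite (le_trans e1)// ler_pM ?mulr_ge0 ?powR_ge0 ?addr_ge0//.
by rewrite ler_wpM2l ?addr_ge0.
Qed.

End power_inequalities.

Section nonlinearity.
Context {R : realType} (M K : R) (j : int).
Hypotheses (hM : 2 <= M) (hK : 1 <= K).
Let P : set int := [set i | (i <= j)%R].
Implicit Types v w : int -> R[i].

(** The sum is finite when v is summable over i <= j, by [lM_esum_le]. *)
Definition lM_sum v : R := fine (\esum_(i in [set i | (i <= j)%R]) (normc (v i) `^ M)%:E).

Definition nonlinearity v : R[i] :=
  v j * (normc (v j) `^ (M - 2) * lM_sum v `^ (K - 1))%:C%C.

Let Pj : P j. Proof. exact: lexx. Qed.

Let M0 : 0 < M. Proof. by rewrite (lt_le_trans _ hM). Qed.

Lemma esum_term_le (a : int -> \bar R) (b : \bar R) i : P i -> (forall k, (0 <= a k)%E) ->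
  (\esum_(k in P) a k <= b)%E -> (a i <= b)%E.
Proof.
move=> Pi a0; apply: le_trans; apply: esum_ge; exists [set i].
  by split; [exact: finite_set1|move=> _ ->].
by rewrite fsbig_set1.
Qed.

Lemma esumZ_le (T : choiceType) (Q : set T) (c : R) (a : T -> \bar R) : 0 <= c ->
  (forall k, (0 <= a k)%E) -> (\esum_(k in Q) (c%:E * a k) <= c%:E * \esum_(k in Q) a k)%E.
Proof.
move=> c0 a0; apply: ge_ereal_sup => _ /= [X XQ <-].
rewrite -ge0_mule_fsumr// lee_wpmul2l ?lee_fin//.
by apply: ereal_sup_ubound; exists X.
Qed.

Section bounds.
Variables (v : int -> R[i]) (B : R).
Hypotheses (B0 : 0 <= B) (vB : (\esum_(i in P) (normc (v i))%:E <= B%:E)%E).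

Lemma l1_term_le i : P i -> normc (v i) <= B.
Proof.
move=> Pi; rewrite -lee_fin; apply: (esum_term_le Pi _ vB) => k.
by rewrite lee_fin normc_ge0.
Qed.

(** The l^M norm is below the l^1 norm. *)
Lemma lM_esum_le : (\esum_(i in P) (normc (v i) `^ M)%:E <= (B `^ M)%:E)%E.
Proof.
have M1 : 0 <= M - 1 by rewrite subr_ge0 (le_trans _ hM)// ler1n.
rewrite -(mulr_powRB1 B0 M0) mulrC EFinM.
apply: (@le_trans _ _ (\esum_(i in P) ((B `^ (M - 1))%:E * (normc (v i))%:E))%E).
  apply: le_esum => i Pi; rewrite -EFinM lee_fin -(mulr_powRB1 (normc_ge0 _) M0) mulrC.
  rewrite ler_wpM2r ?normc_ge0//; apply: ge0_ler_powR => //; rewrite ?nnegrE ?normc_ge0//.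
  exact: l1_term_le.
rewrite (le_trans (esumZ_le _ (powR_ge0 _ _) _))//; first by move=> k; rewrite lee_fin normc_ge0.
by rewrite lee_wpmul2l// lee_fin powR_ge0.
Qed.

Lemma lM_sumE : (\esum_(i in P) (normc (v i) `^ M)%:E = (lM_sum v)%:E)%E.
Proof.
rewrite fineK// ge0_fin_numE; first by rewrite (le_lt_trans lM_esum_le)// ltry.
by apply: esum_ge0 => i _; rewrite lee_fin powR_ge0.
Qed.

Lemma lM_sum_ge0 : 0 <= lM_sum v.
Proof. by apply: fine_ge0; apply: esum_ge0 => i _; rewrite lee_fin powR_ge0. Qed.

Lemma lM_sum_le : lM_sum v <= B `^ M.
Proof. by rewrite -lee_fin -lM_sumE lM_esum_le. Qed.

Lemma lM_term_le i : P i -> normc (v i) `^ M <= lM_sum v.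
Proof.
move=> Pi; rewrite -lee_fin -lM_sumE; apply: (esum_term_le (a := fun i => (normc (v i) `^ M)%:E) Pi) => // k.
by rewrite lee_fin powR_ge0.
Qed.

Lemma lM_term_root_le i : P i -> normc (v i) <= lM_sum v `^ M^-1.
Proof.
move=> Pi; have := lM_term_le Pi => h.
have -> : normc (v i) = (normc (v i) `^ M) `^ M^-1.
  by rewrite -powRrM divff ?gt_eqF// powRr1// normc_ge0.
by apply: ge0_ler_powR; rewrite ?nnegrE ?invr_ge0 ?(ltW M0) ?powR_ge0 ?lM_sum_ge0.
Qed.

End bounds.

(** Each term is a difference of M-th powers, and |v_i|^(M - 1) is bounded by the
    corresponding power of the whole sum. *)
Lemma lM_sum_sub v w B D : 0 <= B -> 0 <= D ->
  (\esum_(i in P) (normc (v i))%:E <= B%:E)%E ->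
  (\esum_(i in P) (normc (w i))%:E <= B%:E)%E ->
  (\esum_(i in P) (normc (v i - w i))%:E <= D%:E)%E ->
  lM_sum v - lM_sum w <= M * lM_sum v `^ ((M - 1) / M) * D.
Proof.
move=> B0 D0 vB wB vwD; have M1 : 1 <= M by rewrite (le_trans _ hM)// ler1n.
set c := M * lM_sum v `^ ((M - 1) / M).
have c0 : 0 <= c by rewrite mulr_ge0 ?powR_ge0// ltW.
rewrite lerBlDl -lee_fin EFinD -(lM_sumE B0 vB) -(lM_sumE B0 wB).
apply: (@le_trans _ _ (\esum_(i in P) ((normc (w i) `^ M)%:E + c%:E * (normc (v i - w i))%:E))%E).
  apply: le_esum => i Pi; rewrite -EFinM -EFinD lee_fin -lerBlDl.
  rewrite (le_trans (powR_sub_le (normc_ge0 _) (normc_ge0 _) M1))//.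
  apply: ler_pM => //; first by rewrite mulr_ge0 ?powR_ge0// ltW.
    rewrite ler_wpM2l ?(ltW M0)// mulrC powRrM; apply: ge0_ler_powR.
    - by rewrite subr_ge0.
    - by rewrite nnegrE normc_ge0.
    - by rewrite nnegrE powR_ge0.
    - exact: (lM_term_root_le B0 vB).
  have h1 : normc (v i) <= normc (v i - w i) + normc (w i) by rewrite -{1}(subrK (w i) (v i)) le_normcD.
  have h2 : normc (w i) <= normc (w i - v i) + normc (v i) by rewrite -{1}(subrK (v i) (w i)) le_normcD.
  by rewrite [normc (w i - v i)]normcB in h2; rewrite ler_norml; apply/andP; split; lra.
rewrite esumD; last 2 first.
- by move=> i _; rewrite lee_fin powR_ge0.
- by move=> i _; rewrite -EFinM lee_fin mulr_ge0// normc_ge0.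
rewrite leeD2l// (le_trans (esumZ_le _ c0 _))//; first by move=> i; rewrite lee_fin normc_ge0.
by rewrite (EFinM c D) lee_wpmul2l.
Qed.

(** The delicate term is w_j |w_j|^(M - 2) (t^(K - 1) - s^(K - 1)), with t and s the
    l^M sums of v and w: for 1 < K < 2 the power K - 1 is not Lipschitz at 0. But w_j is one of
    the terms of the sum, so that |w_j|^(M - 1) <= s^((M - 1) / M), and the product is at most
    t^theta - s^theta with theta = K - 1 / M. The factor t^(theta - 1) of the derivative is
    compensated by the factor t^((M - 1) / M) of [lM_sum_sub], since
    theta - 1 + (M - 1) / M = K - 2 / M is nonnegative. *)
Lemma nonlinearity_lipschitz v w B D : 0 <= B -> 0 <= D ->
  (\esum_(i in P) (normc (v i))%:E <= B%:E)%E ->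
  (\esum_(i in P) (normc (w i))%:E <= B%:E)%E ->
  (\esum_(i in P) (normc (v i - w i))%:E <= D%:E)%E ->
  normc (nonlinearity v - nonlinearity w) <=
    (M + Num.max 1 (K - M^-1) * M) * B `^ (M * K - 2) * D.
Proof.
move=> B0 D0; wlog ts : v w / lM_sum w <= lM_sum v.
  move=> H vB wB vwD; have [h|/ltW h] := leP (lM_sum w) (lM_sum v); first exact: H.
  rewrite normcB; apply: H => //.
  by under eq_esum do rewrite normcB.
move=> vB wB vwD.
set t := lM_sum v; set s := lM_sum w; rewrite -/t -/s in ts.
have s0 : 0 <= s by exact: lM_sum_ge0.
have M1 : 0 <= M - 1 by rewrite subr_ge0 (le_trans _ hM)// ler1n.
(* the powers of t are differentiated below, so that t = 0 is set apart *)
have [tz|tz] := eqVneq t 0.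
  have z u : (\esum_(i in P) (normc (u i))%:E <= B%:E)%E -> lM_sum u = 0 -> nonlinearity u = 0.
    move=> uB u0; have := lM_term_root_le B0 uB Pj; rewrite u0 powR0 ?invr_eq0 ?gt_eqF// => h.
    have -> : nonlinearity u = 0 * (normc (u j) `^ (M - 2) * lM_sum u `^ (K - 1))%:C%C.
      by rewrite /nonlinearity; congr (_ * _); apply: eq0_normc; apply/eqP; rewrite eq_le h normc_ge0.
    by rewrite mul0r.
  rewrite (z v)// (z w)//; last by apply/eqP; rewrite eq_le s0 -tz ts.
  rewrite subrr normc0 !mulr_ge0 ?powR_ge0// addr_ge0 ?mulr_ge0 ?(ltW M0)//.
  by rewrite le_max ler01.
have t0 : 0 < t by rewrite lt_neqAle eq_sym tz (le_trans s0).
have tB : t <= B `^ M by exact: (lM_sum_le B0 vB).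
have Bp : 0 < B.
  rewrite lt_neqAle B0 andbT eq_sym; apply: contraTneq tB => ->.
  by rewrite powR0 ?gt_eqF// -ltNge.
have vj : normc (v j) <= B by exact: (l1_term_le vB Pj).
have wj : normc (w j) <= B by exact: (l1_term_le wB Pj).
have vwj : normc (v j - w j) <= D.
  rewrite -lee_fin; apply: (esum_term_le (a := fun i => (normc (v i - w i))%:E) Pj _ vwD).
  by move=> k; rewrite lee_fin normc_ge0.
have K1 : 0 <= K - 1 by rewrite subr_ge0.
have tsK : s `^ (K - 1) <= t `^ (K - 1).
  by apply: ge0_ler_powR; rewrite ?nnegrE ?(ltW t0).
have BE e : 0 <= e -> t `^ e <= B `^ (M * e).
  by move=> e0; rewrite powRrM; apply: ge0_ler_powR; rewrite ?nnegrE ?powR_ge0 ?(ltW t0).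
have -> : nonlinearity v - nonlinearity w =
  (v j * (normc (v j) `^ (M - 2))%:C%C - w j * (normc (w j) `^ (M - 2))%:C%C) * (t `^ (K - 1))%:C%C
  + w j * (normc (w j) `^ (M - 2))%:C%C * (t `^ (K - 1) - s `^ (K - 1))%:C%C.
  exact: mulC_diff_split.
rewrite (le_trans (le_normcD _ _))// -[leRHS]mulrA [leRHS]mulrDl lerD//.
  rewrite normcM normcR ger0_norm ?powR_ge0//.
  have -> : M * (B `^ (M * K - 2) * D) = M * B `^ (M - 2) * D * B `^ (M * (K - 1)).
    have -> : M * K - 2 = (M - 2) + M * (K - 1) by ring.
    by rewrite powRD ?(gt_eqF Bp) ?implybT//; ring.
  apply: ler_pM; rewrite ?normc_ge0 ?powR_ge0//; last exact: BE.
  rewrite (le_trans (normc_powR_sub _ vj wj))// ?subr_ge0// subrK.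
  by rewrite ler_wpM2l// mulr_ge0 ?powR_ge0// ltW.
rewrite !normcM !normcR ger0_norm ?powR_ge0// ger0_norm ?subr_ge0//.
have -> : normc (w j) * normc (w j) `^ (M - 2) = normc (w j) `^ (M - 1).
  by rewrite mulr_powR ?normc_ge0 ?subr_ge0//; congr (_ `^ _); ring.
pose a := (M - 1) / M; pose theta := a + (K - 1).
have a0 : 0 <= a by rewrite divr_ge0// ltW.
have Mi : M^-1 <= 2^-1 by rewrite lef_pV2 ?posrE.
have aE : a = 1 - M^-1 by rewrite /a; field; rewrite gt_eqF.
have theta0 : 0 < theta by rewrite ltr_pwDl// divr_gt0// subr_gt0 (lt_le_trans _ hM)// ltr1n.
have thetaE : theta = K - M^-1 by rewrite /theta aE; ring.
have wa : normc (w j) `^ (M - 1) <= s `^ a.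
  have aM : a = M^-1 * (M - 1) by rewrite /a mulrC.
  rewrite aM powRrM; apply: ge0_ler_powR.
  - exact: M1.
  - by rewrite nnegrE normc_ge0.
  - by rewrite nnegrE powR_ge0.
  - exact: (lM_term_root_le B0 wB Pj).
have e1 : normc (w j) `^ (M - 1) * (t `^ (K - 1) - s `^ (K - 1)) <= t `^ theta - s `^ theta.
  exact: powR_mul_sub_le.
rewrite (le_trans e1)// (le_trans (powR_sub_le_max theta t0 s0 ts))// -thetaE.
rewrite -!mulrA ler_wpM2l ?le_max ?ler01//.
have ltsub := lM_sum_sub B0 D0 vB wB vwD; rewrite -/t -/s -/a in ltsub.
rewrite (le_trans (ler_wpM2l _ ltsub)) ?powR_ge0//.
have -> : t `^ (theta - 1) * (M * t `^ a * D) = M * (t `^ (theta - 1 + a) * D).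
  by rewrite [t `^ (theta - 1 + a)]powRD ?(gt_eqF t0) ?implybT//; ring.
rewrite ler_wpM2l ?(ltW M0)// ler_wpM2r//.
have -> : M * K - 2 = M * (theta - 1 + a).
  by rewrite thetaE aE; field; rewrite gt_eqF.
have -> : theta - 1 + a = K - 1 + (2^-1 - M^-1) + (2^-1 - M^-1).
  by rewrite thetaE aE; field; rewrite gt_eqF.
have Md : 0 <= 2^-1 - M^-1 by rewrite subr_ge0.
exact: BE (addr_ge0 (addr_ge0 K1 Md) Md).
Qed.

End nonlinearity.

(** * Sums over dyadic scales *)

Section geometric_sums.
Context {R : realType}.

Lemma esum_nat_geometric (q : R) : 0 <= q -> q < 1 ->
  (\esum_(k in [set: nat]) (q ^+ k)%:E <= ((1 - q)^-1)%:E)%E.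
Proof.
move=> q0 q1; have d0 : 0 < 1 - q by rewrite subr_gt0.
have E N : \sum_(0 <= k < N) q ^+ k = (1 - q ^+ N) / (1 - q).
  elim: N => [|N IH]; first by rewrite big_geq// expr0 subrr mul0r.
  by rewrite big_nat_recr//= IH exprS; field; rewrite gt_eqF.
rewrite -nneseries_esumT => [|k]; last by rewrite lee_fin exprn_ge0.
apply: lime_le; first by apply: is_cvg_nneseries => k _ _; rewrite lee_fin exprn_ge0.
apply: nearW => N; rewrite sumEFin lee_fin E.
by rewrite ler_pdivrMr// mulVf ?gt_eqF// gerBl exprn_ge0.
Qed.

Lemma powR2_lt1 (g : R) : 0 < g -> (2 : R) `^ (- g) < 1.
Proof.
move=> g0; rewrite powRN invf_lt1 ?powR_gt0//.
by rewrite -[X in X < _](congr1 (fun f => f g) (powR1 R)) gt0_ltr_powR ?nnegrE// ltr1n.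
Qed.

Lemma esum_geometric_below (g : R) : 0 < g -> exists C : R, 0 <= C /\
  forall j : int, (\esum_(i in [set i : int | (i <= j)%R]) (2 `^ ((i - j)%:~R * g))%:E <= C%:E)%E.
Proof.
move=> g0; pose q : R := 2 `^ (- g).
have q1 : q < 1 by exact: powR2_lt1.
exists ((1 - q)^-1); split; first by rewrite invr_ge0 subr_ge0 ltW.
move=> j; rewrite (reindex_esum [set: nat] _ (fun k : nat => j - k%:Z)).
  apply: le_trans (esum_nat_geometric (powR_ge0 _ _) q1).
  apply: le_esum => k _; rewrite lee_fin -powR_mulrn ?powR_ge0// -powRrM.
  by rewrite (_ : j - k%:Z - j = - k%:Z) ?mulrNz ?mulNr ?[g * _]mulrC//; ring.
split => [k _ /=|k l _ _|i /= ij]; first by rewrite gerBl.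
  by move/addrI/oppr_inj => -[].
exists `|j - i|%N => //; rewrite gez0_abs ?subr_ge0//.
by rewrite opprB addrC subrK.
Qed.

(** min (t, 1 / t)^eps for t > 0. *)
Definition two_sided (eps t : R) : R := if t < 1 then t `^ eps else t `^ (- eps).

Lemma two_sided_ge0 eps t : 0 <= two_sided eps t.
Proof. by rewrite /two_sided; case: ifP => _; rewrite powR_ge0. Qed.

(** Both t^eps and t^(- eps) bound the weight, so a bound on either t or 1 / t is enough. *)
Lemma two_sided_le eps t s : 0 < eps -> 0 < t ->
  (t <= 2 `^ s -> two_sided eps t <= 2 `^ (s * eps)) /\
  (2 `^ (- s) <= t -> two_sided eps t <= 2 `^ (s * eps)).
Proof.
move=> e0 t0; split => ts; rewrite /two_sided powRrM; case: ltP => t1.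
- by apply: ge0_ler_powR; rewrite ?nnegrE ?powR_ge0 ?(ltW e0) ?(ltW t0).
- rewrite powRN -powRrM mulrC powRrM.
  rewrite (@le_trans _ _ 1)//.
    by rewrite invf_le1 ?powR_gt0// -[X in X <= _](congr1 (fun f => f eps) (powR1 R)) ge0_ler_powR ?nnegrE ?(ltW e0) ?(ltW t0)//.
  rewrite -powRrM mulrC powRrM -[X in X <= _](congr1 (fun f => f eps) (powR1 R)).
  by apply: ge0_ler_powR; rewrite ?nnegrE ?powR_ge0 ?(ltW e0)// (le_trans t1).
- rewrite (@le_trans _ _ 1)//.
    rewrite -[X in _ <= X](congr1 (fun f => f eps) (powR1 R)).
    by apply: ge0_ler_powR; rewrite ?nnegrE ?(ltW e0) ?(ltW t0) ?(ltW t1).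
  rewrite -[X in X <= _](congr1 (fun f => f eps) (powR1 R)).
  apply: ge0_ler_powR; rewrite ?nnegrE ?powR_ge0 ?(ltW e0)//.
  have : 2 `^ (- s) <= 1 by rewrite (le_trans ts)// ltW.
  by rewrite powRN invf_le1 ?powR_gt0.
- have -> : (2 `^ s) `^ eps = ((2 `^ (- s)) `^ eps)^-1 by rewrite -!powRrM -powRN mulNr opprK.
  rewrite powRN lef_pV2 ?posrE ?powR_gt0//.
  by apply: ge0_ler_powR; rewrite ?nnegrE ?powR_ge0 ?(ltW e0) ?(ltW t0).
Qed.

(** Up to the shift by log2 t, the terms decay geometrically on both sides of
    j = - log2 t. *)
Lemma esum_two_sided (eps : R) : 0 < eps -> exists C : R, 0 <= C /\
  forall t : R, 0 <= t ->
   (\esum_(j in [set: int]) (two_sided eps (2 `^ j%:~R * t))%:E <= C%:E)%E.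
Proof.
move=> e0; have [C [C0 hC]] := esum_geometric_below e0.
exists (C + C); split; first exact: addr_ge0.
move=> t; rewrite le_eqVlt => /predU1P[<-|t0].
  rewrite esum1 ?lee_fin ?addr_ge0// => j _.
  by rewrite mulr0 /two_sided ltr01 powR0// gt_eqF.
pose tau := ln t / ln 2.
have l2 : ln (2 : R) != 0 by rewrite gt_eqF// ln_gt0// ltr1n.
have tE : t = 2 `^ tau by rewrite /powR pnatr_eq0/= /tau divfK// lnK.
have jt (j : int) : 2 `^ j%:~R * t = 2 `^ (j%:~R + tau).
  by rewrite {1}tE -powRD// pnatr_eq0 implybT.
(* the scale at which 2^j t crosses 1 *)
pose f := Num.floor (- tau).
have /andP[f1 f2] := real_floor_itv (num_real (- tau)); rewrite -/f in f1 f2.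
rewrite (esumID [set j | (j <= f)%R])//; last by move=> j _; rewrite lee_fin two_sided_ge0.
rewrite !setTI EFinD; apply: leeD.
  apply: le_trans (hC f); apply: le_esum => j /= jf; rewrite lee_fin.
  apply: (two_sided_le (j - f)%:~R e0 _).1; first by rewrite mulr_gt0 ?powR_gt0.
  rewrite jt; apply: ler_powR; first by rewrite ler1n.
  by rewrite rmorphB/= lerD2l; lra.
rewrite (reindex_esum [set i : int | (i <= - (f + 1))%R] _ (fun j : int => - j)); last first.
  split => [i /=|i k _ _ /oppr_inj//|j /= jf].
    by move=> h; apply/negP; rewrite -ltNge; lia.
  exists (- j); last by rewrite opprK.
  by rewrite /= lerN2; move/negP: jf; rewrite -ltNge; lia.
apply: le_trans (hC (- (f + 1))); apply: le_esum => j /= jf; rewrite lee_fin.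
apply: (two_sided_le (j - (- (f + 1)))%:~R e0 _).2; first by rewrite mulr_gt0 ?powR_gt0.
rewrite jt; apply: ler_powR; first by rewrite ler1n.
by move: f2; rewrite !(rmorphB, rmorphD, rmorphN)/=; lra.
Qed.

End geometric_sums.

(** * Comparison with a radial model at one scale *)

Section parameter_measurability.
Context {R : realType} d (T : measurableType d) (M K : R) (j : int).

Lemma measurable_esum_below (a : int -> T -> R) :
  (forall i t, 0 <= a i t) -> (forall i, measurable_fun setT (a i)) ->
  measurable_fun setT (fun t => (\esum_(i in [set i : int | (i <= j)%R]) (a i t)%:E)%E).
Proof.
move=> a0 ma.
have bij : set_bij [set: nat] [set i : int | (i <= j)%R] (fun k : nat => j - k%:Z).
  split => [k _ /=|k l _ _|i /= ij]; first by rewrite gerBl.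
    by move/addrI/oppr_inj => -[].
  by exists `|j - i|%N => //; rewrite gez0_abs ?subr_ge0// opprB addrC subrK.
rewrite (_ : (fun _ => _) = (fun t => \sum_(0 <= k <oo) (a (j - k%:Z) t)%:E)%E).
  apply: ge0_emeasurable_sum => k.
    by move=> t _ _; rewrite lee_fin.
  by move=> _; exact/measurable_EFinP.
apply/funext => t; rewrite (reindex_esum _ _ _ _ bij) nneseries_esumT//.
by move=> k; rewrite lee_fin.
Qed.

Lemma cmeasurable_nonlinearity (v : T -> int -> R[i]) :
  (forall i, cmeasurable (fun t => v t i)) ->
  cmeasurable (fun t => nonlinearity M K j (v t)).
Proof.
move=> mv; apply: cmeasurableM => //; apply: cmeasurableR.
have mn i := cmeasurable_normc (mv i).
have mp r (h : T -> R) : measurable_fun setT h -> measurable_fun setT (fun t => h t `^ r).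
  by move=> mh; apply: (measurableT_comp (f := @powR R ^~ r)) => //; exact: measurable_powR.
apply: measurable_funM; first exact: mp.
apply: (mp); apply: measurableT_comp => //.
by apply: measurable_esum_below => [i t|i]; [exact: powR_ge0|exact: mp].
Qed.

End parameter_measurability.

Section kernel_difference.
Context {R : realType} {n : nat}.
Local Notation rV := 'rV[R]_n.
Variables (psi : rV -> R[i]) (Cp Lp eps : R).
Hypotheses (Lp0 : 0 <= Lp) (psiC : forall x, (1 + `|x|) * normc (psi x) <= Cp)
  (psiL : forall x y, normc (psi x - psi y) <= Lp * `|x - y|)
  (eps0 : 0 < eps) (eps1 : eps <= 1).

Lemma exprz2_gt0 (i : int) : 0 < (2 : R) ^ i.
Proof. by rewrite exprz_gt0. Qed.

Lemma powR2_int (i : int) : (2 : R) `^ i%:~R = 2 ^ i.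
Proof. by rewrite powR_intmul. Qed.

Lemma exprz2_le1 (i j : int) : i <= j -> (2 : R) ^ (i - j) <= 1.
Proof.
move=> ij; rewrite -powR2_int -[leRHS](powRr0 (2 : R)); apply: ler_powR; first by rewrite ler1n.
by rewrite (_ : 0 = 0%:~R)// ler_int subr_le0.
Qed.

Lemma exprz2_shift (i j : int) : (2 : R) ^ i = 2 ^ (i - j) * 2 ^ j.
Proof. by rewrite -expfzDr ?pnatr_eq0// subrK. Qed.

(** With t = 2^j |y - z| and q = 2^(i - j) <= 1, the argument of psi is q u displaced by
    a vector of norm q t. For t < 1 the Lipschitz bound q t <= t^eps is enough. For
    t >= 1 the decay of psi at x0 = 2^i (z - y) + q u gives 1 / (1 + |x0|), and
    q t <= |x0| + |u| turns it into (1 + |u|) / (q t)^eps. *)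
Lemma kernel_difference (i j : int) (z y u : rV) : i <= j ->
  normc (psi (2 ^ i *: (z - y) + 2 ^ (i - j) *: u) -
         (if 2 ^ j * `|y - z| < 1 then psi (2 ^ (i - j) *: u) else 0)) <=
  (Cp + Lp) * (2 `^ ((j - i)%:~R * eps) * ((1 + `|u|) * two_sided eps (2 ^ j * `|y - z|))).
Proof.
move=> ij; set tau := 2 ^ j * `|y - z|; set q : R := 2 ^ (i - j).
have q0 : 0 < q by exact: exprz2_gt0.
have q1 : q <= 1 by exact: exprz2_le1.
have tau0 : 0 <= tau by rewrite mulr_ge0// ltW// exprz2_gt0.
have Cp0 : 0 <= Cp by rewrite (le_trans _ (psiC 0))// mulr_ge0 ?normc_ge0// addr_ge0.
have E1 : 1 <= (2 : R) `^ ((j - i)%:~R * eps).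
  rewrite -[leLHS](powRr0 (2 : R)); apply: ler_powR; first by rewrite ler1n.
  by rewrite mulr_ge0 ?(ltW eps0)// (_ : 0 = 0%:~R)// ler_int subr_ge0.
have U1 : 1 <= 1 + `|u| by rewrite lerDl.
have sE : `|2 ^ i *: (z - y)| = q * tau.
  rewrite normrZ ger0_norm ?(ltW (exprz2_gt0 _))// (exprz2_shift i j) -/q -mulrA.
  by rewrite distrC.
rewrite /two_sided; case: ltP => t1.
  rewrite (le_trans (psiL _ _))// addrK sE.
  have h1 : q * tau <= tau `^ eps.
    move: tau0; rewrite le_eqVlt => /predU1P[<-|tau0]; first by rewrite mulr0 powR_ge0.
    rewrite (@le_trans _ _ tau) ?ler_piMl ?(ltW tau0)//.
    by apply: ger1_powR => //; rewrite tau0 ltW.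
  apply: ler_pM => //; first by rewrite mulr_ge0 ?(ltW q0).
    by rewrite lerDr.
  rewrite (le_trans h1)// mulrA ler_peMl ?powR_ge0//.
  exact: mulr_ege1.
rewrite subr0; set x0 := _ + _.
have tp : 0 < tau by exact: lt_le_trans t1.
have D0 : 0 < 1 + `|x0| by rewrite ltr_pwDl.
have pB : normc (psi x0) <= Cp / (1 + `|x0|) by rewrite ler_pdivlMr// mulrC.
rewrite (le_trans pB)//; apply: ler_pM; [by []|by rewrite invr_ge0 ltW|by rewrite lerDl|].
have F0 : 0 < (q * tau) `^ eps by rewrite powR_gt0// mulr_gt0.
have -> : 2 `^ ((j - i)%:~R * eps) * ((1 + `|u|) * tau `^ (- eps)) =
   (1 + `|u|) / (q * tau) `^ eps.
  rewrite powRM ?(ltW q0)// invfM powRN /q -powR2_int -!powRrM.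
  rewrite (_ : (j - i)%:~R * eps = - ((i - j)%:~R * eps)); last by rewrite !rmorphB/=; ring.
  by rewrite powRN; ring.
rewrite ler_pdivlMr// mulrC ler_pdivrMr//.
rewrite (@le_trans _ _ (1 + q * tau))//.
  have w1 : 1 <= 1 + q * tau by rewrite lerDl mulr_ge0 ?(ltW q0).
  rewrite (@le_trans _ _ ((1 + q * tau) `^ eps))//; last exact: ler1_powR.
  apply: ge0_ler_powR.
  - exact: ltW.
  - by rewrite nnegrE mulr_ge0 ?(ltW q0).
  - by rewrite nnegrE (le_trans ler01 w1).
  - by rewrite lerDr.
have h2 : q * tau <= `|x0| + `|u|.
  rewrite -sE -[2 ^ i *: (z - y)](addrK (q *: u)) -/x0 (le_trans (ler_normB _ _))// lerD2l.
  by rewrite normrZ ger0_norm ?(ltW q0)// ler_piMl.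
rewrite (@le_trans _ _ (1 + (`|x0| + `|u|)))//; first by rewrite lerD2l.
by have := mulr_ge0 (normr_ge0 x0) (normr_ge0 u); lra.
Qed.

End kernel_difference.

Section two_sided_facts.
Context {R : realType} (eps : R).
Hypothesis eps0 : 0 < eps.

Lemma two_sided_le1 t : 0 <= t -> two_sided eps t <= 1.
Proof.
move=> t0; rewrite /two_sided; case: ltP => t1.
  have := @ge0_ler_powR R eps (ltW eps0) t 1; rewrite powR1; apply; rewrite ?nnegrE//.
  exact: ltW.
rewrite powRN invf_le1 ?powR_gt0 ?(lt_le_trans _ t1)//.
by have := @ge0_ler_powR R eps (ltW eps0) 1 t; rewrite powR1; apply; rewrite ?nnegrE.
Qed.

Lemma measurable_two_sided d (T : measurableType d) (h : T -> R) : measurable_fun setT h ->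
  measurable_fun setT (fun t => two_sided eps (h t)).
Proof.
move=> mh; have mp r : measurable_fun setT (fun t => h t `^ r).
  by apply: (measurableT_comp (f := @powR R ^~ r)) => //; exact: measurable_powR.
apply: measurable_fun_ifT => //.
by apply: measurable_fun_ltr => //; exact: measurable_cst.
Qed.

End two_sided_facts.

Section scale_estimate.
Context {R : realType} {n : nat}.
Local Notation N := n.+1.
Local Notation rV := 'rV[R]_n.+1.
Local Notation lam := (@lebesgue_rV R n.+1).
Local Notation I h := (lam.-integrable setT (EFin \o h)).
Local Notation CI f := (Cintegrable lam setT f).
Local Notation Cint f := (Cintegral lam setT f).
Variables (M K : R) (psi kap : rV -> R[i]) (Cp Lp Ck eps : R).
Hypotheses (hM : 2 <= M) (hK : 1 <= K).
Hypotheses (mpsi : cmeasurable psi) (mkap : cmeasurable kap) (Lp0 : 0 <= Lp).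
Hypothesis psiW : forall x, (1 + `|x|) * normc (psi x) <= Cp * decay_weight x.
Hypothesis psiL : forall x y, normc (psi x - psi y) <= Lp * `|x - y|.
Hypothesis psiR : forall x y, enorm x = enorm y -> psi x = psi y.
Hypothesis kapW : forall x, (1 + `|x|) * normc (kap x) <= Ck * decay_weight x.
Hypothesis kap_cancel : forall H : rV -> R[i], CI H -> I (fun x => `|x| * normc (H x)) ->
  (forall x y, enorm x = enorm y -> H x = H y) -> Cint (fun x => kap x * H x) = 0.

(** The exponent for which 2^(i beta) to the power M is the growth 2^(i n / K) left of
    |Delta_i g|^M after weighting. *)
Definition beta : R := N%:R / (K * M).

Hypotheses (eps0 : 0 < eps) (eps1 : eps <= 1) (epsb : eps < beta).

(** Delta_i g without the factor 2^(i n). *)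
Definition averages (g : rV -> R[i]) (i : int) (x : rV) : R[i] :=
  Cint (fun y => psi (2 ^ i *: (x - y)) * g y).

Definition rescaled g (j : int) x (i : int) : R[i] :=
  (2 `^ ((i - j)%:~R * beta))%:C%C * averages g i x.

(** The function integrated against f once the kernel of Delta_j m(D) has been moved to
    the other factor. *)
Definition scale_pairing g (j : int) z : R[i] :=
  Cint (fun x => ((2 ^ j) ^+ N)%:C%C * kap (2 ^ j *: (x - z)) *
    nonlinearity M K j (rescaled g j x)).

(** The mass of g, each point y being discounted according to how far the scale 2^j is
    from the inverse distance of y to z. *)
Definition scale_error g (j : int) z : R :=
  \int[lam]_y (two_sided eps (2 ^ j * `|y - z|) * normc (g y)).

Let M0 : 0 < M. Proof. by rewrite (lt_le_trans _ hM). Qed.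
Let K0 : 0 < K. Proof. by rewrite (lt_le_trans _ hK). Qed.

Let Cp0 : 0 <= Cp.
Proof.
have := psiW 0; rewrite (_ : decay_weight 0 = 1) ?mulr1.
  by apply: le_trans; rewrite mulr_ge0 ?normc_ge0// addr_ge0.
by rewrite /decay_weight big1// => i _; rewrite mxE expr0n addr0 invr1.
Qed.

Let psiC x : (1 + `|x|) * normc (psi x) <= Cp.
Proof. by rewrite (le_trans (psiW x))// ler_piMr// decay_weight_le1. Qed.

Let psiB x : normc (psi x) <= Cp.
Proof. by rewrite (le_trans _ (psiC x))// ler_peMl ?normc_ge0// lerDl. Qed.

Lemma kap_moment : I (fun u => (1 + `|u|) * normc (kap u)).
Proof.
apply: le_integrable (integrable_scale Ck (integrable_decay_weight n.+1)) => //.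
  apply/measurable_EFinP; apply: measurable_funM; last exact: cmeasurable_normc.
  by apply: measurable_funD => //; apply: measurable_continuous => x; exact: norm_continuous.
move=> x _ /=; rewrite lee_fin ger0_norm ?mulr_ge0 ?normc_ge0 ?addr_ge0//.
by rewrite (le_trans (kapW x))// ler_norm.
Qed.

Lemma kap_integrable : CI kap.
Proof.
apply: (Cintegrable_dom mkap kap_moment) => x.
by rewrite ler_peMl ?normc_ge0// lerDl.
Qed.

Section fixed_g.
Variables (g : rV -> R[i]) (ig : CI g).
Local Notation A := (L1norm g).

Let A0 : 0 <= A.
Proof. by apply: Rintegral_ge0 => x _; exact: normc_ge0. Qed.

Let mg : cmeasurable g. Proof. exact: cmeasurable_integrable ig. Qed.

Lemma Cintegrable_bounded_mul (h : rV -> R[i]) C : cmeasurable h -> (forall y, normc (h y) <= C) ->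
  CI (fun y => h y * g y).
Proof.
move=> mh hC; apply: (Cintegrable_dom _ (integrable_scale C (integrable_normc ig))).
  exact: cmeasurableM.
by move=> y; rewrite normcM ler_wpM2r ?normc_ge0.
Qed.

Lemma measurable_affine (i : int) (x : rV) : measurable_fun setT (fun y : rV => 2 ^ i *: (x - y)).
Proof.
apply: (measurableT_comp (@measurable_scalerV R N (2 ^ i))).
by apply: measurable_subrV => //; exact: measurable_cst.
Qed.

Lemma averages_integrable i x : CI (fun y => psi (2 ^ i *: (x - y)) * g y).
Proof.
apply: (@Cintegrable_bounded_mul _ Cp) => //.
exact: (cmeasurable_comp mpsi (measurable_affine i x)).
Qed.

Lemma averages_bound i x : normc (averages g i x) <= Cp * A.
Proof.
rewrite /averages -RintegralZl//; last exact: integrable_normc.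
apply: Cintegral_bound.
- exact: cmeasurable_integrable (averages_integrable i x).
- exact: integrable_scale (integrable_normc ig).
- by move=> y; rewrite normcM ler_wpM2r ?normc_ge0.
Qed.

(** The averages are Lipschitz because psi is. *)
Lemma cmeasurable_averages i : cmeasurable (averages g i).
Proof.
apply: (cmeasurable_lipschitz (C := Lp * 2 ^ i * A)) => x x'.
rewrite /averages -(CintegralB (averages_integrable i x) (averages_integrable i x')).
have -> : Lp * 2 ^ i * A * `|x - x'| = \int[lam]_y (Lp * 2 ^ i * `|x - x'| * normc (g y)).
  rewrite RintegralZl//; last exact: integrable_normc.
  by rewrite -/(L1norm g); ring.
apply: Cintegral_bound.
- apply: cmeasurable_integrable.
  exact: (CintegrableB (averages_integrable i x) (averages_integrable i x')).
- exact: integrable_scale (integrable_normc ig).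
- move=> y; rewrite -mulrBl normcM ler_wpM2r ?normc_ge0//.
  rewrite (le_trans (psiL _ _))// -scalerBr opprB addrA addrNK normrZ mulrA.
  by rewrite ger0_norm// ltW// exprz2_gt0.
Qed.

Lemma cmeasurable_scale_nonlinearity j :
  cmeasurable (fun x => nonlinearity M K j (rescaled g j x)).
Proof.
apply: cmeasurable_nonlinearity => i; apply: cmeasurableM; first exact: cmeasurable_cst.
exact: cmeasurable_averages.
Qed.

Variables (G1 G2 : R).
Hypotheses (G10 : 0 <= G1) (G20 : 0 <= G2).
Hypothesis hG1 : forall j : int,
  (\esum_(i in [set i : int | (i <= j)%R]) (2 `^ ((i - j)%:~R * beta))%:E <= G1%:E)%E.
Hypothesis hG2 : forall j : int,
  (\esum_(i in [set i : int | (i <= j)%R]) (2 `^ ((i - j)%:~R * (beta - eps)))%:E <= G2%:E)%E.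

Let B := G1 * (Cp * A).
Let B0 : 0 <= B. Proof. by rewrite !mulr_ge0. Qed.

Lemma l1_geometric_bound j (a : int -> R[i]) c : 0 <= c -> (forall i, normc (a i) <= c) ->
  (\esum_(i in [set i : int | (i <= j)%R])
     (normc ((2 `^ ((i - j)%:~R * beta))%:C%C * a i))%:E <= (G1 * c)%:E)%E.
Proof.
move=> c0 ac; apply: (@le_trans _ _ (\esum_(i in [set i : int | (i <= j)%R])
   (c%:E * (2 `^ ((i - j)%:~R * beta))%:E))%E).
  apply: le_esum => i _; rewrite -EFinM lee_fin normcM normcR ger0_norm ?powR_ge0// mulrC.
  by rewrite ler_wpM2r ?powR_ge0.
apply: (le_trans (esumZ_le _ c0 _)); first by move=> i; rewrite lee_fin powR_ge0.
by rewrite [G1 * c]mulrC (EFinM c G1); apply: lee_wpmul2l; [rewrite lee_fin|exact: hG1].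
Qed.

Lemma rescaled_l1 j x :
  (\esum_(i in [set i : int | (i <= j)%R]) (normc (rescaled g j x i))%:E <= B%:E)%E.
Proof.
apply: l1_geometric_bound; first by rewrite mulr_ge0.
by move=> i; exact: averages_bound.
Qed.

Let CL := M + Num.max 1 (K - M^-1) * M.
Let CL0 : 0 <= CL.
Proof. by rewrite addr_ge0 ?mulr_ge0 ?(ltW M0)// le_max ler01. Qed.

Lemma nonlinearity0 j : nonlinearity M K j (fun=> 0) = 0.
Proof. by rewrite /nonlinearity mul0r. Qed.

Lemma scale_nonlinearity_bound j v :
  (\esum_(i in [set i : int | (i <= j)%R]) (normc (v i))%:E <= B%:E)%E ->
  normc (nonlinearity M K j v) <= CL * B `^ (M * K - 2) * B.
Proof.
move=> vB; rewrite -[nonlinearity M K j v]subr0 -(nonlinearity0 j).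
apply: nonlinearity_lipschitz => //.
  rewrite esum1 ?lee_fin// => i _; by rewrite normc0.
by under eq_esum do rewrite subr0.
Qed.

Lemma two_sided_integrable (c : R) z : 0 <= c ->
  I (fun y => two_sided eps (c * `|y - z|) * normc (g y)).
Proof.
move=> c0; apply: le_integrable (integrable_normc ig) => //.
  apply/measurable_EFinP; apply: measurable_funM; last exact: cmeasurable_normc.
  apply: measurable_two_sided; apply: measurable_funM => //.
  apply: measurable_continuous; apply: (continuous_of_lipschitz (C := 1)) => x y.
  by rewrite mul1r (le_trans (ler_dist_dist _ _))// opprB addrA addrNK.
move=> y _ /=; rewrite lee_fin normrM [`|normc _|]ger0_norm ?normc_ge0// ler_piMl ?normc_ge0//.
by rewrite ger0_norm ?two_sided_ge0// two_sided_le1// mulr_ge0.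
Qed.

Lemma scale_error_ge0 j z : 0 <= scale_error g j z.
Proof. by apply: Rintegral_ge0 => y _; rewrite mulr_ge0 ?two_sided_ge0 ?normc_ge0. Qed.

Section fixed_scale.
Variables (j : int) (z : rV).
Let c : R := 2 ^ j.
Let c0 : 0 < c. Proof. exact: exprz2_gt0. Qed.

(* The part of the mass of g that the scale j sees as concentrated at z. *)
Let near_mass : R[i] := Cint (fun y => (c * `|y - z| < 1)%R%:R%:C%C * g y).

(* What rescaled g j would be at x = z + 2^-j u if the near mass sat at z and the
   remainder were absent. *)
Let model (u : rV) (i : int) : R[i] :=
  (2 `^ ((i - j)%:~R * beta))%:C%C * (near_mass * psi (2 ^ (i - j) *: u)).

Let measurable_near : measurable_fun setT (fun y : rV => ((c * `|y - z| < 1)%R%:R : R)).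
Proof.
rewrite (_ : (fun _ => _) = \1_([set y : rV | c * `|y - z| < 1])); last first.
  by apply/funext => y; rewrite indicE mem_setE.
apply: measurable_indic; rewrite -[X in measurable X]setTI.
apply: (measurable_fun_ltr (f := fun y : rV => c * `|y - z|) (g := cst 1)) => //.
apply: measurable_funM => //.
apply: measurable_continuous; apply: (continuous_of_lipschitz (C := 1)) => x y.
by rewrite mul1r (le_trans (ler_dist_dist _ _))// opprB addrA addrNK.
Qed.

Let near_integrable : CI (fun y => (c * `|y - z| < 1)%R%:R%:C%C * g y).
Proof.
apply: (@Cintegrable_bounded_mul _ 1); first exact: cmeasurableR.
by move=> y; rewrite normcR; case: (_ < _)%R => /=; rewrite ?normr1 ?normr0.
Qed.

Let near_mass_bound : normc near_mass <= A.
Proof.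
apply: Cintegral_bound.
- exact: cmeasurable_integrable near_integrable.
- exact: integrable_normc.
- move=> y; rewrite normcM normcR ler_piMl ?normc_ge0//.
  by case: (_ < _)%R => /=; rewrite ?normr1 ?normr0.
Qed.

Let model_l1 u : (\esum_(i in [set i : int | (i <= j)%R]) (normc (model u i))%:E <= B%:E)%E.
Proof.
apply: l1_geometric_bound; first by rewrite mulr_ge0.
by move=> i; rewrite normcM mulrC ler_pM ?normc_ge0.
Qed.

Let H u := nonlinearity M K j (model u).

Let mH : cmeasurable H.
Proof.
apply: cmeasurable_nonlinearity => i; do 2 (apply: cmeasurableM; first exact: cmeasurable_cst).
exact: (cmeasurable_comp mpsi (@measurable_scalerV R N _)).
Qed.

(* The term i = j alone makes the nonlinearity integrable: it carries the decay of psi,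
   while the l^M sum is bounded. *)
Let H_decay : exists C : R, forall u, (1 + `|u|) * normc (H u) <= C * decay_weight u.
Proof.
pose c1 := B `^ (M - 2) * (B `^ M) `^ (K - 1).
have c10 : 0 <= c1 by rewrite mulr_ge0 ?powR_ge0.
exists (A * Cp * c1) => u.
have jj : [set i : int | (i <= j)%R] j by exact: lexx.
have mj : model u j = near_mass * psi u.
  by rewrite /model subrr mul0r powRr0 mul1r scale1r.
have b1 : normc (model u j) <= B by exact: (l1_term_le (model_l1 u) jj).
have b2 : lM_sum M j (model u) <= B `^ M by exact: (lM_sum_le hM B0 (model_l1 u)).
have h1 : normc (model u j) `^ (M - 2) <= B `^ (M - 2).
  by apply: ge0_ler_powR; rewrite ?subr_ge0 ?nnegrE ?normc_ge0.
have h2 : lM_sum M j (model u) `^ (K - 1) <= (B `^ M) `^ (K - 1).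
  by apply: ge0_ler_powR; rewrite ?subr_ge0 ?nnegrE ?powR_ge0 ?lM_sum_ge0.
have e1 : normc (H u) <= A * normc (psi u) * c1.
  rewrite /H /nonlinearity normcM normcR ger0_norm ?mulr_ge0 ?powR_ge0//.
  apply: ler_pM; rewrite ?normc_ge0 ?mulr_ge0 ?powR_ge0//.
    by rewrite mj normcM ler_wpM2r ?normc_ge0.
  by apply: ler_pM; rewrite ?powR_ge0.
rewrite (le_trans (ler_wpM2l _ e1)) ?addr_ge0//.
have -> : (1 + `|u|) * (A * normc (psi u) * c1) = A * c1 * ((1 + `|u|) * normc (psi u)) by ring.
apply: (le_trans (ler_wpM2l _ (psiW u))); first exact: mulr_ge0.
have -> : A * c1 * (Cp * decay_weight u) = A * Cp * c1 * decay_weight u.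
  by clear; clearbody c1; move: (decay_weight u) (L1norm g) => w a; ring.
exact: lexx.
Qed.

(* The model is radial in u, hence invisible to kap. *)
Let H_cancel : Cint (fun u => kap u * H u) = 0.
Proof.
have [C hC] := H_decay.
have iw := integrable_scale C (integrable_decay_weight n.+1 (R := R)).
apply: kap_cancel.
- apply: (Cintegrable_dom mH iw) => u.
  by rewrite (le_trans _ (hC u))// ler_peMl ?normc_ge0// lerDl.
- apply: le_integrable iw => //.
    apply/measurable_EFinP; apply: measurable_funM; last exact: cmeasurable_normc.
    by apply: measurable_continuous => x; exact: norm_continuous.
  move=> u _ /=; rewrite lee_fin ger0_norm ?mulr_ge0 ?normc_ge0//.
  rewrite (le_trans _ (ler_norm _))// (le_trans _ (hC u))//.
  by rewrite ler_wpM2r ?normc_ge0// lerDr.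
- move=> x y xy; rewrite /H; congr nonlinearity; apply/funext => i; rewrite /model.
  congr (_ * (_ * _)); apply: psiR; rewrite !enormZ ?xy//; exact/ltW/exprz2_gt0.
Qed.

Let rescaled_model u i : (i <= j)%R ->
  normc (rescaled g j (c^-1 *: u + z) i - model u i) <=
  2 `^ ((i - j)%:~R * (beta - eps)) * ((Cp + Lp) * ((1 + `|u|) * scale_error g j z)).
Proof.
move=> ij; rewrite /rescaled /model -mulrBr normcM normcR ger0_norm ?powR_ge0//.
set x := c^-1 *: u + z; set pu := psi (2 ^ (i - j) *: u).
have xE y : 2 ^ i *: (x - y) = 2 ^ i *: (z - y) + 2 ^ (i - j) *: u.
  rewrite /x -addrA scalerDr scalerA [LHS]addrC; congr (_ + _ *: _).
  by rewrite /c invr_expz -expfzDr ?pnatr_eq0.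
rewrite -(CintegralZr pu near_integrable).
have i1 : CI (fun y => (c * `|y - z| < 1)%R%:R%:C%C * g y * pu).
  have := CintegrableZ pu near_integrable.
  by rewrite (_ : (fun _ => _) = (fun y => (c * `|y - z| < 1)%R%:R%:C%C * g y * pu))//;
     apply/funext => y; rewrite mulrC.
rewrite /averages -(CintegralB (averages_integrable i x) i1).
pose t2 : R := 2 `^ ((j - i)%:~R * eps).
pose h y := (Cp + Lp) * (t2 * (1 + `|u|)) * (two_sided eps (c * `|y - z|) * normc (g y)).
have ih : I h by apply: integrable_scale; apply: two_sided_integrable; exact: ltW.
have e1 : normc (Cint (fun y => psi (2 ^ i *: (x - y)) * g y - (c * `|y - z| < 1)%R%:R%:C%C * g y * pu)) <=
    \int[lam]_y h y.
  apply: Cintegral_bound => //.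
    apply: cmeasurable_integrable.
    exact: (CintegrableB (averages_integrable i x) i1).
  move=> y; rewrite mulrAC -mulrBl normcM /h mulrA ler_wpM2r ?normc_ge0//.
  have := kernel_difference Lp0 psiC psiL eps0 eps1 z y u ij; rewrite -/pu -/c xE.
  have -> : (if c * `|y - z| < 1 then pu else 0) = (c * `|y - z| < 1)%R%:R%:C%C * pu.
    by case: (_ < _)%R; rewrite ?mul1r ?mul0r.
  by rewrite -/t2 !mulrA.
rewrite (le_trans (ler_wpM2l _ e1)) ?powR_ge0// RintegralZl//; last first.
  by apply: two_sided_integrable; exact: ltW.
rewrite -/(scale_error g j z).
have -> : 2 `^ ((i - j)%:~R * beta) = 2 `^ ((i - j)%:~R * (beta - eps)) * 2 `^ ((i - j)%:~R * eps).
  by rewrite -powRD ?pnatr_eq0 ?implybT//; congr (_ `^ _); ring.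
have tt : 2 `^ ((i - j)%:~R * eps) * t2 = 1.
  rewrite /t2 -powRD ?pnatr_eq0 ?implybT// -(opprB i j) mulrNz.
  by rewrite (_ : _ + _ = 0) ?powRr0//; ring.
rewrite le_eqVlt; apply/orP; left; apply/eqP.
transitivity (2 `^ ((i - j)%:~R * (beta - eps)) * (2 `^ ((i - j)%:~R * eps) * t2) *
  ((Cp + Lp) * ((1 + `|u|) * scale_error g j z))); last by rewrite tt mulr1.
by ring.
Qed.

(** The substitution x = z + 2^-j u. *)
Lemma scale_pairing_rescale :
  scale_pairing g j z = Cint (fun u => kap u * nonlinearity M K j (rescaled g j (c^-1 *: u + z))).
Proof.
pose F x := nonlinearity M K j (rescaled g j x).
have mF : cmeasurable F by exact: cmeasurable_scale_nonlinearity.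
have mcz : measurable_fun setT (fun u : rV => c^-1 *: u + z).
  apply: (measurableT_comp (measurable_addrV z)); exact: measurable_scalerV.
have iP : CI (fun u => kap u * F (c^-1 *: u + z)).
  apply: (Cintegrable_dom _ (integrable_scale (CL * B `^ (M * K - 2) * B) (integrable_normc kap_integrable))).
    exact: (cmeasurableM mkap (cmeasurable_comp mF mcz)).
  move=> u; rewrite (normcM (kap u)) mulrC ler_wpM2r ?normc_ge0//.
  by apply: scale_nonlinearity_bound; exact: rescaled_l1.
rewrite -(Cintegral_dilate c0 iP) /scale_pairing -/c.
have iPc := Cintegrable_dilate c0 iP.
rewrite -(CintegralZ _ iPc).
rewrite -[LHS](Cintegral_mp (preserving_translate z)).
  apply: eq_Cintegral => x.
  by rewrite addrK scalerA mulVf ?gt_eqF// scale1r mulrA.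
apply: cmeasurableM => //; apply: cmeasurableM; first exact: cmeasurable_cst.
apply: (cmeasurable_comp mkap); apply: (measurableT_comp (@measurable_scalerV R N c)).
by apply: measurable_subrV => //; exact: measurable_cst.
Qed.

(** Subtract the vanishing integral of the radial model and use that the nonlinearity is
    Lipschitz. The l^1 distance of the two families grows like 1 + |u|, which kap
    absorbs. *)
Lemma scale_pairing_bound :
  normc (scale_pairing g j z) <=
  CL * B `^ (M * K - 2) * (G2 * (Cp + Lp)) *
  (\int[lam]_u ((1 + `|u|) * normc (kap u))) * scale_error g j z.
Proof.
have E0 := scale_error_ge0 j z.
pose F x := nonlinearity M K j (rescaled g j x).
have mF : cmeasurable F by exact: cmeasurable_scale_nonlinearity.
have mcz : measurable_fun setT (fun u : rV => c^-1 *: u + z).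
  apply: (measurableT_comp (measurable_addrV z)); exact: measurable_scalerV.
have bnd (h : rV -> R[i]) : cmeasurable h ->
    (forall u, normc (h u) <= CL * B `^ (M * K - 2) * B) -> CI (fun u => kap u * h u).
  move=> mh hb.
  apply: (Cintegrable_dom _ (integrable_scale (CL * B `^ (M * K - 2) * B) (integrable_normc kap_integrable))).
    exact: (cmeasurableM mkap mh).
  by move=> u; rewrite (normcM (kap u)) mulrC ler_wpM2r ?normc_ge0.
have iP : CI (fun u => kap u * F (c^-1 *: u + z)).
  apply: bnd; first exact: (cmeasurable_comp mF mcz).
  by move=> u; apply: scale_nonlinearity_bound; exact: rescaled_l1.
have iH : CI (fun u => kap u * H u).
  by apply: bnd => // u; apply: scale_nonlinearity_bound.
rewrite scale_pairing_rescale -[Cint _]subr0 -H_cancel -(CintegralB iP iH).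
pose C := CL * B `^ (M * K - 2) * (G2 * (Cp + Lp)) * scale_error g j z.
have -> : CL * B `^ (M * K - 2) * (G2 * (Cp + Lp)) *
   (\int[lam]_u ((1 + `|u|) * normc (kap u))) * scale_error g j z =
   \int[lam]_u (C * ((1 + `|u|) * normc (kap u))).
  by rewrite RintegralZl//; [rewrite /C; ring|exact: kap_moment].
apply: Cintegral_bound.
- exact: cmeasurable_integrable (CintegrableB iP iH).
- exact: integrable_scale kap_moment.
move=> u; rewrite -mulrBr normcM mulrA mulrC ler_wpM2r ?normc_ge0//.
pose D := G2 * ((Cp + Lp) * ((1 + `|u|) * scale_error g j z)).
have D0 : 0 <= D by rewrite !mulr_ge0 ?addr_ge0.
have := @nonlinearity_lipschitz R M K j hM hK (rescaled g j (c^-1 *: u + z)) (model u) B D B0 D0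
  (rescaled_l1 j _) (model_l1 u).
rewrite -/CL -/(F _) -/(H u) => h; rewrite (le_trans (h _))//; last first.
  by rewrite le_eqVlt; apply/orP; left; apply/eqP; rewrite /D /C; ring.
have d0 : 0 <= (Cp + Lp) * ((1 + `|u|) * scale_error g j z).
  by rewrite !mulr_ge0 ?addr_ge0.
apply: (@le_trans _ _ (\esum_(i in [set i : int | (i <= j)%R])
   (((Cp + Lp) * ((1 + `|u|) * scale_error g j z))%:E * (2 `^ ((i - j)%:~R * (beta - eps)))%:E))%E).
  by apply: le_esum => i ij; rewrite -EFinM lee_fin mulrC; exact: rescaled_model.
apply: (le_trans (esumZ_le _ d0 _)); first by move=> i; rewrite lee_fin powR_ge0.
rewrite /D [G2 * _]mulrC (EFinM _ G2).
by apply: lee_wpmul2l; [rewrite lee_fin|exact: hG2].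
Qed.

End fixed_scale.
End fixed_g.
End scale_estimate.

(** * Transposition and sum over the scales *)

Section convolution_fubini.
Context {R : realType} {n : nat}.
Local Notation rV := 'rV[R]_n.
Local Notation lam := (@lebesgue_rV R n).
Local Notation I h := (lam.-integrable setT (EFin \o h)).
Local Notation CI f := (Cintegrable lam setT f).
Local Notation Cint f := (Cintegral lam setT f).

Lemma integrable_sub_translate (h : rV -> R) z : I h -> I (fun x => h (x - z)).
Proof. exact: (integrable_mp (preserving_translate (- z))). Qed.

(** Absolute integrability of a convolution: the inner integral of h (x - z) does not depend
    on z. *)
Lemma Cfubini_conv (G : rV -> rV -> R[i]) (f : rV -> R[i]) (h : rV -> R) (C : R) :
  cmeasurable (fun p : rV * rV => G p.1 p.2) -> CI f -> I h ->
  (forall x, 0 <= h x) -> (forall x, h x <= C) ->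
  (forall z x, normc (G z x) <= normc (f z) * h (x - z)) ->
  [/\ CI (fun z => Cint (G z)), CI (fun x => Cint (G ^~ x)) &
      Cint (fun z => Cint (G z)) = Cint (fun x => Cint (G ^~ x))].
Proof.
move=> mG iF ih h0 hC Gh.
have ihz z : I (fun x => normc (f z) * h (x - z)).
  exact: (integrable_scale _ (integrable_sub_translate z ih)).
have mh : measurable_fun setT h by apply/measurable_EFinP; exact: measurable_int ih.
have mG1 z : cmeasurable (G z) by exact: (cmeasurable_comp mG (measurable_pair1 z)).
have mG2 x : cmeasurable (G ^~ x) by exact: (cmeasurable_comp mG (measurable_pair2 x)).
apply: (Cfubini (sigma_finite_lam n) (sigma_finite_lam n) mG).
- apply: (@le_lt_trans _ _ (\int[lam]_z ((normc (f z))%:E * (\int[lam]_x (h x))%:E))%E).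
    apply: ge0_le_integral => //.
    + by move=> z _; apply: integral_ge0 => x _; rewrite lee_fin normc_ge0.
    + apply: (sf_measurable_tonelli1 (sigma_finite_lam n)
          (f := fun p => (normc (G p.1 p.2))%:E)) => [|p].
        by apply/measurable_EFinP; exact: cmeasurable_normc.
      by rewrite lee_fin normc_ge0.
    + apply: emeasurable_funM => //; apply/measurable_EFinP.
      exact: (cmeasurable_normc (cmeasurable_integrable iF)).
    + move=> z _.
      have -> : (\int[lam]_x (h x))%:E = (\int[lam]_x (h (x - z))%:E)%E.
        rewrite /Rintegral fineK; last exact: integrable_fin_num ih.
        rewrite -((preserving_translate (- z)).2 (EFin \o h))//; exact/measurable_EFinP.
      rewrite -ge0_integralZl_EFin ?normc_ge0//; last 2 first.
      * by move=> x _; rewrite lee_fin.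
      * exact: (measurable_int _ (integrable_sub_translate z ih)).
      apply: ge0_le_integral => //.
      * by move=> x _; rewrite lee_fin normc_ge0.
      * by apply/measurable_EFinP; exact: cmeasurable_normc (mG1 z).
      * exact: (measurable_int _ (ihz z)).
      * by move=> x _; rewrite lee_fin Gh.
  have i0 := integrable_scale (\int[lam]_x h x) (integrable_normc iF).
  have := integrable_lty measurableT i0; apply: le_lt_trans.
  by rewrite le_eqVlt; apply/orP; left; apply/eqP; apply: eq_integral => z _; rewrite -EFinM mulrC.
- by move=> z; exact: (Cintegrable_dom (mG1 z) (ihz z) (Gh z)).
- move=> x; apply: (Cintegrable_dom (mG2 x) (integrable_scale C (integrable_normc iF))) => z.
  by rewrite (le_trans (Gh z x))// mulrC ler_wpM2r ?normc_ge0.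
Qed.

Lemma Rintegral_fsum (X : set int) (F : int -> rV -> R) : finite_set X -> (forall j, I (F j)) ->
  I (fun x => \sum_(j \in X) F j x) /\
  \int[lam]_x (\sum_(j \in X) F j x) = \sum_(j \in X) \int[lam]_x F j x.
Proof.
move=> fX iF; rewrite (fsbig_finite _ _ fX)//.
under [fun x => \sum_(j \in X) _]eq_fun do rewrite (fsbig_finite _ _ fX)//.
elim: (finmap.enum_fset (fset_set X)) => [|j s [IH1 IH2]].
  have z0 : (fun x => \sum_(j <- [::]) F j x) = (fun=> 0 : R).
    by apply/funext => x; rewrite big_nil.
  rewrite z0 big_nil; split; first exact: integrable0.
  by rewrite /Rintegral integral0.
have z0 : (fun x => \sum_(i <- j :: s) F i x) = (fun x => F j x + \sum_(i <- s) F i x).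
  by apply/funext => x; rewrite big_cons.
rewrite z0 big_cons -IH2; split; first exact: (integrableD measurableT (iF j) IH1).
exact: RintegralD.
Qed.
End convolution_fubini.

Section sum_over_scales.
Context {R : realType} {n : nat} (eps : R).
Hypotheses (eps0 : 0 < eps).
Local Notation rV := 'rV[R]_n.+1.
Local Notation lam := (@lebesgue_rV R n.+1).
Local Notation I h := (lam.-integrable setT (EFin \o h)).
Local Notation CI f := (Cintegrable lam setT f).
Variables (f g : rV -> R[i]).
Hypotheses (iF : CI f) (ig : CI g).

Let w (j : int) (z y : rV) : R := two_sided eps (2 ^ j * `|y - z|) * normc (g y).

Let w_ge0 j z y : 0 <= w j z y.
Proof. by rewrite mulr_ge0 ?normc_ge0 ?two_sided_ge0. Qed.

Let iw j z : I (w j z).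
Proof. exact: (two_sided_integrable eps0 ig z (ltW (exprz2_gt0 j))). Qed.

Lemma scale_error_le j z : scale_error eps g j z <= L1norm g.
Proof.
apply: le_Rintegral => //; [exact: iw|exact: integrable_normc|].
move=> y _; rewrite ler_piMl ?normc_ge0// two_sided_le1// mulr_ge0//.
exact: ltW (exprz2_gt0 j).
Qed.

Lemma measurable_scale_error j : measurable_fun setT (scale_error eps g j).
Proof.
apply: (measurableT_comp (f := fine) (g := fun z => (\int[lam]_y (w j z y)%:E)%E)) => //.
apply: (sf_measurable_tonelli1 (sigma_finite_lam n.+1)
   (f := fun p => (w j p.1 p.2)%:E)) => [|p]; last by rewrite lee_fin.
apply/measurable_EFinP; apply: measurable_funM.
  apply: measurable_two_sided.
  apply: measurable_funM => //.
  apply: (measurableT_comp (f := fun x : rV => `|x|)).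
    by apply: measurable_continuous => x; exact: norm_continuous.
  by apply: measurable_subrV.
by apply: cmeasurable_normc; exact: (cmeasurable_comp (cmeasurable_integrable ig)).
Qed.

Lemma integrable_scale_error j : I (fun z => normc (f z) * scale_error eps g j z).
Proof.
apply: le_integrable (integrable_scale (L1norm g) (integrable_normc iF)) => //.
  apply/measurable_EFinP; apply: measurable_funM; last exact: measurable_scale_error.
  exact: cmeasurable_normc (cmeasurable_integrable iF).
move=> z _ /=; rewrite lee_fin normrM mulrC.
have s0 : 0 <= scale_error eps g j z by apply: Rintegral_ge0 => y _; exact: w_ge0.
rewrite (ger0_norm s0) (ger0_norm (normc_ge0 _)) (le_trans _ (ler_norm _))//.
by rewrite ler_wpM2r ?normc_ge0// scale_error_le.
Qed.

Variable C : R.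
Hypothesis sumC : forall t : R, 0 <= t ->
  (\esum_(j in [set: int]) (two_sided eps (2 `^ j%:~R * t))%:E <= C%:E)%E.

(** Under the integral the weights sum up to a constant, whatever the distance of y
    to z. *)
Lemma sum_scale_error (X : set int) z : finite_set X ->
  \sum_(j \in X) scale_error eps g j z <= C * L1norm g.
Proof.
move=> fX; have [i0 <-] := Rintegral_fsum fX (iw ^~ z).
rewrite /L1norm -RintegralZl//; last exact: integrable_normc.
apply: le_Rintegral => //; first exact: integrable_scale (integrable_normc ig).
move=> y _; rewrite -mulr_fsuml// ler_wpM2r ?normc_ge0//.
rewrite -lee_fin -fsumEFin//.
apply: le_trans (sumC (normr_ge0 (y - z))).
under eq_fsbigr do rewrite -powR2_int.
by apply: ereal_sup_ubound; exists X.
Qed.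

Lemma sum_weighted_scale_error (X : set int) : finite_set X ->
  \sum_(j \in X) \int[lam]_z (normc (f z) * scale_error eps g j z) <=
  C * (L1norm f * L1norm g).
Proof.
move=> fX; have [i0 <-] := Rintegral_fsum fX integrable_scale_error.
rewrite [L1norm f * _]mulrC mulrA [L1norm f]/L1norm -RintegralZl//; last exact: integrable_normc.
apply: le_Rintegral => //; first exact: integrable_scale (integrable_normc iF).
by move=> z _; rewrite -mulr_fsumr// mulrC ler_wpM2r ?normc_ge0// sum_scale_error.
Qed.

End sum_over_scales.

(** * Rescaling the Littlewood-Paley pieces *)

Section littlewood_paley_rescaling.
Context {R : realType}.

Lemma esumZ (T : choiceType) (Q : set T) (c : R) (a : T -> \bar R) : 0 < c ->
  (forall k, (0 <= a k)%E) -> (\esum_(k in Q) (c%:E * a k) = c%:E * \esum_(k in Q) a k)%E.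
Proof.
move=> c0 a0; apply/le_anti/andP; split; first exact: (esumZ_le _ (ltW c0)).
have aE k : (a k = c^-1%:E * (c%:E * a k))%E.
  by rewrite muleA -EFinM mulVf ?gt_eqF// mul1e.
under [in leLHS]eq_esum do rewrite aE.
apply: (@le_trans _ _ (c%:E * (c^-1%:E * \esum_(k in Q) (c%:E * a k)))%E).
  apply: lee_wpmul2l; first by rewrite lee_fin ltW.
  apply: esumZ_le; first by rewrite invr_ge0 ltW.
  by move=> k; rewrite mule_ge0// lee_fin ltW.
by rewrite muleA -EFinM mulfV ?gt_eqF// mul1e.
Qed.

Lemma pow_scale (i : int) (N : nat) : ((2 : R) ^ i) ^+ N = 2 `^ (i%:~R * N%:R).
Proof. by rewrite powRrM powR2_int powR_mulrn// ltW// exprz2_gt0. Qed.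

Lemma powR2D (r s : R) : 2 `^ (r + s) = 2 `^ r * 2 `^ s.
Proof. by rewrite powRD// pnatr_eq0 implybT. Qed.

Variables (M K : R) (n : nat).
Hypotheses (hM : 2 <= M) (hK : 1 <= K).
Local Notation N := n.+1.

Let M0 : 0 < M. Proof. by rewrite (lt_le_trans _ hM). Qed.
Let K0 : 0 < K. Proof. by rewrite (lt_le_trans _ hK). Qed.

(** Bookkeeping of powers of two. For every i the i-th summand is 2^(j n / K) |v_i|^M; then
    the exponents n, n (M - 2) and n (K - 1) / K of the three factors add up to
    n (M K - 1) / K. *)
Lemma lp_nonlinearity (b D v : int -> R[i]) (j : int) (s B : R) :
  s = N%:R * (M * K - 1) / K -> 0 <= B ->
  (forall i, D i = ((2 ^ i) ^+ N)%:C%C * b i) ->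
  (forall i, v i = (2 `^ ((i - j)%:~R * beta (n := n) M K))%:C%C * b i) ->
  (\esum_(i in [set i : int | (i <= j)%R]) (normc (v i))%:E <= B%:E)%E ->
  D j * (normc (D j) `^ (M - 2) *
    fine (\esum_(i in [set i : int | (i <= j)%R])
      (2 `^ (- (i%:~R * s)) * normc (D i) `^ M)%:E) `^ (K - 1))%:C%C =
  (2 `^ (j%:~R * s))%:C%C * nonlinearity M K j v.
Proof.
move=> sE B0 DE vE vB.
have K0' : K != 0 by rewrite gt_eqF.
have M0' : M != 0 by rewrite gt_eqF.
have nD i : normc (D i) = 2 `^ (i%:~R * N%:R) * normc (b i).
  by rewrite DE normcM normcR pow_scale ger0_norm// powR_ge0.
have nv i : normc (v i) = 2 `^ ((i - j)%:~R * beta (n := n) M K) * normc (b i).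
  by rewrite vE normcM normcR ger0_norm// powR_ge0.
have term i : 2 `^ (- (i%:~R * s)) * normc (D i) `^ M =
    2 `^ (j%:~R * (N%:R / K)) * normc (v i) `^ M.
  rewrite nD nv; have := normc_ge0 (b i); move: (normc (b i)) => x x0.
  have p0 r : 0 <= (2 : R) `^ r by exact: powR_ge0.
  rewrite (powRM _ (p0 _) x0) (powRM _ (p0 _) x0) -!powRrM 2!mulrA -2!powR2D.
  congr (_ `^ _ * _); rewrite intrB sE /beta; field.
  by rewrite K0' M0'.
have vj : v j = b j by rewrite vE subrr mul0r powRr0 mul1r.
under eq_esum do rewrite term EFinM.
rewrite esumZ ?powR_gt0//; last by move=> i; rewrite lee_fin powR_ge0.
rewrite (lM_sumE hM B0 vB) -EFinM/= powRM ?powR_ge0 ?lM_sum_ge0// -powRrM.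
rewrite nD powRM ?powR_ge0 ?normc_ge0// -powRrM DE pow_scale /nonlinearity vj.
set x := normc (b j) `^ _; set y := lM_sum _ _ _ `^ _.
have -> : 2 `^ (j%:~R * s) = 2 `^ (j%:~R * N%:R) *
    (2 `^ (j%:~R * N%:R * (M - 2)) * 2 `^ (j%:~R * (N%:R / K) * (K - 1))).
  by rewrite -!powR2D; congr (_ `^ _); rewrite sE; field.
rewrite !rmorphM/=; ring.
Qed.

End littlewood_paley_rescaling.

Section littlewood_paley_kernels.
Context {R : realType} {n : nat}.
Local Notation N := n.+1.
Local Notation rV := 'rV[R]_n.+1.
Local Notation lam := (@lebesgue_rV R n.+1).
Local Notation CI f := (Cintegrable lam setT f).
Local Notation Cint f := (Cintegral lam setT f).

Lemma multiplier_scale (a f : rV -> R[i]) (j : int) x : CI a -> CI f ->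
  multiplier (fun xi => a (2 ^ (- j) *: xi)) f x =
  Cint (fun z => ((2 ^ j) ^+ N)%:C%C * inv_fourier a (2 ^ j *: (x - z)) * f z).
Proof.
move=> ia iF; have c0 : 0 < (2 : R) ^ (- j) := exprz2_gt0 _.
rewrite (multiplier_conv (a := fun xi => a (2 ^ (- j) *: xi)))//; last exact: Cintegrable_dilate.
apply: eq_Cintegral => z; congr (_ * _).
rewrite -invr_expz (inv_fourier_dilate (c := 2 ^ j))//.
exact: exprz2_gt0.
Qed.

End littlewood_paley_kernels.

Section transposition.
Context {R : realType} {n : nat}.
Local Notation N := n.+1.
Local Notation rV := 'rV[R]_n.+1.
Local Notation lam := (@lebesgue_rV R n.+1).
Local Notation I h := (lam.-integrable setT (EFin \o h)).
Local Notation CI f := (Cintegrable lam setT f).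
Local Notation Cint f := (Cintegral lam setT f).

(** Exchange the convolution with the outer integral: a bound on the transposed kernel
    applied to F is then integrated against |f|. *)
Lemma transposed_convolution_bound (kap f F : rV -> R[i]) (E : rV -> R) (Ck B P : R) (j : int) :
  CI kap -> (forall x, normc (kap x) <= Ck) -> CI f ->
  cmeasurable F -> (forall x, normc (F x) <= B) ->
  I (fun z => normc (f z) * E z) ->
  (forall z, normc (Cint (fun x => ((2 ^ j) ^+ N)%:C%C * kap (2 ^ j *: (x - z)) * F x)) <=
     P * E z) ->
  let T x := Cint (fun z => ((2 ^ j) ^+ N)%:C%C * kap (2 ^ j *: (x - z)) * f z) * F x in
  CI T /\ normc (Cint T) <= P * \int[lam]_z (normc (f z) * E z).
Proof.
move=> ik kC iF mF FB iE PE T.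
set c : R := 2 ^ j in PE T *; have c0 : 0 < c := exprz2_gt0 j.
have cN0 : 0 <= c ^+ N by rewrite exprn_ge0// ltW.
have mk := cmeasurable_integrable ik; have mf := cmeasurable_integrable iF.
have B0 : 0 <= B by rewrite (le_trans _ (FB 0)) ?normc_ge0.
pose k (u : rV) : R[i] := (c ^+ N)%:C%C * kap (c *: u).
have kE u : k u = (c ^+ N)%:C%C * kap (c *: u) by [].
have mkk : cmeasurable k.
  apply: cmeasurableM; first exact: cmeasurable_cst.
  exact: (cmeasurable_comp mk (@measurable_scalerV R N c)).
clearbody k.
have nk u : normc (k u) = c ^+ N * normc (kap (c *: u)).
  by rewrite kE (normcM (c ^+ N)%:C%C) normcR ger0_norm.
have mr (x : rV) : measurable_fun setT (fun z : rV => x - z).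
  by apply: measurable_subrV => //; exact: measurable_cst.
have ml (z : rV) : measurable_fun setT (fun x : rV => x - z).
  by apply: measurable_subrV => //; exact: measurable_cst.
pose h u := B * (c ^+ N * normc (kap (c *: u))).
have ih : I h.
  do 2 apply: integrable_scale.
  exact: (integrable_dilate c0 (integrable_normc ik)).
pose G z x := f z * (k (x - z) * F x).
have mG : cmeasurable (fun p : rV * rV => G p.1 p.2).
  apply: cmeasurableM; first exact: (cmeasurable_comp mf measurable_fst).
  apply: cmeasurableM; last exact: (cmeasurable_comp mF measurable_snd).
  apply: (cmeasurable_comp mkk); exact: (measurable_subrV measurable_snd measurable_fst).
have [i1 i2 EQ] : [/\ CI (fun z => Cint (G z)), CI (fun x => Cint (G ^~ x)) &
      Cint (fun z => Cint (G z)) = Cint (fun x => Cint (G ^~ x))].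
  apply: (@Cfubini_conv R N G f h (B * (c ^+ N * Ck))) => //.
  - by move=> x; rewrite /h !mulr_ge0 ?normc_ge0.
  - by move=> x; rewrite /h ler_wpM2l// ler_wpM2l.
  - move=> z x; rewrite /G (normcM (f z)) ler_wpM2l ?normc_ge0//.
    rewrite (normcM (k (x - z)) (F x)) nk /h mulrC.
    exact: (ler_wpM2r (mulr_ge0 cN0 (normc_ge0 _)) (FB x)).
have TE x : T x = Cint (G ^~ x).
  have ikf : CI (fun z => k (x - z) * f z).
    apply: (Cintegrable_dom (h := fun z => c ^+ N * Ck * normc (f z))).
    - exact: (cmeasurableM (cmeasurable_comp mkk (mr x)) mf).
    - exact: integrable_scale (integrable_normc iF).
    - move=> z; rewrite (normcM (k (x - z)) (f z)).
      rewrite nk.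
      apply: ler_wpM2r; first exact: normc_ge0.
      exact: (ler_wpM2l cN0 (kC _)).
  have -> : T x = Cint (fun z => k (x - z) * f z) * F x.
    by rewrite /T; congr (_ * _); apply: eq_Cintegral => z; rewrite kE.
  by rewrite -(CintegralZr (F x) ikf); apply: eq_Cintegral => z; rewrite /G mulrC mulrCA [F x * _]mulrC mulrCA.
have GE z : Cint (G z) = f z * Cint (fun x => k (x - z) * F x).
  have ikF : CI (fun x => k (x - z) * F x).
    apply: (Cintegrable_dom (h := fun x : rV => h (x - z)) _ (integrable_sub_translate z ih)).
    - exact: (cmeasurableM (cmeasurable_comp mkk (ml z)) mF).
    - move=> x; rewrite (normcM (k (x - z)) (F x)) nk /h mulrC.
      exact: (ler_wpM2r (mulr_ge0 cN0 (normc_ge0 _)) (FB x)).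
  exact: CintegralZ.
rewrite (_ : T = fun x => Cint (G ^~ x)); last by apply/funext.
split; first exact: i2.
rewrite -EQ -(RintegralZl P measurableT iE).
apply: Cintegral_bound; first exact: cmeasurable_integrable i1.
  exact: integrable_scale.
move=> z; rewrite (GE z) (normcM (f z)) [leRHS]mulrCA.
apply: ler_wpM2l; first exact: normc_ge0.
by under eq_Cintegral do rewrite kE; exact: PE.
Qed.

End transposition.

(** By homogeneity m may be dilated together with phi, so that all the symbols of
    Delta_j m(D) are dilates of a single one; at the origin phi vanishes. *)
Lemma LPm_symbol (R : realType) (n : nat) (phi : 'rV[R]_n -> R) (m : 'rV[R]_n -> R[i]) (j : int) :
  test_function_off0 phi -> homogeneous0 m ->
  (fun xi => (phi ((2 : R) ^ (- j) *: xi))%:C%C * m xi) =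
  (fun xi => (fun eta => (phi eta)%:C%C * m eta) ((2 : R) ^ (- j) *: xi)).
Proof.
move=> tphi hom; apply/funext => xi; have [->|x0] := eqVneq xi 0.
  by rewrite scaler0.
by rewrite hom// exprz2_gt0.
Qed.

Theorem proposition1p3 (R : realType) (n : nat) (hn : (2 <= n)%N)
    (phi : 'rV[R]_n -> R) (hphi : LP_partition phi)
    (m : 'rV[R]_n -> R[i])
    (hm_smooth : csmooth_on [set xi | xi != 0] m)
    (hm_hom : homogeneous0 m)
    (hm_mean : Cintegral surface_measure esphere m = 0)
    (M K : R) (hM : 2 <= M) (hK : 1 <= K) :
  let L := M * K - 1 in
  exists C : R, 0 < C /\
    forall f g : 'rV[R]_n -> R[i], L1 f -> L1 g ->
      (\esum_(j in [set: int])
         (2 `^ (- (j%:~R * (n%:R * L / K))) *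
          normc (Cintegral (lebesgue_rV n) setT (fun x =>
            LPm phi m j f x * LP phi j g x *
            (normc (LP phi j g x) `^ (M - 2) *
             low_freq_sum phi (n%:R * L / K) M j g x `^ (K - 1))%:C%C)))%:E
       <= (C * L1norm f * L1norm g `^ L)%:E)%E.
Proof.
move=> L; case: n hn phi hphi m hm_smooth hm_hom hm_mean => [//|n] hn phi hphi m sm hom mean0.
have [tphi _ rphi _] := hphi.
have ta := test_symbolR tphi; have tb := test_symbol_mul tphi sm.
set a := (fun xi => (phi xi)%:C%C) in ta; set b := (fun xi => _) in tb.
have ia := test_symbol_integrable ta; have ib := test_symbol_integrable tb.
have [Cp [Cp0 psiW]] := inv_fourier_decay ta.
have [Ck [Ck0 kapW]] := inv_fourier_decay tb.
have [Lp [Lp0 psiL]] := inv_fourier_lipschitz ia (test_symbol_moment ta).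
have [Lk [_ kapL]] := inv_fourier_lipschitz ib (test_symbol_moment tb).
have psiR : forall x y, enorm x = enorm y -> inv_fourier a x = inv_fourier a y.
  apply: (inv_fourier_radial (cmeasurable_integrable ia)) => x y xy.
  by rewrite /a (rphi _ _ xy).
have mpsi := cmeasurable_lipschitz psiL; have mkap := cmeasurable_lipschitz kapL.
have canc H := @kernel_cancellation R n phi m H tphi rphi sm hom mean0.
move: psiW kapW psiL psiR mpsi mkap canc; rewrite -/b.
have scaleP f j x iF := multiplier_scale (f := f) j x ia iF.
have scaleK f j x iF := multiplier_scale (f := f) j x ib iF.
move: scaleP scaleK.
set psi := inv_fourier a; set kap := inv_fourier b.
move=> scaleP scaleK psiW kapW psiL psiR mpsi mkap canc.
have M0 : 0 < M by rewrite (lt_le_trans _ hM).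
have K0 : 0 < K by rewrite (lt_le_trans _ hK).
pose bt := beta (n := n) M K.
have bt0 : 0 < bt by rewrite divr_gt0// ?ltr0n// mulr_gt0.
(* at most 1 for the comparison of kernels, below beta for the sum over i *)
pose eps := Num.min 1 (bt / 2).
have eps0 : 0 < eps by rewrite lt_min ltr01 divr_gt0.
have eps1 : eps <= 1 by rewrite ge_min lexx.
have epsb : eps < bt by rewrite gt_min; apply/orP; right; rewrite ltr_pdivrMr//; lra.
have [G1 [G10 hG1]] := esum_geometric_below bt0.
have be0 : 0 < bt - eps by rewrite subr_gt0.
have [G2 [G20 hG2]] := esum_geometric_below be0.
have [C4 [C40 hC4]] := esum_two_sided eps0.
pose CL := M + Num.max 1 (K - M^-1) * M.
have CL0 : 0 <= CL by rewrite addr_ge0 ?mulr_ge0 ?(ltW M0)// le_max ler01.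
pose kappa := \int[lebesgue_rV n.+1]_u ((1 + `|u|) * normc (kap u)).
have kappa0 : 0 <= kappa.
  by apply: Rintegral_ge0 => u _; rewrite mulr_ge0 ?normc_ge0 ?addr_ge0.
pose C0 := CL * (G1 * Cp) `^ (M * K - 2) * (G2 * (Cp + Lp)) * kappa * C4.
have C00 : 0 <= C0 by rewrite !mulr_ge0 ?powR_ge0 ?(addr_ge0 Cp0 Lp0).
have ik := kap_integrable mkap kapW.
have kC x : normc (kap x) <= Ck.
  have h : normc (kap x) <= (1 + `|x|) * normc (kap x) by rewrite ler_peMl ?normc_ge0// lerDl.
  by rewrite (le_trans h)// (le_trans (kapW x))// ler_piMr// decay_weight_le1.
(* the constant must be positive even if the kernels vanish *)
exists (C0 + 1); split=> [|f g iF ig]; first by rewrite ltr_wpDl.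
have A0 : 0 <= L1norm g by apply: Rintegral_ge0 => x _; exact: normc_ge0.
have F0 : 0 <= L1norm f by apply: Rintegral_ge0 => x _; exact: normc_ge0.
pose B := G1 * (Cp * L1norm g).
have B0 : 0 <= B by rewrite !mulr_ge0.
pose P := CL * B `^ (M * K - 2) * (G2 * (Cp + Lp)) * kappa.
have P0 : 0 <= P by rewrite !mulr_ge0 ?powR_ge0 ?(addr_ge0 Cp0 Lp0).
have vB := rescaled_l1 (M := M) (K := K) mpsi psiW ig hG1.
have term (j : int) : 2 `^ (- (j%:~R * (n.+1%:R * L / K))) *
    normc (Cintegral (lebesgue_rV n.+1) setT (fun x =>
            LPm phi m j f x * LP phi j g x *
            (normc (LP phi j g x) `^ (M - 2) *
             low_freq_sum phi (n.+1%:R * L / K) M j g x `^ (K - 1))%:C%C)) <=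
    P * \int[lebesgue_rV n.+1]_z (normc (f z) * scale_error eps g j z).
  pose NL x := nonlinearity M K j (rescaled M K psi g j x).
  have mNL : cmeasurable NL := cmeasurable_scale_nonlinearity M K mpsi psiW psiL ig j.
  have NLB x : normc (NL x) <= CL * B `^ (M * K - 2) * B.
    exact: (scale_nonlinearity_bound hM hK psiW G10 (vB j x)).
  have PE z := scale_pairing_bound hM hK mpsi mkap Lp0 psiW psiL psiR kapW canc
    eps0 eps1 ig G10 G20 hG1 hG2 j z.
  have [iT TB] := transposed_convolution_bound ik kC iF mNL NLB
    (integrable_scale_error eps0 iF ig j) PE.
  set T := (fun x => _) in iT TB.
  rewrite (_ : (fun x => _ * _) = (fun x => (2 `^ (j%:~R * (n.+1%:R * L / K)))%:C%C * T x)).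
    rewrite (CintegralZ _ iT) normcM normcR ger0_norm ?powR_ge0//.
    by rewrite mulrA -powR2D addNr powRr0 mul1r.
  apply/funext => x.
  have lpE i : LP phi i g x = ((2 ^ i) ^+ n.+1)%:C%C * averages psi g i x.
    rewrite /LP (scaleP _ i x ig) /averages.
    rewrite -(CintegralZ _ (averages_integrable mpsi psiW ig i x)).
    by apply: eq_Cintegral => z; rewrite mulrA.
  rewrite -mulrA.
  have NLE := lp_nonlinearity hM hK (n := n) (b := averages psi g ^~ x)
    (v := rescaled M K psi g j x) (erefl (n.+1%:R * (M * K - 1) / K)) B0 lpE (fun i => erefl) (vB j x).
  apply: etrans (congr1 (fun w => LPm phi m j f x * w) NLE) _.
  by rewrite mulrCA /LPm (LPm_symbol j tphi hom) (scaleK _ j x iF).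
apply: ge_ereal_sup => _ [X [fX _] <-].
apply: (@le_trans _ _ (\sum_(j \in X) P * \int[lebesgue_rV n.+1]_z (normc (f z) * scale_error eps g j z))%:E).
  by rewrite -fsumEFin//; apply: lee_fsum => // j _; rewrite lee_fin.
rewrite lee_fin -mulr_fsumr.
apply: (le_trans (ler_wpM2l P0 (sum_weighted_scale_error eps0 iF ig hC4 fX))).
have -> : P * (C4 * (L1norm f * L1norm g)) = C0 * L1norm f * L1norm g `^ L.
  have L0 : 0 < L by rewrite /L subr_gt0; nra.
  rewrite -(mulr_powRB1 A0 L0) /P /C0 /B [G1 * (Cp * _)]mulrA (powRM _ (mulr_ge0 G10 Cp0) A0).
  have -> : L - 1 = M * K - 2 by rewrite /L; ring.
  ring.
by rewrite -subr_ge0 -!mulrBl addrC addKr mul1r mulr_ge0 ?powR_ge0.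
Qed.
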